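(* Let $X$ be a smooth projective geometrically irreducible curve over $\mathbb{F}_q$. The map $$\mathrm{Cl}\,X\longrightarrow\mathbb{P}\mathrm{Bun}_2^{\rm dec}X,\qquad[D]\longmapsto c_D$$ is surjective with fibres of the form $\{[D],[-D]\}$.
   Context: $\mathrm{Cl}\,X$ is the divisor class group of $X$. $\mathbb{P}\mathrm{Bun}_2X$ is the set of isomorphism classes of rank $2$ vector bundles on $X$ modulo tensoring with line bundles, and $\mathbb{P}\mathrm{Bun}_2^{\rm dec}X$ is the subset of classes of bundles that are isomorphic to a direct sum of two line bundles. $c_D$ denotes the class of $\mathcal{L}_D\oplus\mathcal{O}_X$, where $\mathcal{L}_D$ is the line bundle associated to the divisor $D$. *)

(* Defs.v *)
From HB Require Import structures.
From mathcomp Require Import all_boot all_algebra.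
From mathcomp Require Import boolp classical_sets functions.
From mathcomp Require Import mpoly freeg.

Set Implicit Arguments.
Unset Strict Implicit.
Unset Printing Implicit Defensive.

Import GRing.Theory.
Local Open Scope ring_scope.
Local Open Scope quotient_scope.

(* The topological space Proj(k[x_0, ..., x_n] / (T)): its points are the    *)
(* homogeneous primes that contain T and omit some coordinate x_i.           *)

Record homog_prime (k : fieldType) (n : nat) (p : {mpoly k[n.+1]} -> Prop) :
    Prop := HomogPrime {
  hp_0 : p 0;
  hp_add : forall f g, p f -> p g -> p (f + g);
  hp_mul : forall f g, p g -> p (f * g);
  hp_prime : forall f g, p (f * g) -> p f \/ p g;
  hp_homog : forall f d, p f -> p (pihomog mdeg d f);
  hp_relevant : exists i, ~ p 'X_i }.

Record proj_point (k : fieldType) (n : nat) (T : {mpoly k[n.+1]} -> Prop) :=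
    ProjPoint {
  pt_ideal :> {mpoly k[n.+1]} -> Prop;
  pt_prime : homog_prime pt_ideal;
  pt_above : forall f, T f -> pt_ideal f }.

Section ProjTopology.
Variables (k : fieldType) (n : nat) (T : {mpoly k[n.+1]} -> Prop).

(* U is a union of basic open sets D_+(f), f homogeneous. *)
Definition zariski_open (U : proj_point T -> Prop) : Prop :=
  forall p, U p -> exists (d : nat) (f : {mpoly k[n.+1]}),
    [/\ f \is d.-homog, ~ p f & forall q : proj_point T, ~ q f -> U q].

Record opens := Open {
  open_set :> proj_point T -> Prop;
  open_setP : zariski_open open_set }.

Definition proj_irreducible : Prop :=
  inhabited (proj_point T) /\
  forall U V : opens, (exists p, U p) -> (exists p, V p) ->
    exists p, U p /\ V p.

(* A strict chain of d + 1 points under specialisation, that is, a strict    *)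
(* chain of d + 1 irreducible closed subsets.                                *)
Definition has_chain (d : nat) : Prop :=
  exists c : 'I_d.+1 -> proj_point T, forall i j : 'I_d.+1, (i < j)%N ->
    (forall f, c i f -> c j f) /\ (exists f, c j f /\ ~ c i f).

Definition proj_dim (d : nat) : Prop := has_chain d /\ ~ has_chain d.+1.

End ProjTopology.

Lemma fraction_div (R : idomainType) (z : {fraction R}) :
  exists x y : R, y != 0 /\ z = tofrac x / tofrac y.
Proof.
exists (\n_(repr z)), (\d_(repr z)); split; first exact: denom_ratioP.
apply: (canRL (mulfK _)); first by rewrite tofrac_eq0 denom_ratioP.
rewrite -[z in LHS]reprK; unlock FracField.tofrac; rewrite -[LHS]FracField.pi_mul.
apply/eqmodP; rewrite /= /FracField.equivf /FracField.mulf /=.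
rewrite !numden_Ratio ?oner_neq0 ?mulf_neq0 ?denom_ratioP ?oner_neq0 //.
by rewrite !mulr1 mulrC reprK.
Qed.

Section FracQuot.
Variables (R : comNzRingType) (P : prime_idealr R).

Definition dom_quot := {ideal_quot P}.
HB.instance Definition _ := GRing.ComNzRing.on dom_quot.

Definition dom_quot_unit : pred dom_quot := fun x => `[< exists y, y * x = 1 >].
Definition dom_quot_inv (x : dom_quot) : dom_quot :=
  if pselect (exists y, y * x = 1) is left h then projT1 (cid h) else x.

Lemma dom_quot_mulVx : {in dom_quot_unit, left_inverse 1 dom_quot_inv *%R}.
Proof.
move=> x /asboolP h; rewrite /dom_quot_inv; case: pselect => // h'.
by case: (cid h').
Qed.

Lemma dom_quot_unitPl (x y : dom_quot) : y * x = 1 -> dom_quot_unit x.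
Proof. by move=> h; apply/asboolP; exists y. Qed.

Lemma dom_quot_inv_out : {in [predC dom_quot_unit], dom_quot_inv =1 id}.
Proof. by move=> x /asboolP h; rewrite /dom_quot_inv; case: pselect. Qed.

HB.instance Definition _ := GRing.ComNzRing_hasMulInverse.Build dom_quot
  dom_quot_mulVx dom_quot_unitPl dom_quot_inv_out.
HB.instance Definition _ := GRing.ComUnitRing_isIntegral.Build dom_quot
  (@Quotient.rquot_IdomainAxiom _ P).

Definition dom_quot_pi (a : R) : dom_quot := \pi_{ideal_quot P} a.
Definition frac_quot_pi (a : R) : {fraction dom_quot} := tofrac (dom_quot_pi a).

Lemma frac_quot_pi_zmod : zmod_morphism frac_quot_pi.
Proof.
move=> a b; rewrite /frac_quot_pi -tofracB; congr tofrac.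
by rewrite /dom_quot_pi rmorphB.
Qed.
Lemma frac_quot_pi_monoid : monoid_morphism frac_quot_pi.
Proof.
split=> [|a b]; rewrite /frac_quot_pi.
  by rewrite -tofrac1; congr tofrac; exact: rmorph1.
by rewrite -tofracM; congr tofrac; rewrite /dom_quot_pi rmorphM.
Qed.
HB.instance Definition _ :=
  GRing.isZmodMorphism.Build R {fraction dom_quot} frac_quot_pi frac_quot_pi_zmod.
HB.instance Definition _ :=
  GRing.isMonoidMorphism.Build R {fraction dom_quot} frac_quot_pi
    frac_quot_pi_monoid.

Lemma frac_quot_pi_eq0 a : (frac_quot_pi a == 0) = (a \in P).
Proof.
rewrite /frac_quot_pi tofrac_eq0 -[a in RHS]subr0 Quotient.idealrBE.
by congr (_ == _); symmetry; exact: rmorph0.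
Qed.

Lemma frac_quot_piP (z : {fraction dom_quot}) :
  exists a b, b \notin P /\ z = frac_quot_pi a / frac_quot_pi b.
Proof.
have piK (x : dom_quot) : dom_quot_pi (repr x) = x by exact: reprK.
have [x [y [y0 ->]]] := fraction_div z.
exists (repr x), (repr y).
by rewrite -frac_quot_pi_eq0 /frac_quot_pi !piK tofrac_eq0 y0.
Qed.

(* Frac(R/P), packaged opaquely so that conversion never unfolds the        *)
(* quotient constructions.                                                   *)
Lemma frac_quot : {K : fieldType & {f : {rmorphism R -> K} |
  (forall a, (f a == 0) = (a \in P)) /\
  (forall z, exists a b, b \notin P /\ z = f a / f b)}}.
Proof.
by exists {fraction dom_quot}, frac_quot_pi; split;
  [exact: frac_quot_pi_eq0 | exact: frac_quot_piP].
Qed.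

End FracQuot.

(* Projective varieties: integral closed subschemes Proj(k[x]/I) of P^n_k.   *)

Record proj_variety (k : fieldType) := ProjVariety {
  amb_dim : nat;
  var_ideal : prime_idealr {mpoly k[amb_dim.+1]};
  var_homog : forall f d, f \in var_ideal -> pihomog mdeg d f \in var_ideal }.

Section Variety.
Variables (k : fieldType) (X : proj_variety k).
Local Notation n := (amb_dim X).
Local Notation I := (var_ideal X).
Local Notation S := {mpoly k[n.+1]}.

Definition point := proj_point (fun f : S => f \in I).

Definition var_dim (d : nat) : Prop := proj_dim (fun f : S => f \in I) d.

(* The base change of X to L is Proj of L[x] modulo the extension of I.      *)
Definition geom_irreducible : Prop :=
  forall (L : fieldType) (phi : {rmorphism k -> L}),
    proj_irreducible (fun g : {mpoly L[n.+1]} =>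
      exists2 f, f \in I & g = map_mpoly phi f).

Definition jacobian_minor (r : nat) (f : 'I_r -> S) (c : 'I_r -> 'I_n.+1) : S :=
  \det (\matrix_(i < r, j < r) mderiv (c j) (f i)).

(* The Jacobian matrix of the elements of I has rank r over the residue      *)
(* field of the affine cone at p.                                            *)
Definition jacobian_rank (p : point) (r : nat) : Prop :=
  (exists (f : 'I_r -> S) (c : 'I_r -> 'I_n.+1),
     (forall i, f i \in I) /\ ~ p (jacobian_minor f c)) /\
  (forall (f : 'I_r.+1 -> S) (c : 'I_r.+1 -> 'I_n.+1),
     (forall i, f i \in I) -> p (jacobian_minor f c)).

(* Smoothness over k, of relative dimension d: the Jacobian condition at     *)
(* every point, in homogeneous coordinates.                                  *)
Definition smooth_var (d : nat) : Prop :=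
  (d <= n)%N /\ forall p : point, jacobian_rank p (n - d).

(* The fraction field of the homogeneous coordinate ring S/I; the function   *)
(* field of X is its subfield of elements of degree 0.                       *)
Definition cone_field : fieldType := projT1 (frac_quot I).
Definition cone_elt : {rmorphism S -> cone_field} := sval (projT2 (frac_quot I)).

Definition ratfun (z : cone_field) : Prop :=
  exists (d : nat) (a b : S),
    [/\ a \is d.-homog, b \is d.-homog, b \notin I
      & z = cone_elt a / cone_elt b].

(* The local ring at p and its maximal ideal, inside the function field.     *)
Definition regular_at (p : point) (z : cone_field) : Prop :=
  exists (d : nat) (a b : S),
    [/\ a \is d.-homog, b \is d.-homog, ~ p b
      & z = cone_elt a / cone_elt b].

Definition vanishing_at (p : point) (z : cone_field) : Prop :=
  exists (d : nat) (a b : S),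
    [/\ a \is d.-homog, b \is d.-homog, p a, ~ p b
      & z = cone_elt a / cone_elt b].

Definition uniformizer (p : point) (t : cone_field) : Prop :=
  [/\ t != 0, vanishing_at p t
    & forall z, vanishing_at p z -> exists2 w, regular_at p w & z = w * t].

Definition unit_at (p : point) (u : cone_field) : Prop :=
  [/\ u != 0, regular_at p u & regular_at p u^-1].

(* v_p(z) = m for z != 0.  The local rings at the closed points of a smooth  *)
(* curve are discrete valuation rings: uniformizers exist, and the condition *)
(* does not depend on the one used.                                          *)
Definition has_order (p : point) (z : cone_field) (m : int) : Prop :=
  forall t, uniformizer p t -> exists2 u, unit_at p u & z = t ^ m * u.

Lemma cone_elt_eq0 (a : S) : (cone_elt a == 0) = (a \in I).
Proof. exact: (svalP (projT2 (frac_quot I))).1. Qed.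

Lemma cone_fieldP (z : cone_field) :
  exists a b, b \notin I /\ z = cone_elt a / cone_elt b.
Proof. exact: (svalP (projT2 (frac_quot I))).2. Qed.

Lemma pt_one (p : point) : ~ p 1.
Proof.
have [_ _ hM _ _ [i Xi]] := pt_prime p => p1; apply: Xi.
by rewrite -[X in p X]mulr1; apply: hM.
Qed.

Lemma pt_nmul (p : point) (a b : S) : ~ p a -> ~ p b -> ~ p (a * b).
Proof. by have [_ _ _ hP _ _] := pt_prime p => na nb /hP[]. Qed.

Lemma pt_cone (p : point) (a : S) : ~ p a -> cone_elt a != 0.
Proof. by move=> na; rewrite cone_elt_eq0; apply/negP => /(pt_above p). Qed.

Lemma ratfun1 : ratfun 1.
Proof.
exists 0%N, 1, 1; rewrite idealr1 rmorph1 divr1; split => //; exact: dhomog1.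
Qed.

Lemma regular1 p : regular_at p 1.
Proof.
exists 0%N, 1, 1; rewrite rmorph1 divr1; split => //; try exact: dhomog1.
exact: pt_one.
Qed.

Lemma regularM p z w : regular_at p z -> regular_at p w -> regular_at p (z * w).
Proof.
move=> [d [a [b [ha hb nb ->]]]] [e [a' [b' [ha' hb' nb' ->]]]].
exists (d + e)%N, (a * a'), (b * b'); split; try exact: dhomogM.
  exact: pt_nmul.
by rewrite !rmorphM mulf_div.
Qed.

Lemma regularB p z w : regular_at p z -> regular_at p w -> regular_at p (z - w).
Proof.
move=> [d [a [b [ha hb nb ->]]]] [e [a' [b' [ha' hb' nb' ->]]]].
exists (d + e)%N, (a * b' - a' * b), (b * b'); split; try exact: dhomogM.
- by apply: rpredB; [exact: dhomogM | rewrite addnC; exact: dhomogM].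
- exact: pt_nmul.
rewrite rmorphB !rmorphM -[in LHS]mulNr.
by rewrite addf_div ?(@pt_cone p) // mulNr.
Qed.

Lemma ratfunM z w : ratfun z -> ratfun w -> ratfun (z * w).
Proof.
move=> [d [a [b [ha hb nb ->]]]] [e [a' [b' [ha' hb' nb' ->]]]].
exists (d + e)%N, (a * a'), (b * b'); split; try exact: dhomogM.
  by rewrite prime_idealrM negb_or nb.
by rewrite !rmorphM mulf_div.
Qed.

Lemma ratfunV z : z != 0 -> ratfun z -> ratfun z^-1.
Proof.
move=> z0 [d [a [b [ha hb nb Ez]]]].
exists d, b, a; split => //; last by rewrite Ez invf_div.
by rewrite -cone_elt_eq0; apply: contraNneq z0 => a0; rewrite Ez a0 mul0r.
Qed.

Lemma ratfunB z w : ratfun z -> ratfun w -> ratfun (z - w).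
Proof.
move=> [d [a [b [ha hb nb ->]]]] [e [a' [b' [ha' hb' nb' ->]]]].
exists (d + e)%N, (a * b' - a' * b), (b * b'); split; try exact: dhomogM.
- by apply: rpredB; [exact: dhomogM | rewrite addnC; exact: dhomogM].
- by rewrite prime_idealrM negb_or nb.
rewrite rmorphB !rmorphM -[in LHS]mulNr.
by rewrite addf_div ?cone_elt_eq0 // mulNr.
Qed.

Lemma regular_ratfun p z : regular_at p z -> ratfun z.
Proof.
move=> [d [a [b [ha hb nb ->]]]]; exists d, a, b; split => //.
by apply/negP => /(pt_above p).
Qed.

Lemma unit_at1 p : unit_at p 1.
Proof. by split; rewrite ?invr1 ?oner_neq0 //; exact: regular1. Qed.

Lemma unit_at_div p u v : unit_at p u -> unit_at p v -> unit_at p (u / v).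
Proof.
move=> [u0 ru riu] [v0 rv riv]; split.
- by apply: mulf_neq0 => //; rewrite invr_eq0.
- exact: regularM.
- by rewrite invf_div; apply: regularM.
Qed.

Definition closed_point_pred (p : point) : Prop :=
  forall q : point, (forall f, p f -> q f) -> (forall f, q f -> p f).

Record closed_point := ClosedPoint {
  cp_point :> point;
  cp_closed : closed_point_pred cp_point }.
HB.instance Definition _ := gen_eqMixin closed_point.
HB.instance Definition _ := gen_choiceMixin closed_point.

Definition divisor := {freeg closed_point / int}.
HB.instance Definition _ := GRing.Zmodule.on divisor.

Definition principal_prop (D : divisor) : Prop :=
  exists z : cone_field, [/\ ratfun z, z != 0
    & forall P : closed_point, has_order P z (coeff P D)].

Definition principal : pred divisor := fun D => `[< principal_prop D >].

Lemma principal_zmod_closed : zmod_closed principal.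
Proof.
split=> [|D E /asboolP[z [rz z0 hz]] /asboolP[w [rw w0 hw]]]; apply/asboolP.
  exists 1; split; rewrite ?oner_neq0 //; first exact: ratfun1.
  move=> P t _; exists 1; first exact: unit_at1.
  by rewrite raddf0 expr0z mul1r.
exists (z / w); split.
- by apply: ratfunM => //; apply: ratfunV.
- by apply: mulf_neq0 => //; rewrite invr_eq0.
move=> P t ht; have [t0 _ _] := ht.
have [u hu ->] := hz P t ht; have [v hv ->] := hw P t ht.
exists (u / v); first exact: unit_at_div.
by rewrite raddfB /= expfzDr // -invr_expz invfM mulrACA.
Qed.

HB.instance Definition _ :=
  GRing.isZmodClosed.Build divisor principal principal_zmod_closed.

Definition principal_subgroup : zmodClosed divisor :=
  GRing.ZmodClosed.clone divisor principal _.

Definition Cl : zmodType := Quotient.quot principal_subgroup.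
Definition cl (D : divisor) : Cl := \pi_(Quotient.quot principal_subgroup) D.

Local Notation opens := (opens (fun f : S => f \in I)).

Definition osub (V U : opens) : Prop := forall p : point, V p -> U p.

(* Functions on U that are locally given by one rational function z that     *)
(* satisfies the condition A q z at each point q where it is used.           *)
Definition local_section (A : point -> cone_field -> Prop) (U : opens)
    (s : {p : point | U p} -> cone_field) : Prop :=
  forall p : {p : point | U p}, exists V : opens, V (sval p) /\
    exists z, forall q : {p : point | U p}, V (sval q) ->
      s q = z /\ A (sval q) z.

Lemma open_cap_subproof (U V : opens) : zariski_open (fun p => U p /\ V p).
Proof.
move=> p [/(open_setP (o := U))[d [f [hf pf Uf]]]].
move=> /(open_setP (o := V))[e [g [hg pg Vg]]].
exists (d + e)%N, (f * g); split; [exact: dhomogM | exact: pt_nmul |].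
move=> q nq; have [_ _ hM _ _ _] := pt_prime q.
split; [apply: Uf => qf | apply: Vg => qg]; apply: nq; last exact: hM.
by rewrite mulrC; apply: hM.
Qed.
Definition open_cap (U V : opens) : opens := Open (@open_cap_subproof U V).

Lemma open_full_subproof :
  zariski_open (fun _ : proj_point (fun f : S => f \in I) => True).
Proof.
by move=> p _; exists 0%N, 1; split; [exact: dhomog1 | exact: pt_one |].
Qed.
Definition open_full : opens := Open open_full_subproof.

Lemma local_section_op2 (A B C : point -> cone_field -> Prop) U op s t :
  (forall p z w, A p z -> B p w -> C p (op z w)) ->
  @local_section A U s -> @local_section B U t ->
  @local_section C U (fun p => op (s p) (t p)).
Proof.
move=> hop hs ht p; have [V [Vp [z hz]]] := hs p; have [W [Wp [w hw]]] := ht p.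
exists (open_cap V W); split => //; exists (op z w) => q [/= Vq Wq].
by have [-> Az] := hz q Vq; have [-> Aw] := hw q Wq; split => //; apply: hop.
Qed.

Lemma local_section_cst (A : point -> cone_field -> Prop) U z :
  (forall p, A p z) -> @local_section A U (fun=> z).
Proof. by move=> h p; exists open_full; split => //; exists z. Qed.

Definition incl (U V : opens) (h : osub V U) (p : {p : point | V p}) :
  {p : point | U p} := exist _ (sval p) (h _ (svalP p)).

Lemma local_section_res A U V (h : osub V U) s :
  @local_section A U s -> @local_section A V (s \o incl h).
Proof.
move=> hs p; have [W [Wp [z hz]]] := hs (incl h p).
by exists W; split => //; exists z => q Wq; apply: hz.
Qed.

Definition regular_fun (U : opens) : pred ({p : point | U p} -> cone_field) :=
  fun s => `[< local_section regular_at s >].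

Lemma regular_fun_subring U : subring_closed (@regular_fun U).
Proof.
split=> [|s t /asboolP hs /asboolP ht|s t /asboolP hs /asboolP ht];
  apply/asboolP.
- by apply: local_section_cst => p; apply: regular1.
- exact: local_section_op2 (@regularB) hs ht.
- exact: local_section_op2 (@regularM) hs ht.
Qed.

(* O_X(U).  It is the zero ring when U is empty. *)
Record OX (U : opens) := MkOX {
  OX_fun : {p : point | U p} -> cone_field;
  OX_funP : OX_fun \in @regular_fun U }.
HB.instance Definition _ U := [isSub for @OX_fun U].
HB.instance Definition _ U := [Choice of OX U by <:].
HB.instance Definition _ U := GRing.SubChoice_isSubComPzRing.Build _
  (@regular_fun U) (OX U) (regular_fun_subring U).

Lemma OX_local U (a : OX U) : local_section regular_at (OX_fun a).
Proof. exact/asboolP/OX_funP. Qed.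

Definition OX_res U V (h : osub V U) (a : OX U) : OX V :=
  MkOX (asboolT (local_section_res h (OX_local a))).

Definition covers (J : Type) (V : J -> opens) (U : opens) : Prop :=
  forall p : point, U p -> exists j, V j p.

Record omodule := OModule {
  sec : forall U : opens, lmodType (OX U);
  res : forall U V : opens, osub V U -> sec U -> sec V;
  resD : forall U V (h : osub V U) s t, res h (s + t) = res h s + res h t;
  resZ : forall U V (h : osub V U) a s, res h (a *: s) = OX_res h a *: res h s;
  res_id : forall U (h : osub U U) s, res h s = s;
  res_comp : forall U V W (h : osub V U) (h' : osub W V) (h'' : osub W U) s,
    res h' (res h s) = res h'' s;
  sec_eq : forall (J : Type) (V : J -> opens) U (h : forall j, osub (V j) U),
    covers V U -> forall s t : sec U,
    (forall j, res (h j) s = res (h j) t) -> s = t;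
  sec_glue : forall (J : Type) (V : J -> opens) U (h : forall j, osub (V j) U),
    covers V U -> forall s : (forall j, sec (V j)),
    (forall i j W (hi : osub W (V i)) (hj : osub W (V j)),
       res hi (s i) = res hj (s j)) ->
    exists t : sec U, forall j, res (h j) t = s j }.

Record omorphism (E F : omodule) := OMorphism {
  omap :> forall U : opens, {linear sec E U -> sec F U};
  omap_res : forall U V (h : osub V U) s,
    omap V (res h s) = res h (omap U s) }.

Definition oiso (E F : omodule) : Prop :=
  exists (f : omorphism E F) (g : omorphism F E),
    forall U, cancel (f U) (g U) /\ cancel (g U) (f U).

Record obilinear (E F G : omodule) := OBilinear {
  obil :> forall U : opens, sec E U -> sec F U -> sec G U;
  obil_l : forall U t, linear (fun s => @obil U s t);
  obil_r : forall U s, linear (@obil U s);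
  obil_res : forall U V (h : osub V U) s t,
    obil (res h s) (res h t) = res h (obil s t) }.
Arguments obil {E F G} _ U _ _.

(* T is the tensor product of E and F over O_X, by its universal property. *)
Definition is_otensor (E F T : omodule) : Prop :=
  exists b : obilinear E F T, forall (M : omodule) (c : obilinear E F M),
    exists f : omorphism T M,
      (forall U s t, f U (b U s t) = c U s t) /\
      (forall g : omorphism T M, (forall U s t, g U (b U s t) = c U s t) ->
         forall U x, g U x = f U x).

(* Locally free of rank r: near each point, r sections e_i over some U       *)
(* induce an isomorphism of O_U^r with the restriction of E to U.            *)
Definition vector_bundle (r : nat) (E : omodule) : Prop :=
  forall p : point, exists U : opens, U p /\
    exists e : 'I_r -> sec E U, forall V (h : osub V U) (s : sec E V),
      exists! a : 'I_r -> OX V, s = \sum_(i < r) a i *: res h (e i).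

Definition line_bundle := vector_bundle 1.

Lemma sig_pt_inj (U : opens) (p q : {p : point | U p}) :
  sval p = sval q -> p = q.
Proof. by case: p q => p ? [q ?] /= ?; apply: eq_exist. Qed.

Lemma local_section_glue (A : point -> cone_field -> Prop) (J : Type)
    (V : J -> opens) U (h : forall j, osub (V j) U)
    (s : forall j, {p : point | V j p} -> cone_field) :
  covers V U -> (forall j, local_section A (s j)) ->
  (forall i j W (hi : osub W (V i)) (hj : osub W (V j)),
     s i \o incl hi = s j \o incl hj) ->
  exists2 t, @local_section A U t & forall j, t \o incl (h j) = s j.
Proof.
move=> cov hs comp.
pose ix (p : {p | U p}) := cid (cov _ (svalP p)).
pose t (p : {p | U p}) := s (projT1 (ix p)) (exist _ (sval p) (projT2 (ix p))).
have tE j (p : {p | V j p}) : t (incl (h j) p) = s j p.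
  rewrite /t; case: (ix _) => i /= ip.
  have hi : osub (open_cap (V i) (V j)) (V i) by move=> ? [].
  have hj : osub (open_cap (V i) (V j)) (V j) by move=> ? [].
  have := congr1 (fun f => f (exist (open_cap (V i) (V j)) (sval p)
    (conj ip (svalP p)))) (comp _ _ _ hi hj).
  rewrite /= /incl /= => E.
  apply: etrans (etrans _ E) _; first by congr (s i _); apply: sig_pt_inj.
  by congr (s j _); apply: sig_pt_inj.
exists t; last by move=> j; apply/funext => p; apply: tE.
move=> p; have [j jp] := cov _ (svalP p).
have [W [Wp [z hz]]] := hs j (exist _ (sval p) jp).
exists (open_cap W (V j)); split => //; exists z => q [Wq jq].
have [Ez Az] := hz (exist _ (sval q) jq) Wq; split => //.
by rewrite -Ez -tE; congr t; apply: sig_pt_inj.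
Qed.

Lemma OX_resD U V (h : osub V U) (a b : OX U) :
  OX_res h (a + b) = OX_res h a + OX_res h b.
Proof. by apply: val_inj. Qed.

Lemma OX_resZ U V (h : osub V U) (a : OX U) (s : (OX U)^o) :
  OX_res h (a *: s) = OX_res h a *: (OX_res h s : (OX V)^o).
Proof. by apply: val_inj. Qed.

Lemma incl_id U (h : osub U U) p : incl h p = p.
Proof. exact: sig_pt_inj. Qed.

Lemma OX_res_id U (h : osub U U) (a : OX U) : OX_res h a = a.
Proof. by apply: val_inj; apply/funext => p /=; rewrite incl_id. Qed.

Lemma incl_comp U V W (h : osub V U) (h' : osub W V) (h'' : osub W U) p :
  incl h (incl h' p) = incl h'' p.
Proof. exact: sig_pt_inj. Qed.

Lemma OX_res_comp U V W (h : osub V U) (h' : osub W V) (h'' : osub W U)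
  (a : OX U) : OX_res h' (OX_res h a) = OX_res h'' a.
Proof. by apply: val_inj; apply/funext => p /=; rewrite (incl_comp _ _ h''). Qed.

Lemma fun_cover_eq (J : Type) (V : J -> opens) U (h : forall j, osub (V j) U)
    (s t : {p : point | U p} -> cone_field) :
  covers V U -> (forall j, s \o incl (h j) = t \o incl (h j)) -> s = t.
Proof.
move=> cov E; apply/funext => p; have [j jp] := cov _ (svalP p).
have := congr1 (fun f => f (exist (V j) (sval p) jp)) (E j).
rewrite /=; have -> // : incl (h j) (exist (V j) (sval p) jp) = p.
exact: sig_pt_inj.
Qed.

Lemma OX_eq (J : Type) (V : J -> opens) U (h : forall j, osub (V j) U) :
  covers V U -> forall s t : OX U,
  (forall j, OX_res (h j) s = OX_res (h j) t) -> s = t.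
Proof.
move=> cov s t E; apply: val_inj; apply: (fun_cover_eq (h := h) cov) => j.
exact: (congr1 (@OX_fun (V j)) (E j)).
Qed.

Lemma OX_glue (J : Type) (V : J -> opens) U (h : forall j, osub (V j) U) :
  covers V U -> forall s : (forall j, OX (V j)),
  (forall i j W (hi : osub W (V i)) (hj : osub W (V j)),
     OX_res hi (s i) = OX_res hj (s j)) ->
  exists t : OX U, forall j, OX_res (h j) t = s j.
Proof.
move=> cov s E.
have [|i j W hi hj|t ht tE] := local_section_glue (A := regular_at) h
  (s := fun j => OX_fun (s j)) cov.
- by move=> j; apply: OX_local.
- exact: (congr1 (@OX_fun W) (E i j W hi hj)).
by exists (MkOX (asboolT ht)) => j; apply: val_inj; apply: tE.
Qed.

Definition structure_sheaf : omodule :=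
  @OModule (fun U => (OX U)^o) (@OX_res) (@OX_resD) (@OX_resZ) (@OX_res_id)
    (@OX_res_comp) OX_eq OX_glue.

Section DirectSum.
Variables E F : omodule.

Definition osum_res U V (h : osub V U) (s : (sec E U * sec F U)%type) :
  (sec E V * sec F V)%type := (res h s.1, res h s.2).

Lemma osum_resD U V (h : osub V U) s t :
  osum_res h (s + t) = osum_res h s + osum_res h t.
Proof. by rewrite /osum_res !resD. Qed.

Lemma osum_resZ U V (h : osub V U) (a : OX U) s :
  osum_res h (a *: s) = OX_res h a *: osum_res h s.
Proof. by rewrite /osum_res !resZ. Qed.

Lemma osum_res_id U (h : osub U U) s : osum_res h s = s.
Proof. by case: s => s t; rewrite /osum_res !res_id. Qed.

Lemma osum_res_comp U V W (h : osub V U) (h' : osub W V) (h'' : osub W U) s :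
  osum_res h' (osum_res h s) = osum_res h'' s.
Proof. by rewrite /osum_res /= !(res_comp h h' h''). Qed.

Lemma osum_eq (J : Type) (V : J -> opens) U (h : forall j, osub (V j) U) :
  covers V U -> forall s t : (sec E U * sec F U)%type,
  (forall j, osum_res (h j) s = osum_res (h j) t) -> s = t.
Proof.
move=> cov [s1 s2] [t1 t2] EQ; congr pair; apply: (sec_eq (h := h) cov) => j.
  by have /(congr1 fst) := EQ j.
by have /(congr1 snd) := EQ j.
Qed.

Lemma osum_glue (J : Type) (V : J -> opens) U (h : forall j, osub (V j) U) :
  covers V U -> forall s : (forall j, (sec E (V j) * sec F (V j))%type),
  (forall i j W (hi : osub W (V i)) (hj : osub W (V j)),
     osum_res hi (s i) = osum_res hj (s j)) ->
  exists t : (sec E U * sec F U)%type, forall j, osum_res (h j) t = s j.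
Proof.
move=> cov s EQ.
have [|t1 t1E] := sec_glue h cov (s := fun j => (s j).1).
  by move=> i j W hi hj; have /(congr1 fst) := EQ i j W hi hj.
have [|t2 t2E] := sec_glue h cov (s := fun j => (s j).2).
  by move=> i j W hi hj; have /(congr1 snd) := EQ i j W hi hj.
exists (t1, t2) => j; by rewrite /osum_res /= t1E t2E; case: (s j).
Qed.

Definition osum : omodule :=
  @OModule (fun U => (sec E U * sec F U)%type) (@osum_res) (@osum_resD)
    (@osum_resZ) (@osum_res_id) (@osum_res_comp) osum_eq osum_glue.

End DirectSum.

(* The line bundle L_D:                                                      *)
(*   L_D(U) = {z | v_P(z) + D(P) >= 0 for all closed points P of U}.         *)

Section LineBundle.
Variable D : divisor.

Definition LD_at (p : point) (z : cone_field) : Prop :=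
  ratfun z /\
  forall (c : closed_point_pred p) t, uniformizer p t ->
    regular_at p (t ^ coeff (ClosedPoint c) D * z).

Lemma LD_at0 p : LD_at p 0.
Proof.
by split=> [|c t _]; rewrite -?(subrr 1) ?mulrBr; last rewrite subrr -(subrr 1);
  [apply: ratfunB; exact: ratfun1 | apply: regularB; exact: regular1].
Qed.

Lemma LD_atB p z w : LD_at p z -> LD_at p w -> LD_at p (z - w).
Proof.
move=> [rz hz] [rw hw]; split=> [|c t ht]; first exact: ratfunB.
by rewrite mulrBr; apply: regularB; [apply: hz | apply: hw].
Qed.

Lemma LD_atM p a z : regular_at p a -> LD_at p z -> LD_at p (a * z).
Proof.
move=> ra [rz hz]; split=> [|c t ht].
  by apply: ratfunM => //; apply: regular_ratfun ra.
by rewrite mulrCA; apply: regularM => //; apply: hz.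
Qed.

Definition LD_pred (U : opens) : pred ({p : point | U p} -> cone_field) :=
  fun s => `[< local_section LD_at s >].

Lemma LD_zmod_closed U : zmod_closed (@LD_pred U).
Proof.
split=> [|s t /asboolP hs /asboolP ht]; apply/asboolP.
  by apply: local_section_cst => p; apply: LD_at0.
exact: local_section_op2 (@LD_atB) hs ht.
Qed.

Record LD_sec (U : opens) := MkLD {
  LD_fun : {p : point | U p} -> cone_field;
  LD_funP : LD_fun \in @LD_pred U }.
HB.instance Definition _ U := [isSub for @LD_fun U].
HB.instance Definition _ U := [Choice of LD_sec U by <:].
HB.instance Definition _ U := GRing.SubChoice_isSubZmodule.Build _
  (@LD_pred U) (LD_sec U) (LD_zmod_closed U).

Lemma LD_local U (s : LD_sec U) : local_section LD_at (LD_fun s).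
Proof. exact/asboolP/LD_funP. Qed.

Definition LD_scale U (a : OX U) (s : LD_sec U) : LD_sec U :=
  MkLD (asboolT (local_section_op2 (@LD_atM) (OX_local a) (LD_local s))).

Lemma LD_scaleA U (a b : OX U) s :
  LD_scale a (LD_scale b s) = LD_scale (a * b) s.
Proof. by apply: val_inj; apply/funext => p /=; rewrite mulrA. Qed.
Lemma LD_scale1 U : left_id 1 (@LD_scale U).
Proof. by move=> s; apply: val_inj; apply/funext => p /=; rewrite mul1r. Qed.
Lemma LD_scaleDr U : right_distributive (@LD_scale U) +%R.
Proof. by move=> a s t; apply: val_inj; apply/funext => p /=; rewrite mulrDr. Qed.
Lemma LD_scaleDl U s : {morph (@LD_scale U)^~ s : a b / a + b}.
Proof. by move=> a b; apply: val_inj; apply/funext => p /=; rewrite mulrDl. Qed.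

HB.instance Definition _ U := GRing.Zmodule_isLmodule.Build (OX U) (LD_sec U)
  (@LD_scaleA U) (@LD_scale1 U) (@LD_scaleDr U) (@LD_scaleDl U).

Definition LD_res U V (h : osub V U) (s : LD_sec U) : LD_sec V :=
  MkLD (asboolT (local_section_res h (LD_local s))).

Lemma LD_resD U V (h : osub V U) (s t : LD_sec U) :
  LD_res h (s + t) = LD_res h s + LD_res h t.
Proof. by apply: val_inj. Qed.

Lemma LD_resZ U V (h : osub V U) (a : OX U) (s : LD_sec U) :
  LD_res h (a *: s) = OX_res h a *: LD_res h s.
Proof. by apply: val_inj. Qed.

Lemma LD_res_id U (h : osub U U) (s : LD_sec U) : LD_res h s = s.
Proof. by apply: val_inj; apply/funext => p /=; rewrite incl_id. Qed.

Lemma LD_res_comp U V W (h : osub V U) (h' : osub W V) (h'' : osub W U)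
  (s : LD_sec U) : LD_res h' (LD_res h s) = LD_res h'' s.
Proof. by apply: val_inj; apply/funext => p /=; rewrite (incl_comp _ _ h''). Qed.

Lemma LD_eq (J : Type) (V : J -> opens) U (h : forall j, osub (V j) U) :
  covers V U -> forall s t : LD_sec U,
  (forall j, LD_res (h j) s = LD_res (h j) t) -> s = t.
Proof.
move=> cov s t E; apply: val_inj; apply: (fun_cover_eq (h := h) cov) => j.
exact: (congr1 (@LD_fun (V j)) (E j)).
Qed.

Lemma LD_glue (J : Type) (V : J -> opens) U (h : forall j, osub (V j) U) :
  covers V U -> forall s : (forall j, LD_sec (V j)),
  (forall i j W (hi : osub W (V i)) (hj : osub W (V j)),
     LD_res hi (s i) = LD_res hj (s j)) ->
  exists t : LD_sec U, forall j, LD_res (h j) t = s j.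
Proof.
move=> cov s E.
have [|i j W hi hj|t ht tE] := local_section_glue (A := LD_at) h
  (s := fun j => LD_fun (s j)) cov.
- by move=> j; apply: LD_local.
- exact: (congr1 (@LD_fun W) (E i j W hi hj)).
by exists (MkLD (asboolT ht)) => j; apply: val_inj; apply: tE.
Qed.

Definition LD : omodule :=
  @OModule LD_sec (@LD_res) (@LD_resD) (@LD_resZ) (@LD_res_id) (@LD_res_comp)
    LD_eq LD_glue.

End LineBundle.

(* The rank 2 bundles isomorphic to the tensor product of E with some line   *)
(* bundle L; is_otensor E L is closed under isomorphism.                     *)
Definition bun_class (E : omodule) : omodule -> Prop :=
  fun E' => vector_bundle 2 E' /\
    exists L, line_bundle L /\ is_otensor E L E'.

Definition PBun2 : Type :=
  {c : omodule -> Prop | exists E, vector_bundle 2 E /\ c = bun_class E}.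

Definition decomposable (E : omodule) : Prop :=
  exists L M, [/\ line_bundle L, line_bundle M & oiso E (osum L M)].

Definition PBun2dec : Type :=
  {c : PBun2 | exists E, [/\ vector_bundle 2 E, decomposable E
                          & sval c = bun_class E]}.

Definition c_class (D : divisor) : omodule -> Prop :=
  bun_class (osum (LD D) structure_sheaf).

End Variety.

(* Main.v *)
(** A decomposable rank 2 bundle is L_a (+) L_b for divisors a, b, because
    every line bundle L is some L_D: D is read off from the orders of the
    transition functions between local generators of L and a generator at the
    generic point.  Tensoring with L_A adds A to both divisors, so the class of
    L_a (+) L_b depends on a - b only, and surjectivity follows.  For the
    fibres, an isomorphism L_a (+) L_b = L_c (+) L_d is a 2 x 2 matrix of
    rational functions whose determinant generates L_(c+d-a-b) everywhere; the
    two diagonal (or the two antidiagonal) entries are nonzero, and the quotient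
    of their product by the determinant is a regular function on X, hence a
    constant.  So each of these entries is a generator too, which gives
    {[a], [b]} = {[c], [d]}.

    The local theory exploits that k is finite.  At a closed point p with
    x_0 not in p, the residue field is finite, and for a suitable power Q of |k|
    the forms g_j = x_j^Q - x_j x_0^(Q-1) generate p locally, since
    f^Q = x_0^(d(Q-1)) f modulo the g_j for f of degree d; the Jacobian
    condition makes one g_j divide the others in the local ring of X, so it is a
    uniformizer.  The finiteness of residue fields and the constancy of global
    functions both come from the centre on X of a valuation ring. *)

From HB Require Import structures.
From mathcomp Require Import all_boot all_algebra all_field.
From mathcomp Require Import boolp classical_sets functions.
From mathcomp Require Import mpoly freeg ring.
Require Import Defs.

Set Implicit Arguments.
Unset Strict Implicit.
Unset Printing Implicit Defensive.

Import GRing.Theory.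
Local Open Scope ring_scope.

(** * Homogeneous primes and valuation rings *)

(** [has_order] and [L_D] quantify over all uniformizers at a point and would be vacuous at a closed
    point without one. So everything about divisors rests on producing a uniformizer from the
    Jacobian condition, and on showing that no nonzero function is divisible by all its powers.
    Valuation rings enter through one remark: if z^-1 is not a polynomial in z over k, some
    valuation ring has z in its maximal ideal, and it has a centre because X is projective. Over a
    finite field the excluded relation z^-1 = g(z) makes z a root of unity. Hence coordinate ratios
    at a closed point are zero or roots of unity, so fixed by a power of Frobenius; and a nonzero
    function regular everywhere is a root of unity, so a unit everywhere, which is the form of
    constancy used. Every nonempty open set contains the generic point, so a section of O_X or L_D
    is one rational function with a condition at each point. Divisors have finite support, so the
    closed zeros of a form outside I must be finite in number: near a given point they have
    coordinates in some F_Q. *)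

Section HomogeneousComponents.
Variables (k : fieldType) (n : nat).
Local Notation S := {mpoly k[n]}.
Implicit Types (f g : S) (d e : nat).

Lemma pihomog_sum_le N f : exists2 K, (N <= K)%N & f = \sum_(d < K) pihomog mdeg d f.
Proof.
exists (maxn N (mmeasure mdeg f)); first exact: leq_maxl.
by apply: pihomog_partitionE; exact: leq_maxr.
Qed.

Lemma pihomogMl d e f g : f \is e.-homog -> (e <= d)%N ->
  pihomog mdeg d (f * g) = f * pihomog mdeg (d - e) g.
Proof.
move=> hf le_ed; have [K leK Eg] := pihomog_sum_le d.+1 g.
rewrite {1}Eg mulr_sumr raddf_sum /=.
have ltK : (d - e < K)%N by apply: leq_trans leK; rewrite ltnS leq_subr.
rewrite (bigD1 (Ordinal ltK)) //= big1 ?addr0.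
  rewrite pihomog_dE // -{2}(subnKC le_ed); apply: dhomogM => //; exact: pihomogP.
move=> i ne; apply: (pihomog_ne0 (d := (e + i)%N)); last first.
  apply: dhomogM => //; exact: pihomogP.
by apply: contraNneq ne => E; apply/eqP/val_inj => /=; rewrite -E addKn.
Qed.

Lemma pihomogMl0 d e f g : f \is e.-homog -> (d < e)%N ->
  pihomog mdeg d (f * g) = 0.
Proof.
move=> hf lt_de; have [K _ Eg] := pihomog_sum_le 0 g.
rewrite {1}Eg mulr_sumr raddf_sum /= big1 // => i _.
apply: (pihomog_ne0 (d := (e + i)%N)); last by apply: dhomogM => //; exact: pihomogP.
by rewrite gtn_eqF // ltn_addr.
Qed.

Lemma pihomogM d f g : pihomog mdeg d (f * g) =
  \sum_(i < d.+1) pihomog mdeg i f * pihomog mdeg (d - i) g.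
Proof.
have [K leK Ef] := pihomog_sum_le d.+1 f.
rewrite {1}Ef mulr_suml raddf_sum /= (big_ord_widen K
  (fun i => pihomog mdeg i f * pihomog mdeg (d - i) g)) //.
rewrite [RHS]big_mkcond; apply: eq_bigr => i _; rewrite ltnS.
case: leqP => h; first by rewrite (pihomogMl (e := i)) // pihomogP.
by rewrite (pihomogMl0 (e := i)) // pihomogP.
Qed.

End HomogeneousComponents.

(** Primes that need not be homogeneous: contractions of ideals of valuation rings or local rings,
    and ideals given by Zorn's lemma. They become points of Proj through [homog_part]. *)
Record prime_pred (R : comNzRingType) (P : R -> Prop) : Prop := PrimePred {
  pp_0 : P 0;
  pp_add : forall f g, P f -> P g -> P (f + g);
  pp_mul : forall f g, P g -> P (f * g);
  pp_prime : forall f g, P (f * g) -> P f \/ P g }.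

Lemma ideal_sum (R : comNzRingType) (P : R -> Prop) (J : Type) (s : seq J)
    (A : pred J) (F : J -> R) : P 0 -> (forall f g, P f -> P g -> P (f + g)) ->
  (forall i, A i -> P (F i)) -> P (\sum_(i <- s | A i) F i).
Proof. by move=> P0 PD PF; apply: (big_ind P). Qed.

(** For an ideal P this is the largest homogeneous ideal inside P. *)
Definition homog_part (k : fieldType) (n : nat) (P : {mpoly k[n]} -> Prop)
    (f : {mpoly k[n]}) : Prop := forall d, P (pihomog mdeg d f).

Lemma homog_part_homog (k : fieldType) (n : nat) (P : {mpoly k[n]} -> Prop)
    (f : {mpoly k[n]}) d : P 0 -> f \is d.-homog -> (homog_part P f <-> P f).
Proof.
move=> P0 hf; split=> [/(_ d)|Pf e]; first by rewrite pihomog_dE.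
have [<-|ne] := eqVneq d e; last by rewrite (pihomog_ne0 ne hf).
by rewrite pihomog_dE.
Qed.

Lemma homogXi (k : fieldType) (n : nat) (i : 'I_n) :
  ('X_i : {mpoly k[n]}) \is 1.-homog.
Proof. by rewrite dhomogX /= mdeg1. Qed.

(** If f and g both have components outside P, take those of least degrees a and c. In degree a + c
    the product f g is the product of these two plus terms of P, so one of the two would lie in
    P. *)
Lemma homog_part_prime (k : fieldType) (n : nat) (P : {mpoly k[n.+1]} -> Prop) :
  prime_pred P -> (exists i, ~ P 'X_i) -> homog_prime (homog_part P).
Proof.
move=> [P0 PD PM PP] [i0 Pi0].
split=> [d|f g Pf Pg d|f g Pg d|f g Pfg|f d Pf e|].
- by rewrite raddf0.
- by rewrite raddfD; apply: PD; [apply: Pf | apply: Pg].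
- by rewrite pihomogM; apply: ideal_sum => // i _; apply: PM; apply: Pg.
- apply: contrapT => /not_orP[/existsNP Nf /existsNP Ng].
  have [a Na mina] : exists2 a, ~ P (pihomog mdeg a f) &
      forall b, (b < a)%N -> P (pihomog mdeg b f).
    have Hf : exists a, `[< ~ P (pihomog mdeg a f) >].
      by have [a Na] := Nf; exists a; apply/asboolP.
    case: (ex_minnP Hf) => a /asboolP Na mina.
    exists a => // b lt_ba; apply: contrapT => Nb.
    by have := mina b (asboolT Nb); rewrite leqNgt lt_ba.
  have [c Nc minc] : exists2 c, ~ P (pihomog mdeg c g) &
      forall b, (b < c)%N -> P (pihomog mdeg b g).
    have Hg : exists a, `[< ~ P (pihomog mdeg a g) >].
      by have [c Nc] := Ng; exists c; apply/asboolP.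
    case: (ex_minnP Hg) => c /asboolP Nc minc.
    exists c => // b lt_bc; apply: contrapT => Nb.
    by have := minc b (asboolT Nb); rewrite leqNgt lt_bc.
  have lt_a : (a < (a + c).+1)%N by rewrite ltnS leq_addr.
  have := Pfg (a + c)%N; rewrite pihomogM (bigD1 (Ordinal lt_a)) //= addKn.
  set y := \sum_(_ < _ | _) _ => Pxy.
  have Py : P y.
    apply: ideal_sum => // i ne; case: (ltngtP i a) => [lt_ia|lt_ai|E].
    - by rewrite mulrC; apply/PM/mina.
    - apply/PM/minc; rewrite ltn_subLR ?ltn_add2r //.
      by rewrite -ltnS ltn_ord.
    - by case/eqP: ne; apply: val_inj.
  suff /PP[] : P (pihomog mdeg a f * pihomog mdeg c g) by [].
  rewrite -[X in P X](addrK y); apply: PD => //; rewrite -mulN1r; exact: PM.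
- have [<-|ne] := eqVneq d e; first by rewrite pihomog_id.
  by rewrite (pihomog_ne0 ne) // pihomogP.
- by exists i0 => /(homog_part_homog P0 (homogXi k i0)).
Qed.

(** Krull's lemma: take an ideal maximal among those that contain A and no power of x. If f and g
    lie outside it, a power of x is a multiple of f modulo it and another a multiple of g; the
    product of the two powers is then a multiple of f g modulo it. *)
Lemma prime_avoid (R : comNzRingType) (A : R -> Prop) (x : R) :
    A 0 -> (forall f g, A f -> A g -> A (f + g)) ->
    (forall f g, A g -> A (f * g)) -> (forall N, ~ A (x ^+ N)) ->
  exists2 P, prime_pred P & (forall f, A f -> P f) /\ ~ P x.
Proof.
move=> A0 AD AM Ax.
(* the union with A gives the empty chain an upper bound *)
pose good (P : set R) := (forall f, A f -> P f) /\ [/\ forall f g, P f -> P g -> P (f + g),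
  forall f g, P g -> P (f * g) & forall N, ~ P (x ^+ N)].
pose good' (P : set R) := good (fun f => A f \/ P f).
have [F Fg Ftot|P [[PA [PD PM Px]] maxP]] := @Zorn_bigcup R good'.
  split=> [f Af|]; first by left.
  have lift f : (A f \/ (\bigcup_(X in F) X)%classic f) ->
      A f \/ exists2 X, F X & X f by case=> [|[X FX Xf]]; [left | right; exists X].
  split=> [f g Hf Hg|f g Hg|N HN].
  - have [Af|[X FX Xf]] := lift _ Hf; have [Ag|[Y FY Yg]] := lift _ Hg.
    + by left; apply: AD.
    + have [_ [D _ _]] := Fg _ FY.
      by have [|Z] := D f g (or_introl Af) (or_intror Yg); [left | right; exists Y].
    + have [_ [D _ _]] := Fg _ FX.
      by have [|Z] := D f g (or_intror Xf) (or_introl Ag); [left | right; exists X].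
    + have [XY|YX] := Ftot _ _ FX FY.
        have [_ [D _ _]] := Fg _ FY.
        have [|Z] := D f g (or_intror (XY _ Xf)) (or_intror Yg); first by left.
        by right; exists Y.
      have [_ [D _ _]] := Fg _ FX.
      have [|Z] := D f g (or_intror Xf) (or_intror (YX _ Yg)); first by left.
      by right; exists X.
  - have [Ag|[Y FY Yg]] := lift _ Hg; first by left; apply: AM.
    have [_ [_ M _]] := Fg _ FY.
    by have [|Z] := M f g (or_intror Yg); [left | right; exists Y].
  - have [/Ax//|[Y FY YN]] := lift _ HN.
    by have [_ [_ _ E]] := Fg _ FY; apply: (E N); right.
pose P' f := A f \/ P f.
have P'0 : P' 0 by left.
have ext f : ~ P' f -> exists N a, P' (x ^+ N - a * f).
  move=> Nf; apply: contrapT => HN.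
  pose B : set R := fun g => exists a, P' (g - a * f).
  have PB g : P' g -> B g by exists 0; rewrite mul0r subr0.
  have BB g : A g \/ B g -> B g by case=> // Ag; apply: PB; left.
  apply: (maxP B).
    split=> [g Pg|/(_ f) Bf]; first by apply: PB; right.
    by apply: Nf; right; apply: Bf; exists 1; rewrite ?mul1r ?subrr.
  split; first by left.
  split=> [g h /BB[a Ha] /BB[b Hb]|g h /BB[a Ha]|N /BB[a Ha]].
  - right; exists (a + b) => //; rewrite mulrDl opprD addrACA; exact: PD.
  - right; exists (g * a) => //; rewrite -mulrA -mulrBr; exact: PM.
  - by apply: HN; exists N, a.
exists P'; last by split=> // /(Px 1%N).
split=> // f g Pfg; apply: contrapT => /not_orP[/ext[N [a Ha]] /ext[M [b Hb]]].
apply: (Px (N + M)%N).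
have -> : x ^+ (N + M) = x ^+ M * (x ^+ N - a * f) + (a * f) * (x ^+ M - b * g)
    + (a * b) * (f * g).
  rewrite exprD !mulrBr [x ^+ M * x ^+ N]mulrC [x ^+ M * (a * f)]mulrC.
  by rewrite addrA subrK mulrACA subrK.
by apply: (PD); [apply: (PD)|]; apply: (PM).
Qed.

(** * Valuation rings of a field *)

Section Valuation.
Variable K : fieldType.

Record subring_pred (V : K -> Prop) : Prop := SubringPred {
  sr_1 : V 1;
  sr_sub : forall x y, V x -> V y -> V (x - y);
  sr_mul : forall x y, V x -> V y -> V (x * y) }.

Section SubringTheory.
Variables (V : K -> Prop) (VS : subring_pred V).

Lemma sr_0 : V 0. Proof. by rewrite -(subrr 1); apply: (sr_sub VS); apply: (sr_1 VS). Qed.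
Lemma sr_opp x : V x -> V (- x).
Proof. by rewrite -sub0r => Vx; apply: (sr_sub VS) => //; apply: sr_0. Qed.
Lemma sr_add x y : V x -> V y -> V (x + y).
Proof. by move=> Vx Vy; rewrite -[y]opprK; apply: (sr_sub VS) => //; apply: sr_opp. Qed.
Lemma sr_exp x m : V x -> V (x ^+ m).
Proof.
move=> Vx; elim: m => [|m IHm]; first exact: (sr_1 VS).
by rewrite exprS; apply: (sr_mul VS).
Qed.
Lemma sr_sum (J : Type) (s : seq J) (A : pred J) (F : J -> K) :
  (forall i, A i -> V (F i)) -> V (\sum_(i <- s | A i) F i).
Proof. by move=> h; apply: (big_ind V) => //; [exact: sr_0 | exact: sr_add]. Qed.
Lemma sr_prod (J : Type) (s : seq J) (A : pred J) (F : J -> K) :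
  (forall i, A i -> V (F i)) -> V (\prod_(i <- s | A i) F i).
Proof. by move=> h; apply: (big_ind V) => //; [exact: (sr_1 VS) | exact: (sr_mul VS)]. Qed.

Definition adjoin x y := exists2 p : {poly K}, (forall i, V p`_i) & y = p.[x].

Lemma adjoin_subring x : subring_pred (adjoin x).
Proof.
split=> [|_ _ [p Vp ->] [r Vr ->]|_ _ [p Vp ->] [r Vr ->]].
- exists 1; last by rewrite hornerC.
  by move=> i; rewrite coef1; case: eqP => _; [exact: (sr_1 VS) | exact: sr_0].
- by exists (p - r); [move=> i; rewrite coefB; apply: (sr_sub VS) | rewrite hornerD hornerN].
- exists (p * r); last by rewrite hornerM.
  by move=> i; rewrite coefM; apply: sr_sum => j _; apply: (sr_mul VS).
Qed.

Lemma adjoin_sub x y : V y -> adjoin x y.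
Proof.
move=> Vy; exists y%:P; last by rewrite hornerC.
by move=> i; rewrite coefC; case: eqP => _ //; exact: sr_0.
Qed.

Lemma adjoin_gen x : adjoin x x.
Proof.
exists 'X; last by rewrite hornerX.
by move=> i; rewrite coefX; case: eqP => _; [exact: (sr_1 VS) | exact: sr_0].
Qed.

End SubringTheory.

Definition val_ring V := subring_pred V /\ forall x, V x \/ V x^-1.
(** The non-units of V. Zero is listed separately because [0^-1 = 0] lies in V. *)
Definition val_max (V : K -> Prop) x := x = 0 \/ ~ V x^-1.

(** For the sum: one of y / x and x / y lies in V, so x + y is a V-multiple of x or of y. *)
Lemma val_maxP V : val_ring V ->
  [/\ val_max V 0, forall x, val_max V x -> V x,
      forall x y, val_max V x -> val_max V y -> val_max V (x + y),
      forall x y, V x -> val_max V y -> val_max V (x * y)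
    & forall x y, V x -> V y -> val_max V (x * y) -> val_max V x \/ val_max V y].
Proof.
move=> [VS tot].
have inV x : val_max V x -> V x.
  by case=> [->|]; [exact: sr_0 | case: (tot x)].
have mM x y : V x -> val_max V y -> val_max V (x * y).
  move=> Vx [->|Ny]; first by rewrite mulr0; left.
  have [->|x0] := eqVneq x 0; first by rewrite mul0r; left.
  right=> Nxy; apply: Ny.
  by have -> : y^-1 = x * (x * y)^-1; [rewrite invfM mulVKf | apply: (sr_mul VS)].
split=> //; first by left.
- have wl x y : x != 0 -> V (y / x) -> val_max V x -> val_max V (x + y).
    move=> x0 Vyx mx; have -> : x + y = (1 + y / x) * x by rewrite mulrDl mul1r divfK.
    by apply: mM => //; apply: sr_add => //; exact: (sr_1 VS).
  move=> x y mx my; have [->|x0] := eqVneq x 0; first by rewrite add0r.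
  have [->|y0] := eqVneq y 0; first by rewrite addr0.
  case: (tot (y / x)) => h; first exact: wl.
  by rewrite addrC; apply: wl => //; rewrite -invf_div.
- move=> x y Vx Vy [/eqP|Nxy].
    by rewrite mulf_eq0 => /orP[]/eqP->; [left | right]; left.
  apply: contrapT => /not_orP[/not_orP[_ /contrapT Nx] /not_orP[_ /contrapT Ny]].
  by apply: Nxy; rewrite invfM; apply: (sr_mul VS).
Qed.

(* A maximal subring among those that contain A and avoid z^-1 is a          *)
(* valuation ring.                                                           *)
Lemma chevalley (A : K -> Prop) (z : K) : subring_pred A -> A z -> z != 0 ->
  ~ A z^-1 -> exists V, [/\ val_ring V, forall x, A x -> V x & ~ V z^-1].
Proof.
move=> AS Az z0 Nz.
pose good (V : K -> Prop) := [/\ subring_pred V, forall x, A x -> V x & ~ V z^-1].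
pose good' (V : set K) := good (fun x => A x \/ V x).
have [F Fg Ftot|V0 [gV maxV]] := @Zorn_bigcup K good'.
  have lift x : (A x \/ (\bigcup_(X in F) X)%classic x) ->
      A x \/ exists2 X, F X & X x by case=> [|[X FX Xf]]; [left | right; exists X].
  have common x y : (A x \/ (\bigcup_(X in F) X)%classic x) ->
      (A y \/ (\bigcup_(X in F) X)%classic y) -> (A x /\ A y) \/
      exists2 X, F X & (A x \/ X x) /\ (A y \/ X y).
    move=> /lift[Ax|[X FX Xx]] /lift[Ay|[Y FY Yy]]; first by left.
    - by right; exists Y => //; split; [left|right].
    - by right; exists X => //; split; [right|left].
    - have [XY|YX] := Ftot _ _ FX FY; right.
        by exists Y => //; split; right => //; apply: XY.
      by exists X => //; split; right => //; apply: YX.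
  split; [split|by left|].
  - by left; exact: (sr_1 AS).
  - move=> x y hx hy; have [[Ax Ay]|[X FX [Xx Xy]]] := common _ _ hx hy.
      by left; apply: (sr_sub AS).
    have [XS _ _] := Fg _ FX.
    by have [?|?] := sr_sub XS Xx Xy; [left|right; exists X].
  - move=> x y hx hy; have [[Ax Ay]|[X FX [Xx Xy]]] := common _ _ hx hy.
      by left; apply: (sr_mul AS).
    have [XS _ _] := Fg _ FX.
    by have [?|?] := sr_mul XS Xx Xy; [left|right; exists X].
  - move=> /lift[//|[X FX Xz]]; have [_ _ []] := Fg _ FX; by right.
pose V x := A x \/ V0 x.
have [VS VA Vz] : good V by [].
have Vzz : V z by left.
have ext x : ~ V x -> exists2 p : {poly K}, (forall i, V p`_i) & z^-1 = p.[x].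
  move=> Nx; apply: contrapT => Nxz.
  apply: (maxV (adjoin V x)).
    split=> [y Vy|/(_ x (adjoin_gen VS x)) V0x]; last by apply: Nx; right.
    by apply: adjoin_sub => //; right.
  have Aadj y : A y \/ adjoin V x y -> adjoin V x y.
    by case=> // Ay; apply: adjoin_sub => //; left.
  have aS := adjoin_subring VS x.
  split; [split|by left|by move=> /Aadj].
  - by right; exact: (sr_1 aS).
  - by move=> y w /Aadj hy /Aadj hw; right; apply: (sr_sub aS).
  - by move=> y w /Aadj hy /Aadj hw; right; apply: (sr_mul aS).
(* z behaves like an element of the maximal ideal: were (1 - z b)^-1 outside V, maximality would
   make z^-1 a polynomial in it over V. *)
have unit1 b : V b -> V (1 - z * b)^-1.
  move=> Vb; set u := 1 - z * b; apply: contrapT => /ext[p Vp Ep].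
  have Vu : V u by apply: (sr_sub VS); [exact: (sr_1 VS) | apply: (sr_mul VS)].
  have u0 : u != 0.
    apply/eqP => /eqP; rewrite subr_eq0 => /eqP E; apply: Vz.
    by have -> : z^-1 = b by rewrite -[LHS]mulr1 E mulKf.
  (* z divides a power of the unit-modulo-z element u, hence z divides 1 *)
  have : exists2 v, V v & u ^+ (size p) = z * v.
    exists (u ^+ (size p) * z^-1); last by rewrite mulrCA mulfV // mulr1.
    rewrite Ep horner_coef mulr_sumr; apply: sr_sum => // i _.
    rewrite exprVn mulrCA; apply: (sr_mul VS); first exact: Vp.
    by rewrite -expfB ?ltn_ord //; apply: sr_exp.
  have : exists2 w, V w & u ^+ (size p) = 1 - z * w.
    elim: (size p) => [|m [w Vw E]]; first by exists 0; rewrite ?mulr0 ?subr0 //; exact: sr_0.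
    exists (w + b * u ^+ m); first by apply: sr_add => //; apply: (sr_mul VS) => //; apply: sr_exp.
    by rewrite exprS {1}/u mulrBl mul1r {1}E mulrDr opprD addrA mulrA.
  move=> [w Vw ->] [v Vv /eqP]; rewrite subr_eq -mulrDr => /eqP E; apply: Vz.
  by have -> : z^-1 = v + w; [rewrite -[LHS]mulr1 E mulKf | apply: sr_add].
exists V; split=> //; split=> // x; apply: contrapT => /not_orP[Nx Nx'].
(* If V contains neither x nor x^-1, then z^-1 is a polynomial over V in each of them; the longer of
   two shortest such relations will be shortened. *)
pose rel m x := exists2 p : {poly K}, (forall i, V p`_i) /\ (size p <= m)%N & z^-1 = p.[x].
have relex y : ~ V y -> exists m, `[< rel m y >].
  by move=> /ext[p Vp Ep]; exists (size p); apply/asboolP; exists p.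
have exx := relex _ Nx; have exx' := relex _ Nx'.
case: (ex_minnP exx) => m /asboolP[p [Vp sp] Ep] minm.
case: (ex_minnP exx') => m' /asboolP[p' [Vp' sp'] Ep'] minm'.
(* reduce the leading term of the longer relation with the other one *)
have red y c d (q r : {poly K}) : y != 0 -> (forall i, V q`_i) -> (forall i, V r`_i) ->
    (size q <= c)%N -> (size r <= d)%N -> (d <= c)%N -> (1 < c)%N ->
    z^-1 = q.[y] -> z^-1 = r.[y^-1] -> exists2 c', (c' < c)%N & rel c' y.
  move=> y0 Vq Vr sq sr le_dc c1 Eq Er.
  case: c c1 sq le_dc => // c c1 sq le_dc.
  have Vu := unit1 _ (Vr 0%N); set u := 1 - z * r`_0 in Vu.
  have u0 : u != 0.
    apply/eqP => /eqP; rewrite subr_eq0 => /eqP E; apply: Vz.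
    by have -> : z^-1 = r`_0 by rewrite -[LHS]mulr1 E mulKf.
  have Eu : u = z * \sum_(i < c) r`_(i.+1) * y^-1 ^+ i.+1.
    have : 1 = z * r.[y^-1] by rewrite -Er mulfV.
    rewrite (horner_coef_wide _ (leq_trans sr le_dc)) big_ord_recl expr0 mulr1.
    rewrite mulrDr /u => {1}->; rewrite addrC addKr; congr (_ * _).
  (* The relation in y^-1, divided by its unit 1 - z r_0, expresses y^c through lower powers of
     y. *)
  have Ey : y ^+ c = z * u^-1 * \sum_(i < c) r`_(i.+1) * y ^+ (c - i.+1).
    have -> : y ^+ c = u^-1 * (u * y ^+ c) by rewrite mulKf.
    rewrite {2}Eu -!mulrA mulrCA; congr (_ * _); congr (_ * _).
    rewrite mulr_suml; apply: eq_bigr => i _; rewrite -mulrA; congr (_ * _).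
    by rewrite exprVn mulrC -expfB_cond // (negPf y0) ltn_ord.
  exists c => //; exists (\poly_(i < c) (q`_i + q`_c * (z * u^-1 * r`_(c - i)))).
    split; last exact: size_poly.
    move=> i; rewrite coef_poly; case: ifP => _; last exact: sr_0.
    apply: sr_add => //; apply: (sr_mul VS) => //.
    by apply: (sr_mul VS) => //; apply: (sr_mul VS).
  rewrite Eq (horner_coef_wide _ sq) big_ord_recr /= horner_poly Ey.
  rewrite (eq_bigr _ (fun i _ => mulrDl _ _ _)) big_split /=; congr (_ + _).
  rewrite mulr_sumr mulr_sumr (reindex_inj rev_ord_inj) /=; apply: eq_bigr => i _.
  by rewrite subnSK // subKn ?(ltnW (ltn_ord i)) // !mulrA.
have x0 : x != 0 by apply: contra_not_neq Nx => ->; exact: sr_0.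
have big1 y c (q : {poly K}) : (forall i, V q`_i) -> (size q <= c)%N ->
    z^-1 = q.[y] -> (1 < c)%N.
  move=> Vq sq Eq; rewrite ltnNge; apply/negP => c1; apply: Vz.
  by rewrite Eq (size1_polyC (leq_trans sq c1)) hornerC.
case/orP: (leq_total m' m) => le_mm.
  have [|c lt_c rc] := red x m m' p p' x0 Vp Vp' sp sp' le_mm _ Ep Ep'.
    exact: big1 sp Ep.
  by have := minm c (asboolT rc); rewrite leqNgt lt_c.
have [|||c lt_c rc] := red x^-1 m' m p' p _ Vp' Vp sp' sp le_mm _ Ep'.
- by rewrite invr_eq0.
- exact: big1 sp' Ep'.
- by rewrite invrK.
by have := minm' c (asboolT rc); rewrite leqNgt lt_c.
Qed.

End Valuation.

(** * Affine charts and centres of valuation rings *)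

Section Dehomogenization.
Variables (k : fieldType) (n : nat) (K : fieldType).
Local Notation S := {mpoly k[n]}.
Variables (phi : {rmorphism S -> K}) (i0 : 'I_n).
Implicit Types (f g : S) (d e : nat).

(** Evaluation at the affine coordinates of the chart x_i0 != 0. On a form of degree d it is phi f /
    phi x_i0^d, but it is a ring morphism on all polynomials. *)
Definition ev : S -> K := mmap (phi \o @mpolyC n k) (fun j => phi 'X_j / phi 'X_i0).
HB.instance Definition _ := GRing.RMorphism.on ev.

Lemma evX j : ev 'X_j = phi 'X_j / phi 'X_i0.
Proof. by rewrite /ev mmapX mmap1U. Qed.

Hypothesis phi_i0 : phi 'X_i0 != 0.

Lemma ev_homog f d : f \is d.-homog -> phi f = phi 'X_i0 ^+ d * ev f.
Proof.
move=> /dhomogP hf; rewrite {1}(mpolyE f) rmorph_sum /ev /mmap mulr_sumr.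
rewrite big_seq [RHS]big_seq; apply: eq_bigr => m m_f.
rewrite -mul_mpolyC rmorphM /= mulrCA; congr (_ * _).
have <- : mdeg m = d := hf m m_f.
rewrite mpolyXE_id rmorph_prod /mmap1 mdegE -prodrXr -big_split /=.
by apply: eq_bigr => j _; rewrite rmorphXn -exprMn mulrC divfK.
Qed.

End Dehomogenization.

(** A is a homogenization of f with respect to x_i0, chosen before K and phi: one form serves the
    function field and all residue fields. *)
Lemma ev_homogenize (k : fieldType) (n : nat) (i0 : 'I_n) (f : {mpoly k[n]}) :
  exists N A, A \is N.-homog /\ forall (K : fieldType)
    (phi : {rmorphism {mpoly k[n]} -> K}), phi 'X_i0 != 0 ->
    phi A = phi 'X_i0 ^+ N * ev phi i0 f.
Proof.
have [N _ Ef] := pihomog_sum_le 0 f.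
exists N, (\sum_(d < N) pihomog mdeg d f * 'X_i0 ^+ (N - d)); split.
  apply: rpred_sum => d _; have E : (d + 1 * (N - d) = N)%N.
    by rewrite mul1n subnKC // ltnW.
  rewrite -[X in _ \in (X.-homog)]E; apply: dhomogM; first exact: pihomogP.
  by apply: dhomogMn; exact: homogXi.
move=> K phi phi0; rewrite {2}Ef !rmorph_sum mulr_sumr; apply: eq_bigr => d _ /=.
rewrite rmorphM rmorphXn (ev_homog phi0 (pihomogP _ _ _)) mulrAC -exprD.
by rewrite subnKC // ltnW.
Qed.

(** The valuative criterion of properness. Since z^-1 is not in k[z], some valuation ring V contains
    k[z] but not z^-1. Dividing by a coordinate of least valuation puts all coordinate ratios in V,
    and q is the homogeneous part of the contraction of the maximal ideal. Ratios regular at q lie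
    in V, so none equals z^-1, while z lies in the maximal ideal and its numerators lie in q. *)
Lemma center (k K : fieldType) (n : nat) (phi : {rmorphism {mpoly k[n.+1]} -> K})
    (z : K) : (exists i, phi 'X_i != 0) -> z != 0 ->
    (forall g : {poly k}, z^-1 != (map_poly (phi \o @mpolyC _ k) g).[z]) ->
  exists q : {mpoly k[n.+1]} -> Prop, [/\ homog_prime q,
    forall f, (forall d, phi (pihomog mdeg d f) = 0) -> q f,
    forall d a b, a \is d.-homog -> b \is d.-homog -> ~ q b ->
      z^-1 != phi a / phi b
  & forall d a b, a \is d.-homog -> b \is d.-homog -> phi b != 0 ->
      z = phi a / phi b -> q a].
Proof.
move=> [i Xi] z0 Nz.
pose iota : {rmorphism k -> K} := phi \o @mpolyC _ k.
pose A x := exists g : {poly k}, x = (map_poly iota g).[z].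
have AS : subring_pred A.
  split=> [|_ _ [p ->] [r ->]|_ _ [p ->] [r ->]].
  - by exists 1; rewrite rmorph1 hornerC.
  - by exists (p - r); rewrite rmorphB hornerD hornerN.
  - by exists (p * r); rewrite rmorphM hornerM.
have [||V [Vval AV Vz]] := chevalley AS _ z0.
- by exists 'X; rewrite map_polyX hornerX.
- by move=> [g /eqP]; rewrite (negPf (Nz g)).
have [VS tot] := Vval; have [m0 mV mD mM mP] := val_maxP Vval.
have [i0 Xi0 Vi0] : exists2 i0, phi 'X_i0 != 0 & forall j, V (phi 'X_j / phi 'X_i0).
  suff [i0 Xi0 H] : exists2 i0, phi 'X_i0 != 0 &
      forall j, j \in enum 'I_n.+1 -> V (phi 'X_j / phi 'X_i0).
    by exists i0 => // j; apply: H; rewrite mem_enum.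
  elim: (enum _) => [|j s [i1 Xi1 H]]; first by exists i.
  have [h|h] := tot (phi 'X_j / phi 'X_i1).
    by exists i1 => // l; rewrite inE => /orP[/eqP->|/H].
  have [j0|j0] := eqVneq (phi 'X_j) 0.
    exists i1 => // l; rewrite inE => /orP[/eqP->|/H//].
    by rewrite j0 mul0r; exact: sr_0.
  exists j => // l; rewrite inE => /orP[/eqP->|/H Hl].
    by rewrite divff //; exact: (sr_1 VS).
  rewrite invf_div in h; have := sr_mul VS Hl h.
  by rewrite mulrA divfK.
have Vev f : V (ev phi i0 f).
  rewrite /ev /mmap; apply: sr_sum => // m _; apply: (sr_mul VS).
    by apply: AV; exists (f@_m)%:P; rewrite map_polyC hornerC.
  by apply: sr_prod => // j _; apply: sr_exp.
pose P f := val_max V (ev phi i0 f).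
have PP : prime_pred P.
  split=> [|f g|f g|f g]; rewrite /P.
  - by rewrite rmorph0.
  - by rewrite rmorphD; apply: mD.
  - by move=> h; rewrite rmorphM; exact: (mM _ _ (Vev f) h).
  - by rewrite rmorphM; exact: (mP _ _ (Vev f) (Vev g)).
have Pq f d : f \is d.-homog -> homog_part P f <-> P f := homog_part_homog (pp_0 PP).
have evE a b d : a \is d.-homog -> b \is d.-homog ->
    phi a / phi b = ev phi i0 a / ev phi i0 b.
  move=> ha hb; rewrite (ev_homog Xi0 ha) (ev_homog Xi0 hb).
  by rewrite -mulf_div divff ?mul1r // expf_neq0.
exists (homog_part P); split.
- apply: homog_part_prime => //; exists i0; rewrite /P evX divff // => -[/eqP|].
    by rewrite oner_eq0.
  by apply; rewrite invr1; exact: (sr_1 VS).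
- move=> f Hf d; rewrite /P; have := ev_homog Xi0 (pihomogP mdeg d f).
  rewrite Hf => /esym/eqP; rewrite mulf_eq0 (negPf (expf_neq0 _ Xi0)) /= => /eqP->.
  by left.
- move=> d a b ha hb Nb; apply/eqP => E; apply: Vz; rewrite E (evE _ _ _ ha hb).
  apply: (sr_mul VS) => //; apply: contrapT => Nvb; apply: Nb.
  by apply/(Pq _ _ hb); right.
- move=> d a b ha hb b0 E; apply/(Pq _ _ ha); rewrite /P.
  have -> : ev phi i0 a = ev phi i0 b * z.
    rewrite E (evE _ _ _ ha hb) mulrC divfK //.
    by apply: contraNneq b0 => b0; rewrite (ev_homog Xi0 hb) b0 mulr0.
  by apply: mM => //; right.
Qed.

(** * Algebraic elements over a finite field *)

Lemma card_pchar_nat (k : finFieldType) (R : comNzRingType) (iota : {rmorphism k -> R}) :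
  [pchar R].-nat #|k|.
Proof.
have [p p_pr pk] := finPcharP k.
rewrite (eq_pnat _ (pcharf_eq (rmorph_pchar iota pk))).
have := card_pprimeChar pk; rewrite -/(#|k|) => ->.
by rewrite pnatX pnat_id.
Qed.

Section FiniteBase.
Variables (k : finFieldType) (K : fieldType) (iota : {rmorphism k -> K}).

Lemma pigeonhole (T : finType) (F : nat -> T) : exists a b, (a < b)%N /\ F a = F b.
Proof.
pose G (i : 'I_#|T|.+1) := F i.
have : ~~ injectiveb G.
  by apply/injectiveP => /leq_card; rewrite card_ord ltnn.
move=> /injectivePn[a [b ne E]].
case: (ltngtP a b) => [lt|lt|/val_inj/eqP]; last by rewrite (negPf ne).
  by exists a, b.
by exists b, a; rewrite lt; split.
Qed.

(** z is a root of X g - 1, which is nonzero because its constant term is -1. Modulo this polynomial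
    the powers of X take finitely many values over the finite field k, so two powers of z agree. *)
Lemma root_of_unity (z : K) (g : {poly k}) : z != 0 ->
  z^-1 = (map_poly iota g).[z] -> exists2 M, (0 < M)%N & z ^+ M = 1.
Proof.
move=> z0 Eg; pose P : {poly k} := 'X * g - 1.
have Pz : (map_poly iota P).[z] = 0.
  by rewrite rmorphB rmorphM rmorph1 /= map_polyX hornerD hornerN hornerC hornerM hornerX -Eg mulfV ?subrr.
have P0 : P != 0.
  apply: contraTneq (oner_neq0 k) => /(congr1 (fun p : {poly k} => p`_0)).
  by rewrite coefB coefXM coef1 coef0 sub0r => /eqP; rewrite oppr_eq0 => ->.
have powE j : z ^+ j = (map_poly iota ('X^j %% P)).[z].
  transitivity (map_poly iota 'X^j).[z]; first by rewrite map_polyXn hornerXn.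
  by rewrite {1}(divp_eq 'X^j P) rmorphD rmorphM hornerD hornerM Pz mulr0 add0r.
have [a [b [lt_ab E]]] := pigeonhole (fun j => poly_rV ('X^j %% P) : 'rV[k]_(size P)).
have {}E : 'X^a %% P = 'X^b %% P.
  have szmod (p : {poly k}) : (size (p %% P)%R <= size P)%N by rewrite ltnW ?ltn_modp.
  by rewrite -(poly_rV_K (szmod 'X^a)) -(poly_rV_K (szmod 'X^b)) E.
exists (b - a)%N; first by rewrite subn_gt0.
by rewrite expfB // !powE E divff // -powE expf_neq0.
Qed.

(** The exponents #|k|^j repeat modulo M, so two iterates of Frobenius agree at z; the smaller
    iterate is additive and injective on a field and can be cancelled. *)
Lemma frobenius_period (z : K) : z = 0 \/ (exists2 M, (0 < M)%N & z ^+ M = 1) ->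
  exists2 r, (0 < r)%N & z ^+ (#|k| ^ r) = z.
Proof.
case=> [->|[M M0 zM]].
  by exists 1%N => //; rewrite expr0n expn1 gtn_eqF // ltnW ?finNzRing_gt1.
have [a [b [lt_ab E]]] := pigeonhole (fun j => Ordinal (ltn_pmod (#|k| ^ j) M0)).
have {E} : z ^+ (#|k| ^ a) = z ^+ (#|k| ^ b).
  have zmod j : z ^+ j = z ^+ (j %% M).
    by rewrite {1}(divn_eq j M) exprD mulnC exprM zM expr1n mul1r.
  by rewrite zmod [RHS]zmod; have /= -> := congr1 val E.
rewrite -(subnK (ltnW lt_ab)) expnD exprM => /esym/eqP; rewrite -subr_eq0 => E.
exists (b - a)%N; first by rewrite subn_gt0.
have kn j : [pchar K].-nat (#|k| ^ j)%N by rewrite pnatX (card_pchar_nat iota).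
have : (z ^+ (#|k| ^ (b - a)) - z) ^+ (#|k| ^ a) == 0.
  by rewrite exprDn_pchar // exprNn_pchar.
by rewrite expf_eq0 => /andP[_]; rewrite subr_eq0 => /eqP.
Qed.

Lemma frobenius_period_all (J : finType) (y : J -> K) :
  (forall j, exists2 r, (0 < r)%N & y j ^+ (#|k| ^ r) = y j) ->
  exists2 r, (0 < r)%N & forall j, y j ^+ (#|k| ^ r) = y j.
Proof.
move=> H; suff [r r0 Hr] : exists2 r, (0 < r)%N &
    forall j, j \in enum J -> y j ^+ (#|k| ^ r) = y j.
  by exists r => // j; apply: Hr; rewrite mem_enum.
have mult z r m : z ^+ (#|k| ^ r) = z -> z ^+ (#|k| ^ (r * m)) = z :> K.
  by move=> E; elim: m => [|m IHm]; rewrite ?muln0 ?expr1 // mulnS expnD exprM E.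
elim: (enum J) => [|j s [r r0 Hr]]; first by exists 1%N.
have [r' r'0 Hr'] := H j; exists (r * r')%N; first by rewrite muln_gt0 r0.
move=> l; rewrite inE => /orP[/eqP->|/Hr]; last exact: mult.
by rewrite mulnC; apply: mult.
Qed.

End FiniteBase.

(** * Points of Proj and their residue fields *)

Section ProjPoints.
Variables (k : fieldType) (n : nat) (T : {mpoly k[n.+1]} -> Prop).
Local Notation S := {mpoly k[n.+1]}.
Implicit Types (p q : proj_point T) (f g : S).

Lemma pt0 p : p 0. Proof. exact: (hp_0 (pt_prime p)). Qed.
Lemma ptD p f g : p f -> p g -> p (f + g). Proof. exact: (hp_add (pt_prime p)). Qed.
Lemma ptMl p f g : p g -> p (f * g). Proof. exact: (hp_mul (pt_prime p)). Qed.
Lemma ptMr p f g : p f -> p (f * g). Proof. by rewrite mulrC; exact: ptMl. Qed.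
Lemma ptM p f g : p (f * g) -> p f \/ p g. Proof. exact: (hp_prime (pt_prime p)). Qed.
Lemma pth p f d : p f -> p (pihomog mdeg d f). Proof. exact: (hp_homog (pt_prime p)). Qed.
Lemma ptN p f : p f -> p (- f). Proof. by rewrite -mulN1r; exact: ptMl. Qed.
Lemma ptB p f g : p f -> p g -> p (f - g). Proof. by move=> ? /ptN; exact: ptD. Qed.
Lemma pt1 p : ~ p 1.
Proof. by have [i Xi] := hp_relevant (pt_prime p) => p1; apply: Xi; rewrite -['X_i]mulr1; apply: ptMl. Qed.
Lemma ptX p f m : p (f ^+ m) -> p f.
Proof. by elim: m => [/pt1//|m IHm]; rewrite exprS => /ptM[]. Qed.
Lemma ptXn p f m : (0 < m)%N -> p f -> p (f ^+ m).
Proof. by case: m => // m _ pf; rewrite exprS; apply: ptMr. Qed.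
Lemma pt_nX p f m : ~ p f -> ~ p (f ^+ m). Proof. by move=> ? /ptX. Qed.
Lemma pt_sum p (J : Type) (s : seq J) (A : pred J) (F : J -> S) :
  (forall i, A i -> p (F i)) -> p (\sum_(i <- s | A i) F i).
Proof. by apply: ideal_sum; [exact: pt0 | exact: ptD]. Qed.
Lemma pt_components p f : (forall d, p (pihomog mdeg d f)) -> p f.
Proof. by have [N _ E] := pihomog_sum_le 0 f => h; rewrite E; apply: pt_sum. Qed.

Lemma point_ext p q : (forall f, p f <-> q f) -> p = q.
Proof.
case: p q => p pp pa [q qp qa] /= E.
have {}E : p = q by apply/funext => f; apply/propext.
by case: q / E qp qa => qp qa; congr ProjPoint; exact: Prop_irrelevance.
Qed.

Definition pt_pred p : pred S := fun f => `[< p f >].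

Lemma pt_pred_ideal p : idealr_closed (pt_pred p).
Proof.
split=> [||a f g /asboolP pf /asboolP pg]; first exact/asboolP/pt0.
  by apply/negP => /asboolP/pt1.
by apply/asboolP/ptD => //; apply: ptMl.
Qed.

Lemma pt_pred_prime p : prime_idealr_closed (pt_pred p).
Proof. by move=> f g /asboolP/ptM[] h; apply/orP; [left|right]; apply/asboolP. Qed.

HB.instance Definition _ p := isIdealr.Build S (pt_pred p) (pt_pred_ideal p).
HB.instance Definition _ p := isPrimeIdealrClosed.Build S (pt_pred p) (@pt_pred_prime p).

(** K is the residue field of the affine cone at p; it turns membership in p into the vanishing of
    phi. *)
Lemma residue_field p :
  exists (K : fieldType) (phi : {rmorphism S -> K}), forall f, phi f = 0 <-> p f.
Proof.
have [K [phi [phi0 _]]] := frac_quot (PrimeIdealr.clone S (pt_pred p) _).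
exists K, phi => f; split=> [/eqP|pf]; first by rewrite phi0 => /asboolP.
by apply/eqP; rewrite phi0; apply/asboolP.
Qed.

End ProjPoints.

Lemma homogXin (k : fieldType) (n : nat) (i : 'I_n) m :
  ('X_i : {mpoly k[n]}) ^+ m \is m.-homog.
Proof. by have := dhomogMn m (homogXi k i); rewrite mul1n. Qed.

(** * Forms that cut out the points over F_Q *)

Section FrobeniusRelations.
Variables (k : finFieldType) (n : nat) (i0 : 'I_n.+1) (Q : nat).
Local Notation S := {mpoly k[n.+1]}.
Hypothesis Q_pow : exists2 r, (0 < r)%N & Q = (#|k| ^ r)%N.

(** The homogenization of y^Q - y for the affine coordinate y = x_j / x_i0. *)
Definition frob (j : 'I_n.+1) : S := 'X_j ^+ Q - 'X_j * 'X_i0 ^+ (Q - 1).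

Lemma frob_gt1 : (1 < Q)%N.
Proof.
have [r r0 ->] := Q_pow; apply: (@leq_trans (#|k| ^ 1)%N).
  by rewrite expn1 finNzRing_gt1.
by apply: leq_pexp2l => //; rewrite ltnW ?finNzRing_gt1.
Qed.
Let Q0 : (0 < Q)%N := ltnW frob_gt1.

Lemma frob_card (c : k) : c ^+ Q = c.
Proof.
have [r _ ->] := Q_pow; elim: r => [|r IHr]; first by rewrite expr1.
by rewrite expnSr exprM IHr expf_card.
Qed.

Lemma frob_nat (R : comNzRingType) (iota : {rmorphism k -> R}) : [pchar R].-nat Q.
Proof. by have [r _ ->] := Q_pow; rewrite pnatX (card_pchar_nat iota). Qed.

Lemma frob0 : frob i0 = 0.
Proof. by rewrite /frob -exprS subn1 prednK // subrr. Qed.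

Lemma frob_homog j : frob j \is Q.-homog.
Proof.
apply: rpredB; first exact: homogXin.
have := dhomogM (homogXi k j) (homogXin k i0 (Q - 1)).
by rewrite subnKC.
Qed.

Definition frob_ideal (f : S) := exists h : 'I_n.+1 -> S, f = \sum_j h j * frob j.

Lemma frob_ideal0 : frob_ideal 0.
Proof. by exists (fun=> 0); rewrite big1 // => j _; rewrite mul0r. Qed.
Lemma frob_idealD f g : frob_ideal f -> frob_ideal g -> frob_ideal (f + g).
Proof.
move=> [h ->] [h' ->]; exists (fun j => h j + h' j).
by rewrite -big_split; apply: eq_bigr => j _; rewrite mulrDl.
Qed.
Lemma frob_idealM f g : frob_ideal g -> frob_ideal (f * g).
Proof.
move=> [h ->]; exists (fun j => f * h j).
by rewrite mulr_sumr; apply: eq_bigr => j _; rewrite mulrA.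
Qed.

(* Modulo the ideal, the Q-th power acts on forms of degree d as             *)
(* multiplication by x_0^(d(Q-1)).                                           *)
Lemma frob_ideal_homog f d : f \is d.-homog ->
  frob_ideal (f ^+ Q - f * 'X_i0 ^+ (d * (Q - 1))).
Proof.
pose A f d := frob_ideal (f ^+ Q - f * 'X_i0 ^+ (d * (Q - 1))).
have A1 : A 1 0%N by rewrite /A expr1n mul0n mulr1 subrr; exact: frob_ideal0.
have AM f1 d1 f2 d2 : A f1 d1 -> A f2 d2 -> A (f1 * f2) (d1 + d2)%N.
  rewrite /A => H1 H2; rewrite exprMn mulnDl exprD.
  set a := f1 ^+ Q in H1 *; set w := 'X_i0 ^+ (d1 * _) in H1 *.
  set b := f2 ^+ Q in H2 *; set v := 'X_i0 ^+ (d2 * _) in H2 *.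
  have -> : a * b - f1 * f2 * (w * v) = b * (a - f1 * w) + (f1 * w) * (b - f2 * v).
    by rewrite !mulrBr [b * a]mulrC [b * (f1 * w)]mulrC addrA subrK mulrACA.
  by apply: frob_idealD; apply: frob_idealM.
(* For a variable the difference is the generator itself. Monomials follow by multiplicativity, and
   forms because Q-th powers are additive and fix the coefficients. *)
have AXi j : A 'X_j 1%N.
  rewrite /A mul1n; exists (fun i => (i == j)%:R).
  rewrite (bigD1 j) //= eqxx mul1r big1 ?addr0 // => i /negPf->.
  by rewrite mul0r.
have AX m : A 'X_[m] (mdeg m).
  rewrite mpolyXE_id mdegE; apply: (big_ind2 A) => // j _.
  elim: (m j) => [|e IHe]; first by rewrite expr0.
  by rewrite exprS; apply: (AM _ 1%N _ e).
have cardS := frob_nat (@mpolyC n.+1 k : {rmorphism k -> S}).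
move=> /dhomogP hf; rewrite -/(A f d) (mpolyE f) big_seq.
apply: (big_ind (A^~ d)) => [|f1 f2 H1 H2|m m_f].
- by rewrite /A expr0n gtn_eqF // mul0r subrr; exact: frob_ideal0.
- by rewrite /A exprDn_pchar // mulrDl opprD addrACA; apply: frob_idealD.
- rewrite /A exprZn frob_card -scalerAl -scalerBr -mul_mpolyC.
  by apply: frob_idealM; have <- : mdeg m = d := hf m m_f; apply: AX.
Qed.

(** The component of degree d Q of the relation has cofactors of degree d Q - Q, or zero when d = 0.
    The degree is stated for [h j * 'X_i0 ^+ Q] because that product serves as a numerator over
    forms of degree d Q. *)
Lemma frob_homogE f d : f \is d.-homog -> exists2 h : 'I_n.+1 -> S,
  forall j, h j * 'X_i0 ^+ Q \is (d * Q).-homog &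
  f ^+ Q - f * 'X_i0 ^+ (d * (Q - 1)) = \sum_j h j * frob j.
Proof.
move=> hf; have [h E] := frob_ideal_homog hf.
exists (fun j => if (Q <= d * Q)%N then pihomog mdeg (d * Q - Q) (h j) else 0).
  move=> j; case: ifP => le; last by rewrite mul0r; exact: rpred0.
  by have := dhomogM (pihomogP mdeg (d * Q - Q) (h j)) (homogXin k i0 Q); rewrite subnK.
set F := LHS in E; have hF : F \is (d * Q).-homog.
  apply: rpredB; first exact: dhomogMn.
  have -> : (d * Q = d + d * (Q - 1))%N by rewrite -mulnS subn1 prednK.
  by apply: dhomogM => //; exact: homogXin.
rewrite -[LHS](pihomog_dE hF) E raddf_sum /=; apply: eq_bigr => j _.
rewrite mulrC; case: leqP => le.
  by rewrite (pihomogMl _ (frob_homog j)) // mulrC.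
by rewrite mul0r (pihomogMl0 _ (frob_homog j)).
Qed.

End FrobeniusRelations.

(** * Closed points of the curve *)

Section Curve.
Variables (k : finFieldType) (X : proj_variety k).
Hypotheses (hdim : var_dim X 1) (hsmooth : smooth_var X 1).
Local Notation n := (amb_dim X).
Local Notation I := (var_ideal X).
Local Notation S := {mpoly k[n.+1]}.
Local Notation F := (cone_field X).
Local Notation kappa := (@cone_elt k X).
Implicit Types (p q : point X) (f g : S) (z w : F).

(** The dimension hypothesis provides a point, and a coordinate outside that point is outside I. *)
Lemma generic_prime : homog_prime (fun f : S => f \in I).
Proof.
have [[c _] _] := hdim; split.
- exact: rpred0.
- by move=> f g; exact: rpredD.
- by move=> f g; exact: idealMr.
- by move=> f g; rewrite prime_idealrM => /orP.
- by move=> f d; exact: var_homog.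
- have [i Xi] := hp_relevant (pt_prime (c ord0)); exists i.
  by move=> /(pt_above (c ord0)).
Qed.

Definition eta : point X := ProjPoint generic_prime (fun f If => If).

(** Otherwise eta, p and a proper specialisation of p form a chain of three points, which dimension
    1 forbids. *)
Lemma point_cases p : closed_point_pred p \/ p = eta.
Proof.
apply: contrapT => /not_orP[/existsNP[q /not_implyP[pq /existsNP[f /not_implyP[qf pf]]]] ne].
have [g [pg Ig]] : exists g, p g /\ g \notin I.
  apply: contrapT => H; apply: ne; apply: point_ext => g.
  split=> [pg|]; last exact: pt_above.
  by apply/negPn/negP => Ig; apply: H; exists g.
apply: hdim.2; exists (fun i : 'I_3 => nth eta [:: eta; p; q] i).
have Ip h : h \in I -> p h by apply: pt_above.
have Iq h : h \in I -> q h by apply: pt_above.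
have pg_q : q g by apply: pq.
case=> [[|[|[|//]]] ?] [[|[|[|//]]] ?] //= _; split=> //.
- by exists g; split => //; apply/negP.
- by exists g; split => //; apply/negP.
- by exists f.
Qed.

Lemma eta_not_closed : ~ closed_point_pred eta.
Proof.
have [[c /(_ ord0 ord_max isT)[_ [f [c1f c0f]]]] _] := hdim.
move=> /(_ (c ord_max)) H; apply: c0f; apply: pt_above; apply: H => //.
by move=> h; apply: pt_above.
Qed.

Lemma closed_notin_I p : closed_point_pred p -> exists d g, [/\ g \is d.-homog, p g & g \notin I].
Proof.
move=> cp; apply: contrapT => H; apply: eta_not_closed.
suff <- : p = eta by [].
apply: point_ext => g; split=> [pg|]; last exact: pt_above.
apply: (@pt_components _ _ _ eta) => d /=; apply/negPn/negP => Ig; apply: H.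
by exists d, (pihomog mdeg d g); split=> //; [exact: pihomogP | exact: pth].
Qed.

Section ClosedPoint.
Variables (p : point X) (cp : closed_point_pred p) (i0 : 'I_n.+1).
Hypothesis pi0 : ~ p 'X_i0.

(** If a coordinate ratio y_j at p were neither zero nor a root of unity, [center] would give a
    point q that contains p and x_j. As p is closed, x_j would lie in p and y_j would be zero. A
    common Frobenius period of all the y_j gives Q. *)
Lemma closed_frob : exists2 Q, (exists2 r, (0 < r)%N & Q = (#|k| ^ r)%N) &
  forall j, p (frob k i0 Q j).
Proof.
have [K [phi phi0]] := residue_field p.
have phiX : phi 'X_i0 != 0 by apply/eqP => /phi0.
pose iota : {rmorphism k -> K} := phi \o @mpolyC _ k.
pose y j := phi 'X_j / phi 'X_i0.
have [|r r0 Hr] := @frobenius_period_all k K _ y.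
  move=> j; apply: (frobenius_period iota); have [->|yj0] := eqVneq (y j) 0; first by left.
  right; apply: contrapT => Nroot.
  have Ng (g : {poly k}) : (y j)^-1 != (map_poly (phi \o @mpolyC _ k) g).[y j].
    by apply/eqP => /(root_of_unity (iota := iota) yj0).
  have [|q [qpr qp _ qa]] := center _ yj0 Ng; first by exists i0.
  have pq f : p f -> q f by move=> pf; apply: qp => d; apply/phi0; exact: pth.
  have qI f : f \in I -> q f by move=> If; apply: pq; exact: pt_above.
  pose q' : point X := ProjPoint qpr qI.
  have /(cp (q := q')) : forall f, p f -> q' f by [].
  move=> /(_ 'X_j) pj; move: yj0; rewrite /y (phi0 _).2 ?mul0r ?eqxx //.
  by apply: pj; apply: (qa _ _ _ (homogXi k j) (homogXi k i0)).
exists (#|k| ^ r)%N; first by exists r.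
move=> j; set Q := (_ ^ _)%N.
have Q0 : (0 < Q)%N by rewrite expn_gt0 ltnW ?finNzRing_gt1.
apply/phi0; rewrite rmorphB rmorphXn rmorphM rmorphXn /=.
have := Hr j; rewrite -/Q /y expr_div_n => /(canRL (divfK (expf_neq0 _ phiX))) ->.
by rewrite -{1}(subnK Q0) addn1 exprS mulrA divfK // subrr.
Qed.

End ClosedPoint.

Section Uniformizer.
Variables (p : point X) (cp : closed_point_pred p) (i0 : 'I_n.+1).
Hypothesis pi0 : ~ p 'X_i0.
Variable Q : nat.
Hypothesis Q_pow : exists2 r, (0 < r)%N & Q = (#|k| ^ r)%N.
Hypothesis pfrob : forall j, p (frob k i0 Q j).
Local Notation fr := (frob k i0 Q).
Let Q1 : (1 < Q)%N := frob_gt1 Q_pow.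
Let Q0 : (0 < Q)%N := ltnW Q1.

(* Differentiating f^Q - x_0^e f = sum_j h_j g_j modulo p turns the Jacobian  *)
(* matrix of the f's into a product that factors through the matrix (h_j):   *)
(* the latter has rank at least n - 1, and Cramer's rule applies.            *)
Lemma frob_minor : exists j0 delta, ~ p delta /\
  forall j, exists w : S, delta * fr j - w * fr j0 \in I.
Proof.
have [n1 /(_ p)[[f [c [If minor]]] _]] := hsmooth.
set r := (n - 1)%N in f c If minor.
have [K [phi phi0]] := residue_field p.
have phiX : phi 'X_i0 != 0 by apply/eqP => /phi0.
have [N fE] : exists N, forall i, f i = \sum_(d < N) pihomog mdeg d (f i).
  exists (\max_i mmeasure mdeg (f i)) => i; apply: pihomog_partitionE.
  exact: (leq_bigmax i).
(* T indexes the homogeneous components of the f_i, because the Frobenius relation is stated for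
   forms. *)
pose T : finType := ('I_r * 'I_N)%type.
pose ft (t : T) := pihomog mdeg t.2 (f t.1).
have ftI t : ft t \in I by apply: var_homog.
have [h hE] : exists h : T -> 'I_n.+1 -> S, forall t,
    ft t ^+ Q - ft t * 'X_i0 ^+ (t.2 * (Q - 1)) = \sum_j h t j * fr j.
  have /choice[h hE] : forall t : T, exists h : 'I_n.+1 -> S,
    ft t ^+ Q - ft t * 'X_i0 ^+ (t.2 * (Q - 1)) = \sum_j h j * fr j.
    by move=> t; apply: frob_ideal_homog => //; exact: pihomogP.
  by exists h.
(* Clearing column i0 changes no sum, since g_i0 = 0, and keeps i0 out of the columns selected
   below. *)
pose H : 'M[S]_(#|{: T}|, n.+1) :=
  \matrix_(a, j) (if j == i0 then 0 else h (enum_val a : T) j).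
(* W adds up the components of f_i and undoes the factor -x_0^(d(Q-1)) left by differentiating the
   relation modulo p; the derivative of f^Q vanishes there because Q > 1. *)
pose W : 'M[K]_(r, #|{: T}|) := \matrix_(i, a)
  (let t : 'I_r * 'I_N := enum_val a in
   if t.1 == i then - (phi 'X_i0 ^+ (t.2 * (Q - 1)))^-1 else 0).
pose G : 'M[K]_(n.+1, r) := \matrix_(j, l) phi (mderiv (c l) (fr j)).
pose J : 'M[K]_r := \matrix_(i, l) phi (mderiv (c l) (f i)).
have HE t : \sum_j H (enum_rank t) j * fr j = \sum_j h t j * fr j.
  apply: eq_bigr => j _; rewrite mxE enum_rankK; case: eqP => // ->.
  by rewrite frob0 // !mulr0.
have phiM l a b : p b -> phi (mderiv (c l) (a * b)) = phi a * phi (mderiv (c l) b).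
  by move=> /phi0 b0; rewrite mderivM rmorphD !rmorphM b0 mulr0 add0r.
have JE : J = W *m map_mx phi H *m G.
  apply/matrixP => i l; rewrite -mulmxA !mxE.
  transitivity (\sum_(t : T) W i (enum_rank t) *
      \sum_j phi (H (enum_rank t) j) * phi (mderiv (c l) (fr j))); last first.
    rewrite (reindex_onto enum_val enum_rank) /=; last by move=> t _; rewrite enum_rankK.
    apply: eq_big => [a|a _]; first by rewrite enum_valK eqxx.
    rewrite enum_valK mxE; congr (_ * _); rewrite mxE; apply: eq_bigr => j _.
    by rewrite [(map_mx phi H) _ _]mxE [G _ _]mxE.
  have rowE t : \sum_j phi (H (enum_rank t) j) * phi (mderiv (c l) (fr j)) =
      - (phi 'X_i0 ^+ (t.2 * (Q - 1)) * phi (mderiv (c l) (ft t))).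
    transitivity (phi (mderiv (c l) (\sum_j h t j * fr j))).
      rewrite -HE (raddf_sum (mderiv (c l))) rmorph_sum; apply: eq_bigr => j _ /=; by rewrite phiM.
    have pft : p (ft t) by apply: pt_above.
    rewrite -hE raddfB /= rmorphB /= [ft t * _]mulrC phiM // rmorphXn /=.
    by rewrite -[Q in X in X - _](subnK Q0) addn1 exprSr phiM // rmorphXn /= (phi0 _).2 //
      expr0n subn_eq0 leqNgt Q1 mul0r sub0r.
  transitivity (\sum_(d < N) phi (mderiv (c l) (ft (i, d)))).
    by rewrite {1}fE (raddf_sum (mderiv (c l))) rmorph_sum.
  transitivity (\sum_a \sum_d W i (enum_rank ((a, d) : T)) *
      \sum_j phi (H (enum_rank ((a, d) : T)) j) * phi (mderiv (c l) (fr j))); last first.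
    by rewrite pair_bigA; apply: eq_bigr => -[a d] _.
  rewrite (bigD1 i) //= [X in _ + X]big1 ?addr0; last first.
    by move=> a /negPf ne; rewrite big1 // => d _; rewrite mxE enum_rankK /= ne mul0r.
  apply: eq_bigr => d _; rewrite mxE enum_rankK /= eqxx rowE /= mulrNN mulKf //.
  exact: expf_neq0.
have rankJ : \rank J = r.
  apply: mxrank_unit; rewrite unitmxE unitfE.
  have -> : \det J = phi (jacobian_minor f c).
    rewrite /jacobian_minor -det_map_mx; congr (\det _).
    by apply/matrixP => i l; rewrite !mxE.
  by apply/eqP => /phi0.
have rfree : row_full (W *m map_mx phi H)^T.
  rewrite /row_full mxrank_tr eqn_leq rank_leq_row /= -{1}rankJ JE.
  exact: mxrankM_maxl.
(* J has rank r, hence so has W H. Choosing r independent columns of W H, and then r independent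
   rows of H in these columns, gives a minor D of H that does not vanish at p. *)
pose ga := fullrankfun rfree.
have ga_inj : injective ga := @fullrankfun_inj _ _ _ _ rfree.
have rfull2 : row_full (colsub ga (map_mx phi H)).
  rewrite /row_full eqn_leq rank_leq_col /=.
  suff Er : \rank (W *m colsub ga (map_mx phi H)) = r.
    by apply: leq_trans (mxrankM_maxr W _); rewrite Er.
  rewrite mulmx_colsub -mxrank_tr trmx_mxsub.
  exact: mxrank_fullrowsub.
pose rh := fullrankfun rfull2.
pose D : 'M[S]_r := mxsub rh ga H.
have pD : ~ p (\det D).
  move=> /phi0; apply/eqP; rewrite -det_map_mx -unitfE -unitmxE -row_full_unit.
  have -> : map_mx phi D = rowsub rh (colsub ga (map_mx phi H)).
    by apply/matrixP => i j; rewrite !mxE.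
  exact: fullrowsub_full.
have ga_i0 l : ga l != i0.
  apply/eqP => E; apply: pD; rewrite (expand_det_col _ l) big1 ?mxE; first exact: pt0.
  by move=> i _; rewrite !mxE E eqxx mul0r.
(* Of the n + 1 indices, i0 and the n - 1 selected columns leave exactly one. *)
have [j0 Ej0] : exists j0, ~: (i0 |: ga @: 'I_r) = [set j0].
  apply/cards1P; rewrite cardsCs finset.setCK card_ord cardsU1 card_imset // card_ord.
  have -> : i0 \notin ga @: 'I_r.
    by apply/imsetP => -[l _ E]; have := ga_i0 l; rewrite E eqxx.
  by rewrite /= add1n subSS /r subKn.
exists j0, (\det D); split => // j.
have j0P : j0 \notin i0 |: ga @: 'I_r by rewrite -finset.in_setC Ej0 finset.set11.
(* The components of the f_i lie in I, so on X the Frobenius relations become a homogeneous linear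
   system for the g_j, solved here with g_j0 on the right-hand side. *)
have sumE t : \sum_l kappa (H (enum_rank t) (ga l)) * kappa (fr (ga l)) =
    - (kappa (H (enum_rank t) j0) * kappa (fr j0)).
  apply/eqP; rewrite -addr_eq0; apply/eqP.
  transitivity (kappa (\sum_j H (enum_rank t) j * fr j)).
    rewrite raddf_sum (bigD1 i0) //= frob0 // mulr0 rmorph0 add0r.
    rewrite (bigD1 j0) /=; last by apply: contraNneq j0P => ->; rewrite !inE eqxx.
    rewrite rmorphM addrC; congr (_ + _).
    transitivity (\sum_(i in ga @: 'I_r) kappa (H (enum_rank t) i * fr i)).
      rewrite big_imset /=; last by move=> ? ? _ _; exact: ga_inj.
      by apply: eq_big => [l|l _]; rewrite ?inE // rmorphM.
    apply: eq_bigl => i; rewrite andbC.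
    have := finset.in_set1 i j0; rewrite -Ej0 !inE => <-.
    rewrite negbK orbC; case: eqVneq => [->|]; rewrite ?orbT ?andbF ?orbF ?andbT //.
    by apply/imsetP => -[l _ E]; have := ga_i0 l; rewrite E eqxx.
  rewrite HE -hE; apply/eqP; rewrite cone_elt_eq0.
  apply: rpredB; first by rewrite -(subnK Q0) addn1 exprSr; apply: idealMr.
  by rewrite mulrC; apply: idealMr.
pose v : 'cV[F]_r := \col_l kappa (fr (ga l)).
pose u : 'cV[S]_r := \col_s H (rh s) j0.
have Dv : map_mx kappa D *m v = (- kappa (fr j0)) *: map_mx kappa u.
  apply/matrixP => s z; rewrite mxE [RHS]mxE [(map_mx kappa u) s z]mxE [u s z]mxE.
  have := sumE (enum_val (rh s)); rewrite enum_valK => E.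
  rewrite mulNr [kappa (fr j0) * _]mulrC -E; apply: eq_bigr => l _.
  by rewrite [(map_mx kappa D) s l]mxE [D s l]mxE [v l z]mxE.
case: (boolP (j \in i0 |: ga @: 'I_r)) => [|jN]; last first.
  exists (\det D); have /eqP -> : j == j0 by rewrite -finset.in_set1 -Ej0 finset.in_setC.
  by rewrite subrr rpred0.
rewrite finset.in_setU1 => /orP[/eqP->|/imsetP[l _ ->]].
  by exists 0; rewrite frob0 // mulr0 mul0r subrr rpred0.
exists (- (\adj D *m u) l 0); rewrite -cone_elt_eq0 rmorphB !rmorphM rmorphN /=.
have := congr1 (fun M => (map_mx kappa (\adj D) *m M) l 0) Dv.
rewrite mulmxA -map_mxM mul_adj_mx map_scalar_mx mul_scalar_mx -scalemxAr -map_mxM.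
rewrite [LHS]mxE [RHS]mxE [v l 0]mxE [(map_mx _ _) l 0]mxE => ->.
by rewrite !mulNr opprK [kappa (fr j0) * _]mulrC addNr.
Qed.

End Uniformizer.

End Curve.

Lemma div_mul_swap (K : fieldType) (A B u : K) : B != 0 -> A * u = B * A * (u / B).
Proof. by move=> B0; field. Qed.

Lemma fraction_shuffle (K : fieldType) (A B C D O : K) : B != 0 -> C != 0 ->
  A * O * D / C = A * B / C * O * (D / B).
Proof. by move=> B0 C0; field; rewrite B0 C0. Qed.

(** * Local rings and uniformizers *)

Section LocalRing.
Variables (k : fieldType) (X : proj_variety k).
Local Notation S := {mpoly k[(amb_dim X).+1]}.
Local Notation kappa := (@cone_elt k X).
Implicit Types (p : point X) (z w t u : cone_field X).

Lemma regular_subring p : subring_pred (regular_at p).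
Proof. by split=> *; [exact: regular1 | exact: regularB | exact: regularM]. Qed.

Lemma kappa_eq a b : kappa a = kappa b -> a - b \in var_ideal X.
Proof. by move=> E; rewrite -cone_elt_eq0 rmorphB E subrr. Qed.

Lemma regular_homog p (d : nat) (a b : S) : a \is d.-homog -> b \is d.-homog -> ~ p b ->
  regular_at p (kappa a / kappa b).
Proof. by move=> ha hb pb; exists d, a, b. Qed.

(** Two fractions for one function have cross products that differ by an element of I, hence of p,
    so vanishing can be read off any representation. *)
Lemma vanishing_homog p (d : nat) (a b : S) : a \is d.-homog -> b \is d.-homog -> ~ p b ->
  vanishing_at p (kappa a / kappa b) -> p a.
Proof.
move=> ha hb pb [e [a' [b' [ha' hb' pa' pb' E]]]].
have b0 := pt_cone pb; have b'0 := pt_cone pb'.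
have /kappa_eq Iab : kappa (a * b') = kappa (a' * b).
  by apply/eqP; rewrite !rmorphM -eqr_div // E.
have : p (a * b').
  by rewrite -[a * b'](subrK (a' * b)); apply: ptD; [exact: pt_above | exact: ptMr].
by case/ptM.
Qed.

Lemma vanishing_regular p z : vanishing_at p z -> regular_at p z.
Proof. by move=> [d [a [b [ha hb pa pb ->]]]]; exists d, a, b. Qed.

Lemma regularMvanishing p z w : regular_at p z -> vanishing_at p w -> vanishing_at p (z * w).
Proof.
move=> [d [a [b [ha hb pb ->]]]] [e [a' [b' [ha' hb' pa' pb' ->]]]].
exists (d + e)%N, (a * a'), (b * b'); split; try exact: dhomogM.
- exact: ptMl.
- exact: pt_nmul.
- by rewrite !rmorphM mulf_div.
Qed.

Lemma vanishing_neq1 p : ~ vanishing_at p 1.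
Proof.
move=> v1; apply: (@pt1 _ _ _ p); apply: (@vanishing_homog p 0 1 1); try exact: dhomog1.
  exact: pt1.
by rewrite rmorph1 divr1.
Qed.

Lemma unit_or_vanishing p z : regular_at p z -> unit_at p z \/ vanishing_at p z.
Proof.
move=> [d [a [b [ha hb pb ->]]]]; have [pa|pa] := pselect (p a).
  by right; exists d, a, b.
left; split.
- by rewrite mulf_neq0 ?invr_eq0 ?(pt_cone pa) ?(pt_cone pb).
- by exists d, a, b.
- by exists d, b, a; split=> //; rewrite invf_div.
Qed.

Lemma unit_atM p z w : unit_at p z -> unit_at p w -> unit_at p (z * w).
Proof.
move=> uz uw; have := unit_at_div uz (unit_at_div (unit_at1 p) uw).
by rewrite div1r invrK.
Qed.

Lemma unit_atV p z : unit_at p z -> unit_at p z^-1.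
Proof. by move=> /(unit_at_div (unit_at1 p)); rewrite div1r. Qed.

Lemma unit_atX p z m : unit_at p z -> unit_at p (z ^+ m).
Proof.
move=> uz; elim: m => [|m IHm]; first exact: unit_at1.
by rewrite exprS; apply: unit_atM.
Qed.

Lemma unit_atXz p z (m : int) : unit_at p z -> unit_at p (z ^ m).
Proof. by case: m => m uz; [|apply: unit_atV]; apply: unit_atX. Qed.

Lemma unit_atP p z : regular_at p z -> (exists2 w, regular_at p w & w * z = 1) ->
  unit_at p z.
Proof.
move=> rz [w rw E]; have z0 : z != 0.
  by apply: contra_eq_neq E => ->; rewrite mulr0 eq_sym oner_eq0.
split=> //; suff -> : z^-1 = w by [].
by apply: (mulIf z0); rewrite E mulVf.
Qed.

Lemma regular_ev p i0 (f : S) : ~ p 'X_i0 -> regular_at p (ev kappa i0 f).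
Proof.
move=> pi0; have [N [A [hA AE]]] := ev_homogenize i0 f.
have x0 := pt_cone pi0; have -> : ev kappa i0 f = kappa A / kappa ('X_i0 ^+ N).
  by rewrite AE // rmorphXn mulrC mulKf // expf_neq0.
by apply: regular_homog hA (homogXin k i0 N) _; exact: pt_nX.
Qed.

Lemma ev_ratio p i0 (d : nat) (f : S) : ~ p 'X_i0 -> f \is d.-homog ->
  ev kappa i0 f = kappa f / kappa ('X_i0 ^+ d).
Proof.
move=> pi0 hf; have x0 := pt_cone pi0; rewrite (ev_homog x0 hf) rmorphXn.
by rewrite mulrC mulKf // expf_neq0.
Qed.

(** Division by t is repeated until the quotient is a unit. The second alternative records that this
    may never stop; [uniformizer_order] excludes it at closed points for z != 0. *)
Lemma uniformizer_power p t z : uniformizer p t -> regular_at p z ->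
  (exists (m : nat) u, unit_at p u /\ z = t ^+ m * u) \/
  (forall m : nat, exists2 w, regular_at p w & z = w * t ^+ m).
Proof.
move=> [t0 vt tdiv] rz; have [|N] := pselect (exists (m : nat) u, unit_at p u /\ z = t ^+ m * u).
  by left.
right; elim=> [|m [w rw E]]; first by exists z; rewrite ?mulr1.
case: (unit_or_vanishing rw) => [uw|/tdiv[w' rw' Ew]].
  by case: N; exists m, w; rewrite mulrC.
by exists w' => //; rewrite E Ew exprS mulrA.
Qed.

(** Two uniformizers divide each other and so differ by a unit: one of them suffices to check
    [has_order]. *)
Lemma has_order_of_uniformizer p z (m : int) t : uniformizer p t ->
  (exists2 u, unit_at p u & z = t ^ m * u) -> has_order p z m.
Proof.
move=> [t0 vt tdiv] [u uu Ez] t' [t'0 vt' t'div].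
have [w rw Ew] := tdiv _ vt'; have [w' rw' Ew'] := t'div _ vt.
have uw : unit_at p w.
  apply: unit_atP rw _; exists w' => //; apply: (mulIf t0).
  by rewrite -mulrA -Ew -Ew' mul1r.
exists (u / w ^ m); first by apply: unit_at_div => //; apply: unit_atXz.
have w0 : w != 0 by have [] := uw.
have := expfz_neq0 m w0; rewrite Ew expfzMl Ez.
exact: div_mul_swap.
Qed.

End LocalRing.

(** * Uniformizers at closed points *)

Section Curve.
Variables (k : finFieldType) (X : proj_variety k).
Hypotheses (hdim : var_dim X 1) (hsmooth : smooth_var X 1).
Local Notation n := (amb_dim X).
Local Notation I := (var_ideal X).
Local Notation S := {mpoly k[n.+1]}.
Local Notation F := (cone_field X).
Local Notation kappa := (@cone_elt k X).
Local Notation eta := (eta hdim).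
Implicit Types (p q : point X) (f g : S) (z w : F).

Definition frob_power (Q : nat) := exists2 r, (0 < r)%N & Q = (#|k| ^ r)%N.

(** For a form a of degree d in p, the Frobenius relation reads a (x_0^(d(Q-1)) - a^(Q-1)) = - sum_j
    h_j g_j. The bracket does not vanish at p and each g_j is a local multiple of g_j0, so g_j0 /
    x_0^Q divides a / b. The last clause serves at nearby points: wherever the factors delta do not
    vanish, a zero of g_j0 is a zero of every g_j. *)
Lemma closed_uniformizer p : closed_point_pred p -> exists i0 Q j0,
  [/\ ~ p 'X_i0, frob_power Q, uniformizer p (kappa (frob k i0 Q j0) / kappa ('X_i0 ^+ Q))
    & forall j, exists (e : nat) (delta w : S), [/\ delta \is e.-homog, w \is e.-homog, ~ p delta
      & delta * frob k i0 Q j - w * frob k i0 Q j0 \in I]].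
Proof.
move=> cp; have [i0 pi0] := hp_relevant (pt_prime p).
have [Q Q_pow pfr] := closed_frob cp pi0.
have [j0 [delta [pdelta rel]]] := frob_minor hsmooth pi0 Q_pow pfr.
have Q1 := frob_gt1 Q_pow.
set fr := frob k i0 Q in pfr rel *.
have {}rel j : exists (e : nat) (delta w : S), [/\ delta \is e.-homog, w \is e.-homog, ~ p delta
      & delta * fr j - w * fr j0 \in I].
  have [e pe] : exists e, ~ p (pihomog mdeg e delta).
    by apply/existsNP => /pt_components.
  have [w Iw] := rel j.
  exists e, (pihomog mdeg e delta), (pihomog mdeg e w); split=> //; try exact: pihomogP.
  have := var_homog (Q + e)%N Iw; rewrite raddfB /= ![_ * fr _]mulrC.
  by rewrite !(pihomogMl _ (frob_homog i0 Q_pow _)) ?leq_addr // addKn.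
exists i0, Q, j0; split=> //.
have x0 := pt_cone pi0; have [om omP] : exists om : 'I_n.+1 -> F, forall j,
    regular_at p (om j) /\ kappa (fr j) = om j * kappa (fr j0).
  have /choice[om omP] : forall j, exists om : F,
      regular_at p om /\ kappa (fr j) = om * kappa (fr j0).
    move=> j; have [e [d [w [hd hw pd]]]] := rel j.
    rewrite -cone_elt_eq0 rmorphB !rmorphM subr_eq0 => /eqP E.
    exists (kappa w / kappa d); split; first exact: regular_homog hw hd pd.
    by rewrite mulrAC -E mulrC mulKf // (pt_cone pd).
  by exists om.
have div z : vanishing_at p z -> exists2 w, regular_at p w &
    z = w * (kappa (fr j0) / kappa ('X_i0 ^+ Q)).
  move=> [d [a [b [ha hb pa pb ->]]]].
  have [h hh hE] := frob_homogE i0 Q_pow ha.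
  pose v : S := 'X_i0 ^+ (d * (Q - 1)) - a ^+ (Q - 1).
  have pv : ~ p v.
    move=> pv; have : p ('X_i0 ^+ (d * (Q - 1))).
      rewrite -['X_i0 ^+ _](subrK (a ^+ (Q - 1))); apply: ptD => //.
      by apply: ptXn => //; rewrite subn_gt0.
    exact: pt_nX.
  have hv : v \is (d * (Q - 1)).-homog by apply: rpredB; [exact: homogXin | exact: dhomogMn].
  have hvb : v * b \is (d * Q).-homog.
    have := dhomogM hv hb; rewrite addnC -mulnS subn1 prednK //; exact: ltnW.
  have v0 := pt_cone pv; have b0 := pt_cone pb.
  have Ea : kappa a * kappa v = - \sum_j kappa (h j) * om j * kappa (fr j0).
    rewrite -rmorphM mulrBr -exprS subn1 prednK ?(ltnW Q1) // -subn1 -opprB hE.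
    rewrite rmorphN rmorph_sum; congr (- _); apply: eq_bigr => j _ /=.
    by rewrite rmorphM -mulrA -(omP j).2.
  exists (\sum_j - (kappa (h j * 'X_i0 ^+ Q) / kappa (v * b) * om j)).
    apply: (sr_sum (regular_subring p)) => j _; apply: (sr_opp (regular_subring p)).
    apply: regularM; last by have [] := omP j.
    by apply: regular_homog (hh j) hvb _; exact: pt_nmul.
  have -> : kappa a / kappa b = (kappa a * kappa v) / kappa (v * b).
    by rewrite rmorphM invfM mulrA mulfK.
  rewrite Ea mulNr sumrN mulNr; congr (- _); rewrite !mulr_suml; apply: eq_bigr => j _.
  rewrite [kappa (h j * _)]rmorphM.
  have xQ0 : kappa ('X_i0 ^+ Q) != 0 by rewrite rmorphXn expf_neq0.
  set A := kappa (h j); set B := kappa (_ ^+ Q) in xQ0 *; set C := kappa (v * b).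
  set D := kappa (fr j0); set O := om j.
  have C0 : C != 0 by rewrite /C rmorphM mulf_neq0.
  exact: fraction_shuffle.
split=> //.
(* If g_j0 were zero on X, every function vanishing at p would be zero, whereas p contains a form
   outside I. *)
- rewrite mulf_neq0 ?invr_eq0 ?rmorphXn ?expf_neq0 //; apply/eqP => j0E.
  have [d [g [hg pg /negP[]]]] := closed_notin_I hdim cp.
  have [|w _] := div (kappa g / kappa ('X_i0 ^+ d)).
    by exists d, g, ('X_i0 ^+ d); split=> //; [exact: homogXin | exact: pt_nX].
  rewrite j0E mul0r mulr0 -cone_elt_eq0 => /eqP.
  by rewrite mulf_eq0 invr_eq0 rmorphXn (negPf (expf_neq0 _ x0)) orbF.
- exists Q, (fr j0), ('X_i0 ^+ Q); split=> //; first exact: frob_homog.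
    exact: homogXin.
  exact: pt_nX.
Qed.

End Curve.

(** * Orders of functions and finiteness of zeros *)

Lemma finite_of_injective (T : choiceType) (C : finType) (s : T -> C) (Z : T -> Prop) :
  (forall x y, Z x -> Z y -> s x = s y -> x = y) ->
  exists r : seq T, forall x, Z x -> x \in r.
Proof.
move=> inj; have /choice[o oP] : forall c, exists o : option T,
    forall x, Z x -> s x = c -> o = Some x.
  move=> c; have [[x [Zx sx]]|N] := pselect (exists x, Z x /\ s x = c).
    by exists (Some x) => y Zy sy; congr Some; apply: inj => //; rewrite sx.
  by exists None => x Zx sx; case: N; exists x.
exists (pmap o (enum C)) => x Zx; rewrite mem_pmap; apply/mapP; exists (s x).
  by rewrite mem_enum.
by rewrite (oP _ x).
Qed.

Lemma frob_exponent (Q a : nat) : (1 < Q)%N -> exists2 b, (b < Q)%N &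
  forall (K : fieldType) (y : K), y ^+ Q = y -> y ^+ a = y ^+ b.
Proof.
move=> Q1; elim/ltn_ind: a => a IHa; have [lt|le] := ltnP a Q; first by exists a.
have [|b ltb bE] := IHa (a - Q).+1; first by rewrite -addn1 -[X in (_ < X)%N](subnK le) ltn_add2l.
by exists b => // K y yQ; rewrite -bE // -{1}(subnK le) exprD yQ exprSr.
Qed.

(* Reducing exponents below Q gives finitely many representatives of         *)
(* the polynomial functions on the points with coordinates in F_Q.           *)
Lemma frob_reduction (k : fieldType) (n : nat) (i0 : 'I_n) (Q : nat) (f : {mpoly k[n]}) :
  (1 < Q)%N -> exists b : {ffun {ffun 'I_n -> 'I_Q} -> k},
  forall (K : fieldType) (phi : {rmorphism {mpoly k[n]} -> K}),
  (forall j, (phi 'X_j / phi 'X_i0) ^+ Q = phi 'X_j / phi 'X_i0) ->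
  ev phi i0 f = ev phi i0 (\sum_e b e *: \prod_j 'X_j ^+ e j).
Proof.
move=> Q1; have /choice[red redP] : forall a, exists b : 'I_Q,
    forall (K : fieldType) (y : K), y ^+ Q = y -> y ^+ a = y ^+ b.
  by move=> a; have [b ltb bE] := frob_exponent a Q1; exists (Ordinal ltb).
pose em (m : 'X_{1..n}) : {ffun 'I_n -> 'I_Q} := [ffun j => red (m j)].
exists [ffun e => \sum_(m <- msupp f | em m == e) f@_m] => K phi yQ.
have -> : \sum_e [ffun e => \sum_(m <- msupp f | em m == e) f@_m] e *:
     \prod_j ('X_j : {mpoly k[n]}) ^+ (e : {ffun 'I_n -> 'I_Q}) j =
     \sum_(m <- msupp f) f@_m *: \prod_j ('X_j : {mpoly k[n]}) ^+ em m j.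
  rewrite (eq_bigr (fun e : {ffun 'I_n -> 'I_Q} => \sum_(m <- msupp f | em m == e)
      f@_m *: \prod_j ('X_j : {mpoly k[n]}) ^+ e j)).
    rewrite (exchange_big_dep xpredT) //=; apply: eq_bigr => m _.
    by rewrite (eq_bigl (pred1 (em m))) ?big_pred1_eq // => e; rewrite /= eq_sym.
  by move=> e _; rewrite ffunE scaler_suml.
rewrite {1}(mpolyE f) !rmorph_sum; apply: eq_bigr => m _ /=.
rewrite -!mul_mpolyC !rmorphM /= mpolyXE_id !rmorph_prod; congr (_ * _).
apply: eq_bigr => j _; rewrite !rmorphXn /= evX ffunE; exact: redP.
Qed.

Lemma zeros_shuffle (K : fieldType) (A B T V x : K) : B != 0 -> V != 0 ->
  T / V * (A / B) * x * B * V = A * T * x.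
Proof. by move=> B0 V0; field; rewrite B0 V0. Qed.

Section Curve.
Variables (k : finFieldType) (X : proj_variety k).
Hypotheses (hdim : var_dim X 1) (hsmooth : smooth_var X 1).
Local Notation n := (amb_dim X).
Local Notation I := (var_ideal X).
Local Notation S := {mpoly k[n.+1]}.
Local Notation F := (cone_field X).
Local Notation kappa := (@cone_elt k X).
Local Notation eta := (eta hdim).
Implicit Types (p q : point X) (f g : S) (z w t : F).

(* If z were divisible by all powers of t, the homogeneous prime of such     *)
(* elements would lie strictly between I and p.                              *)
Lemma uniformizer_order p t z : closed_point_pred p -> uniformizer p t ->
  regular_at p z -> z != 0 -> exists (m : nat) u, unit_at p u /\ z = t ^+ m * u.
Proof.
move=> cp ut rz z0; case: (uniformizer_power ut rz) => // zdiv.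
have [t0 vt tdiv] := ut; have rt := vanishing_regular vt.
have rS := regular_subring p.
have [i0 pi0] := hp_relevant (pt_prime p); have x0 := pt_cone pi0.
pose deep w := forall m : nat, exists2 w', regular_at p w' & w = w' * t ^+ m.
pose P f := deep (ev kappa i0 f).
have deepM w w' : regular_at p w -> deep w' -> deep (w * w').
  by move=> rw dw' m; have [v rv ->] := dw' m; exists (w * v); rewrite ?mulrA //; apply: regularM.
(* Elements that are not deep are powers of t times units, and so is their product; a unit is not
   divisible by t. *)
have deepP w w' : regular_at p w -> regular_at p w' -> deep (w * w') -> deep w \/ deep w'.
  move=> rw rw' dww'; case: (uniformizer_power ut rw) => [[a [u [uu Ew]]]|]; last by left.
  case: (uniformizer_power ut rw') => [[b [v [uv Ew']]]|]; last by right.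
  have [x rx Ex] := dww' (a + b).+1; exfalso.
  have Euv : u * v = x * t.
    apply: (mulIf (expf_neq0 (a + b) t0)).
    by rewrite -[RHS]mulrA -exprS -Ex Ew Ew' exprD [RHS]mulrACA mulrC.
  have [uv0 _ ruv] := unit_atM uu uv.
  apply: (@vanishing_neq1 _ _ p); rewrite -(mulVf uv0) {2}Euv.
  by apply: regularMvanishing => //; apply: regularMvanishing.
have deep0 : deep 0 by move=> m; exists 0; rewrite ?mul0r //; exact: (sr_0 rS).
have PP : prime_pred P.
  split=> [|f g Pf Pg m|f g Pg|f g]; rewrite /P.
  - by rewrite rmorph0.
  - have [v rv Ev] := Pf m; have [v' rv' Ev'] := Pg m.
    by exists (v + v'); [exact: (sr_add rS) | rewrite rmorphD /= Ev Ev' mulrDl].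
  - by rewrite rmorphM; apply: deepM => //; exact: regular_ev.
  - by rewrite rmorphM; apply: deepP; exact: regular_ev.
have vP w : deep w -> vanishing_at p w.
  by move=> /(_ 1%N)[v rv ->]; exact: regularMvanishing.
have Pi0 : exists i, ~ P 'X_i.
  by exists i0; rewrite /P evX divff // => /vP/vanishing_neq1.
have qP f d : f \is d.-homog -> homog_part P f <-> P f := homog_part_homog (pp_0 PP).
have qI f : f \in I -> homog_part P f.
  move=> If d; rewrite /P (ev_ratio pi0 (pihomogP _ _ _)).
  by have /eqP -> : kappa (pihomog mdeg d f) == 0; [rewrite cone_elt_eq0 var_homog | rewrite mul0r].
pose q : point X := ProjPoint (homog_part_prime PP Pi0) qI.
have qp f : q f -> p f.
  move=> qf; apply: pt_components => d; have /vP := qf d.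
  rewrite (ev_ratio pi0 (pihomogP _ _ _)); apply: vanishing_homog.
  - exact: pihomogP.
  - exact: homogXin.
  - exact: pt_nX.
(* A closed q would equal p and contain the numerator a of t = a / b; then t times the unit given by
   b would be divisible by t^2, forcing b into p. *)
have qeta : q = eta.
  case: (point_cases hdim q) => // cq; exfalso.
  have [d [a [b [ha hb pa pb Et]]]] := vt.
  have /(qP _ _ ha)/(_ 2%N)[w rw] : q a by apply: cq qp _ pa.
  have evb0 : ev kappa i0 b != 0.
    by rewrite (ev_ratio pi0 hb) mulf_neq0 ?invr_eq0 ?(pt_cone pb) // rmorphXn expf_neq0.
  have -> : ev kappa i0 a = ev kappa i0 b * t.
    rewrite (ev_ratio pi0 ha) (ev_ratio pi0 hb) Et [RHS]mulrC mulrA divfK ?(pt_cone pb) //.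
  rewrite expr2 mulrA => /(mulIf t0) Eb; apply: pb.
  apply: (vanishing_homog hb (homogXin k i0 d)); first exact: pt_nX.
  by rewrite -(ev_ratio pi0 hb) Eb; exact: regularMvanishing.
have [d [a [b [ha hb pb Ez]]]] := rz.
suff : q a by rewrite qeta /= => /= Ia; move: z0; rewrite Ez mulf_eq0 cone_elt_eq0 Ia.
apply/(qP _ _ ha); rewrite /P; have -> : ev kappa i0 a = ev kappa i0 b * z.
  by rewrite (ev_ratio pi0 ha) (ev_ratio pi0 hb) Ez [RHS]mulrC mulrA divfK ?(pt_cone pb).
by apply: deepM => //; exact: regular_ev.
Qed.

Lemma has_order_exists p z : closed_point_pred p -> ratfun z -> z != 0 ->
  exists m, has_order p z m.
Proof.
move=> cp [d [a [b [ha hb Ib Ez]]]] z0.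
have [i0 [Q [j0 [pi0 _ ut _]]]] := closed_uniformizer hdim hsmooth cp.
set t := _ / _ in ut; have [t0 _ _] := ut.
have x0 := pt_cone pi0.
have ord f : f \is d.-homog -> kappa f != 0 -> exists (m : nat) u,
    unit_at p u /\ kappa f / kappa ('X_i0 ^+ d) = t ^+ m * u.
  move=> hf f0; apply: uniformizer_order => //.
    by apply: regular_homog hf (homogXin k i0 d) _; exact: pt_nX.
  by rewrite mulf_neq0 ?invr_eq0 // rmorphXn expf_neq0.
have a0 : kappa a != 0 by apply: contraNneq z0 => a0; rewrite Ez a0 mul0r.
have b0 : kappa b != 0 by rewrite cone_elt_eq0.
have [ma [ua [uua Ea]]] := ord _ ha a0; have [mb [ub [uub Eb]]] := ord _ hb b0.
exists (ma%:Z - mb%:Z); apply: has_order_of_uniformizer ut _.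
exists (ua / ub); first exact: unit_at_div.
have -> : z = (kappa a / kappa ('X_i0 ^+ d)) / (kappa b / kappa ('X_i0 ^+ d)).
  by rewrite Ez invf_div mulrA divfK // rmorphXn expf_neq0.
by rewrite Ea Eb expfzDr // -invr_expz -!exprnP mulf_div.
Qed.

(** A point is determined by the forms that vanish at it, and on points with coordinates in F_Q each
    form takes the values of one of finitely many reduced polynomials. So P is determined by the set
    of reduced polynomials that vanish at P. *)
Lemma frob_points_finite (i0 : 'I_n.+1) Q : frob_power k Q ->
  exists s : seq (closed_point X), forall P : closed_point X,
    ~ cp_point P 'X_i0 -> (forall j, cp_point P (frob k i0 Q j)) -> P \in s.
Proof.
move=> Q_pow; have Q1 := frob_gt1 Q_pow.
(* A f is a homogenization of f: its membership in p tests the vanishing of [ev phi i0 f] for every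
   residue map phi at p. *)
have /choice[A AP] : forall f, exists A : S, forall p, ~ p 'X_i0 ->
    forall (K : fieldType) (phi : {rmorphism S -> K}), (forall g, phi g = 0 <-> p g) ->
    p A <-> ev phi i0 f = 0.
  move=> f; have [N [A [hA AE]]] := ev_homogenize i0 f; exists A => p pi0 K phi phi0.
  have x0 : phi 'X_i0 != 0 by apply/eqP => /phi0.
  rewrite -phi0 (AE _ _ x0); split=> [/eqP|->]; last by rewrite mulr0.
  by rewrite mulf_eq0 (negPf (expf_neq0 _ x0)) => /eqP.
pose po (b : {ffun {ffun 'I_n.+1 -> 'I_Q} -> k}) : S := \sum_e b e *: \prod_j 'X_j ^+ e j.
pose Z (P : closed_point X) := ~ cp_point P 'X_i0 /\ forall j, cp_point P (frob k i0 Q j).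
pose s (P : closed_point X) : {set {ffun {ffun 'I_n.+1 -> 'I_Q} -> k}} :=
  finset.finset (fun b => `[< cp_point P (A (po b)) >]).
have [|r rP] := @finite_of_injective _ _ s Z; last by exists r => P *; apply: rP.
have main P f d : Z P -> f \is d.-homog -> forall b,
    (forall (K : fieldType) (phi : {rmorphism S -> K}),
    (forall j, (phi 'X_j / phi 'X_i0) ^+ Q = phi 'X_j / phi 'X_i0) ->
      ev phi i0 f = ev phi i0 (po b)) -> cp_point P f <-> b \in s P.
  move=> [Pi0 Pfr] hf b bE; have [K [phi phi0]] := residue_field (cp_point P).
  have x0 : phi 'X_i0 != 0 by apply/eqP => /phi0.
  have {}bE : ev phi i0 f = ev phi i0 (po b).
    apply: bE => j; have /phi0 := Pfr j; rewrite rmorphB rmorphXn rmorphM rmorphXn /=.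
    move=> /eqP; rewrite subr_eq0 => /eqP E; rewrite expr_div_n E.
    rewrite -{2}(subnK (ltnW Q1)) addn1 exprS invfM mulrA.
    by rewrite [in LHS]mulrAC mulfK ?expf_neq0.
  have -> : (b \in s P) = `[< cp_point P (A (po b)) >] by rewrite finset.in_set.
  rewrite -phi0 (ev_homog x0 hf) bE; split.
    move=> /eqP; rewrite mulf_eq0 (negPf (expf_neq0 _ x0)) => /eqP E.
    by apply/asboolP/(AP _ _ Pi0 _ _ phi0).
  by move=> /asboolP/(AP _ _ Pi0 _ _ phi0) ->; rewrite mulr0.
move=> P P' ZP ZP' Es; suff E : cp_point P = cp_point P'.
  case: P P' E {ZP ZP' Es} => P cP [P' cP'] /= E; case: P' / E cP' => cP'.
  by congr ClosedPoint; exact: Prop_irrelevance.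
apply: point_ext.
have hom f d : f \is d.-homog -> cp_point P f <-> cp_point P' f.
  move=> hf; have [b bE] := frob_reduction i0 f Q1.
  apply: iff_trans (main P f d ZP hf b bE) _; rewrite Es; apply: iff_sym.
  exact: main ZP' hf b bE.
by move=> f; split=> h; apply: pt_components => d;
  apply/(hom _ d (pihomogP _ _ _)); exact: pth.
Qed.

(** Near a closed zero q, f is a power of the uniformizer g_j0 / x_0^Q times a unit, so its zeros
    are zeros of g_j0, hence of every g_j, and [frob_points_finite] applies. *)
Lemma zeros_finite_near f d q : f \is d.-homog -> f \notin I ->
  exists (e : nat) (h : S), [/\ h \is e.-homog, ~ q h &
   exists s : seq (closed_point X), forall P : closed_point X, ~ cp_point P h -> cp_point P f -> P \in s].
Proof.
move=> hf If; have [qf|qf] := pselect (q f); last first.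
  by exists d, f; split=> //; exists [::].
case: (point_cases hdim q) => [cq|E]; last by move: qf; rewrite E /= => f_I; rewrite f_I in If.
have [i0 [Q [j0 [pi0 Q_pow ut rel]]]] := closed_uniformizer hdim hsmooth cq.
have [s sP] := frob_points_finite i0 Q_pow.
set t := _ / _ in ut; have [t0 _ _] := ut; have x0 := pt_cone pi0.
have xN0 m : kappa ('X_i0 ^+ m) != 0 by rewrite rmorphXn expf_neq0.
have f0 : kappa f != 0 by rewrite cone_elt_eq0.
have [| |m [u [uu Ef]]] := @uniformizer_order q t (kappa f / kappa ('X_i0 ^+ d)) cq ut.
- by apply: regular_homog hf (homogXin k i0 d) _; exact: pt_nX.
- by rewrite mulf_neq0 ?invr_eq0.
have [e [a [b [ha hb pb Eu]]]] : regular_at q u by have [] := uu.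
have pa : ~ q a.
  move=> pa; have [u0 _ ruV] := uu; apply: (@vanishing_neq1 _ _ q).
  by rewrite -(mulVf u0); apply: regularMvanishing => //; exists e, a, b.
have /choice[w wP] : forall j, exists w : nat * S * S, [/\ w.1.2 \is w.1.1.-homog,
    ~ q w.1.2 & w.1.2 * frob k i0 Q j - w.2 * frob k i0 Q j0 \in I].
  by move=> j; have [e' [dl [w [h1 h2 h3 h4]]]] := rel j; exists (e', dl, w).
(* h collects what must stay nonzero near q: the chart coordinate, both terms of the unit u = a / b,
   and the factors that tie each g_j to g_j0. *)
pose h := 'X_i0 * a * b * \prod_j (w j).1.2.
have hh : exists e', h \is e'.-homog.
  exists (1 + e + e + \sum_j (w j).1.1)%N; apply: dhomogM.
    by apply: dhomogM => //; apply: dhomogM => //; exact: homogXi.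
  apply: (big_ind2 (fun (g : S) c => g \is c.-homog)); first exact: dhomog1.
    by move=> g1 c1 g2 c2; exact: dhomogM.
  by move=> j _; have [] := wP j.
have [e' {}hh] := hh; exists e', h; split=> //.
  apply: pt_nmul; first by apply: pt_nmul => //; exact: pt_nmul.
  apply: (big_ind (fun g => ~ q g)); [exact: pt1 | exact: pt_nmul |].
  by move=> j _; have [] := wP j.
exists s => P Ph Pf.
have Phw : ~ cp_point P (\prod_j (w j).1.2) by move=> H; apply: Ph; exact: ptMl.
have Pi0 : ~ cp_point P 'X_i0 by move=> H; apply: Ph; do 3![apply: ptMr].
have Pa : ~ cp_point P a by move=> H; apply: Ph; do 2![apply: ptMr]; exact: ptMl.
have Pb : ~ cp_point P b by move=> H; apply: Ph; apply: ptMr; exact: ptMl.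
have Pj0 : cp_point P (frob k i0 Q j0).
  have /kappa_eq Irel : kappa (f * b * 'X_i0 ^+ (Q * m)) =
      kappa (a * frob k i0 Q j0 ^+ m * 'X_i0 ^+ d).
    have b0 := pt_cone pb.
    have Ekf : kappa f = t ^+ m * u * kappa ('X_i0 ^+ d) by rewrite -Ef divfK.
    rewrite !rmorphM /= Ekf Eu /t expr_div_n !rmorphXn /= exprM.
    by apply: zeros_shuffle => //; rewrite !expf_neq0.
  have := pt_above (cp_point P) Irel => /(ptB (ptMr ('X_i0 ^+ (Q * m)) (ptMr b Pf))).
  rewrite opprB addrC subrK => /ptM[/ptM[//|/ptX//]|/ptX//].
apply: sP => // j; have [_ _ Ij] := wP j.
have := pt_above (cp_point P) Ij => /(ptD (ptMl (w j).2 Pj0)); rewrite addrC subrK => /ptM[] // Pw.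
by case: Phw; rewrite (bigD1 j) //=; exact: ptMr.
Qed.

(* Quasi-compactness, phrased as an ideal: x is in A when all but finitely   *)
(* many zeros of f are zeros of x.                                           *)
Lemma zeros_finite f d : f \is d.-homog -> f \notin I ->
  exists s : seq (closed_point X), forall P : closed_point X, cp_point P f -> P \in s.
Proof.
move=> hf If.
pose A (x : S) := exists s : seq (closed_point X), forall P : closed_point X,
  cp_point P f -> P \notin s -> cp_point P x.
have A0 : A 0 by exists [::] => P _ _; exact: pt0.
have AD x y : A x -> A y -> A (x + y).
  move=> [s sP] [r rP]; exists (s ++ r) => P Pf; rewrite mem_cat negb_or.
  by move=> /andP[Ps Pr]; apply: ptD; [exact: sP | exact: rP].
have AM x y : A y -> A (x * y).
  by move=> [s sP]; exists s => P Pf Ps; apply: ptMl; exact: sP.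
have AI x : x \in I -> A x by move=> Ix; exists [::] => P _ _; exact: pt_above.
have AX i : exists s : seq (closed_point X), forall P : closed_point X,
    cp_point P f -> P \notin s -> cp_point P 'X_i.
  (* Otherwise a prime contains A and avoids x_i, which gives a point q of X; the form h found near
     q lies in A but not in q. *)
  apply: contrapT => Ni; have [|P PP [PA PXi]] := @prime_avoid S A 'X_i A0 AD AM.
    by move=> N [s sP]; apply: Ni; exists s => P Pf /(sP _ Pf)/ptX.
  have qI g : g \in I -> homog_part P g by move=> Ig e; apply/PA/AI/var_homog.
  pose q : point X := ProjPoint (homog_part_prime PP (ex_intro _ i PXi)) qI.
  have [e [h [hh qh [s sP]]]] := @zeros_finite_near f d q hf If.
  apply: qh => /=; apply/(homog_part_homog (pp_0 PP) hh); apply: PA.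
  by exists s => P' P'f P's; apply: contrapT => P'h; rewrite sP in P's.
have /choice[s sP] := AX; exists (flatten [seq s i | i <- enum 'I_n.+1]) => P Pf.
have [i Pi] := hp_relevant (pt_prime (cp_point P)).
apply/flattenP; exists (s i); first by apply: map_f; rewrite mem_enum.
by apply/negPn/negP => /(sP i P Pf).
Qed.

(** If z is not a root of unity, then z is not in k[z^-1], and [center] applied to z^-1 yields a
    point of X at which z is not regular. So z^M = 1, and z^(M-1) is a regular inverse. *)
Lemma global_regular_unit z : (forall p, regular_at p z) -> z != 0 ->
  forall p, unit_at p z.
Proof.
move=> rz z0 p; have [M M0 zM] : exists2 M, (0 < M)%N & z ^+ M = 1.
  apply: contrapT => Nroot; have zV0 : z^-1 != 0 by rewrite invr_eq0.
  have Ng (g : {poly k}) : z^-1^-1 != (map_poly (kappa \o @mpolyC _ k) g).[z^-1].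
    apply/eqP => /(root_of_unity (iota := kappa \o @mpolyC _ k) zV0)[M M0 E].
    by apply: Nroot; exists M => //; apply: invr_inj; rewrite -exprVn E invr1.
  have [|q [qpr qI qreg _]] := center _ zV0 Ng.
    by have [i Xi] := hp_relevant (pt_prime p); exists i; exact: pt_cone Xi.
  have {}qI f : f \in I -> q f.
    by move=> If; apply: qI => d; apply/eqP; rewrite cone_elt_eq0 var_homog.
  have [d [a [b [ha hb qb Ez]]]] := rz (ProjPoint qpr qI).
  by have := qreg _ _ _ ha hb qb; rewrite invrK Ez eqxx.
apply: unit_atP => //; exists (z ^+ M.-1); first by apply: (sr_exp (regular_subring p)).
by rewrite -exprSr prednK.
Qed.

End Curve.

(** * Sheaves of modules and the bundles L_D *)

Section Sheaves.
Variables (k : fieldType) (X : proj_variety k).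
Local Notation opens := (opens (fun f : {mpoly k[(amb_dim X).+1]} => f \in var_ideal X)).
Local Notation omodule := (omodule X).
Local Notation F := (cone_field X).

Lemma local_section_map (A B : point X -> F -> Prop) (U : opens) (f : F -> F) s :
  (forall q, U q -> forall z, A q z -> B q (f z)) ->
  @local_section k X A U s -> @local_section k X B U (fun q => f (s q)).
Proof.
move=> AB hs p; have [V [Vp [z hz]]] := hs p; exists V; split=> //; exists (f z) => q Vq.
by have [-> Az] := hz q Vq; split=> //; apply: AB => //; exact: svalP.
Qed.

Lemma mk_omorphism (E G : omodule) (f : forall U : opens, sec E U -> sec G U) :
  (forall U, linear (f U)) ->
  (forall (U V : opens) (h : osub V U) s, f V (res h s) = res h (f U s)) ->
  exists g : omorphism E G, forall U s, g U s = f U s.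
Proof.
move=> lin fres.
pose lf U : {linear sec E U -> sec G U} :=
  HB.pack (f U) (GRing.isLinear.Build _ _ _ _ (f U) (lin U)).
by exists (@OMorphism k X E G lf fres).
Qed.

Lemma oiso_refl (E : omodule) : oiso E E.
Proof.
have [|//|f fE] := @mk_omorphism E E (fun U s => s); first by move=> U a s t.
by exists f, f => U; split=> s; rewrite !fE.
Qed.

Lemma oiso_sym (E G : omodule) : oiso E G -> oiso G E.
Proof. by move=> [f [g fg]]; exists g, f => U; have [] := fg U. Qed.

Lemma oiso_trans (E G H : omodule) : oiso E G -> oiso G H -> oiso E H.
Proof.
move=> [f [f' ff]] [g [g' gg]].
have [||u uE] := @mk_omorphism E H (fun U s => g U (f U s)).
- by move=> U a s t; rewrite !linearP.
- by move=> U V h s; rewrite !omap_res.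
have [||v vE] := @mk_omorphism H E (fun U s => f' U (g' U s)).
- by move=> U a s t; rewrite !linearP.
- by move=> U V h s; rewrite !omap_res.
exists u, v => U; have [fK f'K] := ff U; have [gK g'K] := gg U.
by split=> s; rewrite uE vE ?gK ?fK ?f'K ?g'K.
Qed.

Lemma oiso_bij (E G : omodule) (f : omorphism E G) :
  (forall U, injective (f U)) -> (forall U y, exists x, f U x = y) -> oiso E G.
Proof.
move=> inj surj; pose g U y := projT1 (cid (surj U y)).
have gK U y : f U (g U y) = y by rewrite /g; case: cid.
have [||h hE] := @mk_omorphism G E g.
- by move=> U a s t; apply: inj; rewrite linearP !gK.
- by move=> U V h s; apply: inj; rewrite omap_res !gK.
exists f, h => U; split=> s; rewrite hE ?gK //; apply: inj; exact: gK.
Qed.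

Lemma oiso_osum (E E' G G' : omodule) : oiso E E' -> oiso G G' ->
  oiso (osum E G) (osum E' G').
Proof.
move=> [f [f' ff]] [g [g' gg]].
have [||u uE] := @mk_omorphism (osum E G) (osum E' G') (fun U s => (f U s.1, g U s.2)).
- by move=> U a s t; rewrite !linearP.
- by move=> U V h s; rewrite !omap_res.
have [||v vE] := @mk_omorphism (osum E' G') (osum E G) (fun U s => (f' U s.1, g' U s.2)).
- by move=> U a s t; rewrite !linearP.
- by move=> U V h s; rewrite !omap_res.
exists u, v => U; have [fK f'K] := ff U; have [gK g'K] := gg U.
by split=> -[s t]; rewrite uE vE /= ?gK ?fK ?f'K ?g'K.
Qed.

Lemma oiso_osumC (E G : omodule) : oiso (osum E G) (osum G E).
Proof.
have sw (A B : omodule) : exists u : omorphism (osum A B) (osum B A), forall U s, u U s = (s.2, s.1).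
  by apply: mk_omorphism.
have [u uE] := sw E G; have [v vE] := sw G E.
by exists u, v => U; split=> -[s t]; rewrite uE vE.
Qed.

Lemma vector_bundle_iso r (E G : omodule) : oiso E G -> vector_bundle r E -> vector_bundle r G.
Proof.
move=> [f [g fg]] vE p; have [U [Up [e eP]]] := vE p; exists U; split=> //.
exists (fun i => f U (e i)) => V h s.
have fe (a : 'I_r -> OX V) : \sum_i a i *: res h (f U (e i)) = f V (\sum_i a i *: res h (e i)).
  by rewrite linear_sum; apply: eq_bigr => i _; rewrite linearZ /= omap_res.
have [fK gK] := fg V; have [a [Ea ua]] := eP V h (g V s); exists a; split.
  by rewrite fe -Ea gK.
by move=> b; rewrite fe => Eb; apply: ua; rewrite Eb fK.
Qed.

Lemma line_bundleP (L : omodule) : line_bundle L <-> forall p : point X, exists U : opens,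
  U p /\ exists e : sec L U, forall (V : opens) (h : osub V U) (s : sec L V),
  exists! a : OX V, s = a *: res h e.
Proof.
split=> vL p; have [U [Up [e eP]]] := vL p; exists U; split=> //.
  exists (e ord0) => V h s; have [a [Ea ua]] := eP V h s; exists (a ord0); split.
    by rewrite Ea big_ord1.
  by move=> b Eb; rewrite (ua (fun=> b)) // big_ord1.
exists (fun=> e) => V h s; have [a [Ea ua]] := eP V h s; exists (fun=> a); split.
  by rewrite big_ord1.
move=> b; rewrite big_ord1 => Eb; apply/funext => i; rewrite ord1; exact: ua.
Qed.

Lemma osum_vector_bundle (L M : omodule) : line_bundle L -> line_bundle M ->
  vector_bundle 2 (osum L M).
Proof.
move=> /line_bundleP vL /line_bundleP vM p.
have [U [Up [e eP]]] := vL p; have [W [Wp [e' eP']]] := vM p.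
exists (open_cap U W); split=> //.
have hU : osub (open_cap U W) U by move=> ? [].
have hW : osub (open_cap U W) W by move=> ? [].
pose ee (i : 'I_2) : sec (osum L M) (open_cap U W) :=
  if i == ord0 then (res hU e, 0) else (0, res hW e').
exists ee => V h s.
have hVU : osub V U by move=> ? /h/hU.
have hVW : osub V W by move=> ? /h/hW.
have res0 (A : omodule) : res h (0 : sec A (open_cap U W)) = 0.
  by apply: (addrI (res h 0)); rewrite -resD !addr0.
have eeE (a : 'I_2 -> OX V) : \sum_i a i *: res h (ee i) =
    (a ord0 *: res hVU e, a (fintype.lift ord0 ord0) *: res hVW e').
  rewrite !big_ord_recl big_ord0 addr0 /ee /= /osum_res /= !res0.
  rewrite (res_comp hU h hVU) (res_comp hW h hVW).
  by congr pair; rewrite /= scaler0 ?addr0 ?add0r.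
have [a [Ea ua]] := eP V hVU s.1; have [b [Eb ub]] := eP' V hVW s.2.
exists (fun i => if i == ord0 then a else b); split.
  by rewrite eeE /= -Ea -Eb; case: s {Ea Eb ua ub}.
move=> c; rewrite eeE => E; apply/funext => i.
have [->|ne] := eqVneq i ord0; first by apply: ua; rewrite E.
have -> : i = fintype.lift ord0 ord0 by case: i ne => [[|[|//]] ?] // _; apply: val_inj.
by apply: ub; rewrite E.
Qed.

End Sheaves.

(** * Local generators of the bundles L_D *)

Section Generators.
Variables (k : finFieldType) (X : proj_variety k).
Hypotheses (hdim : var_dim X 1) (hsmooth : smooth_var X 1).
Local Notation I := (var_ideal X).
Local Notation S := {mpoly k[(amb_dim X).+1]}.
Local Notation F := (cone_field X).
Local Notation opens := (opens (fun f : S => f \in I)).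
Local Notation kappa := (@cone_elt k X).
Local Notation eta := (eta hdim).
Implicit Types (p q : point X) (z w e t u : F) (D E : divisor X).

Lemma closed_point_ext (P P' : closed_point X) : cp_point P = cp_point P' -> P = P'.
Proof.
case: P P' => P cP [P' cP'] /= E; case: P' / E cP' => cP'.
by congr ClosedPoint; exact: Prop_irrelevance.
Qed.

Lemma open_eta (U : opens) p : U p -> U eta.
Proof.
by move=> /open_setP[d [f [_ pf Uf]]]; apply: Uf => /= If; apply: pf; exact: pt_above.
Qed.

Lemma regular_eta z : regular_at eta z <-> ratfun z.
Proof.
split; first exact: regular_ratfun.
by move=> [d [a [b [ha hb Ib ->]]]]; exists d, a, b; split=> //; apply/negP.
Qed.

Lemma open_avoid_subproof (s : seq (closed_point X)) :
  zariski_open (fun q : point X => forall P, P \in s -> q <> cp_point P).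
Proof.
move=> q; elim: s => [_|P s IHs qs].
  by exists 0%N, 1; split=> //; [exact: dhomog1 | exact: pt1].
have [|d [f [hf qf fs]]] := IHs; first by move=> P' P's; apply: qs; rewrite inE P's orbT.
have [e [g [hg Pg qg]]] : exists (e : nat) (g : S), [/\ g \is e.-homog, cp_point P g & ~ q g].
  apply: contrapT => N; apply: (qs P); first by rewrite inE eqxx.
  have Pq g : cp_point P g -> q g.
    move=> Pg; apply: pt_components => e; apply: contrapT => qg; apply: N.
    by exists e, (pihomog mdeg e g); split=> //; [exact: pihomogP | exact: pth].
  by apply: point_ext => g; split=> [|/Pq//]; exact: (cp_closed Pq).
exists (d + e)%N, (f * g); split; [exact: dhomogM | exact: pt_nmul |].
move=> q' q'fg P'; rewrite inE => /orP[/eqP-> E|P's].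
  by apply: q'fg; rewrite E; exact: ptMl.
by apply: fs => // q'f; apply: q'fg; exact: ptMr.
Qed.
Definition open_avoid s : opens := Open (@open_avoid_subproof s).

(** The zeros and poles of z = a / b lie among the closed zeros of the form a b. *)
Lemma unit_almost_everywhere z : ratfun z -> z != 0 ->
  exists s : seq (closed_point X), forall q, open_avoid s q -> unit_at q z.
Proof.
move=> [d [a [b [ha hb Ib Ez]]]] z0.
have Ia : a \notin I.
  by rewrite -cone_elt_eq0; apply: contraNneq z0 => a0; rewrite Ez a0 mul0r.
have Iab : a * b \notin I by rewrite prime_idealrM negb_or Ia.
have [s sP] := zeros_finite hdim hsmooth (dhomogM ha hb) Iab.
exists s => q qs; have qab : ~ q (a * b).
  move=> qab; case: (point_cases hdim q) => [cq|Eq].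
    by apply: (qs (ClosedPoint cq)) => //; exact: sP.
  by move: qab; rewrite Eq; exact/negP.
have qa : ~ q a by move=> qa; apply: qab; exact: ptMr.
have qb : ~ q b by move=> qb; apply: qab; exact: ptMl.
split=> //; first by exists d, a, b.
by exists d, b, a; split=> //; rewrite Ez invf_div.
Qed.

(* e generates the stalk of L_D at q *)
Definition gen_at D q e := [/\ e != 0, ratfun e &
  forall (c : closed_point_pred q) t, uniformizer q t ->
    unit_at q (t ^ coeff (ClosedPoint c) D * e)].

Lemma uniformizer_ratio q t t' : uniformizer q t -> uniformizer q t' -> unit_at q (t / t').
Proof.
move=> ut ut'.
have [|u uu] := has_order_of_uniformizer ut (z := t) (m := 1) _ ut'.
  by exists 1; [exact: unit_at1 | rewrite mulr1].
by have [t'0 _ _] := ut' => ->; rewrite expr1z mulrC mulKf.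
Qed.

(** Reduces membership in L_D to regularity. At a closed point the existence of a uniformizer gives
    the quantified conditions content; at eta they are void, and regular means rational. *)
Lemma gen_atP D q e z : gen_at D q e -> (LD_at D q z <-> regular_at q (z / e)).
Proof.
move=> [e0 re ue]; split=> [[rz hz]|r].
  case: (point_cases hdim q) => [cq|->]; last first.
    by apply/regular_eta/ratfunM => //; exact: ratfunV.
  have [i0 [Q [j0 [_ _ ut _]]]] := closed_uniformizer hdim hsmooth cq.
  set t := _ / _ in ut; have [t0 _ _] := ut.
  have [_ _ rV] := ue cq t ut; have := regularM (hz cq t ut) rV.
  by rewrite -mulf_div divff ?mul1r // expfz_neq0.
have -> : z = z / e * e by rewrite divfK.
split=> [|c t ut]; first by apply: ratfunM => //; exact: regular_ratfun r.
by rewrite mulrCA; apply: regularM => //; have [] := ue c t ut.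
Qed.

Lemma gen_at_mem D q e : gen_at D q e -> LD_at D q e.
Proof.
by move=> ge; apply/(gen_atP _ ge); have [e0 _ _] := ge; rewrite divff //; exact: regular1.
Qed.

Lemma gen_at0 q : gen_at 0 q 1.
Proof.
split; [exact: oner_neq0 | exact: ratfun1 |].
by move=> c t ut; rewrite raddf0 expr0z mul1r; exact: unit_at1.
Qed.

Lemma gen_atB D E q e e' : gen_at D q e -> gen_at E q e' -> gen_at (D - E) q (e / e').
Proof.
move=> [e0 re ue] [e'0 re' ue']; split.
- by rewrite mulf_neq0 ?invr_eq0.
- by apply: ratfunM => //; exact: ratfunV.
- move=> c t ut; have [t0 _ _] := ut; rewrite raddfB /= expfzDr // -invr_expz.
  by rewrite mulrACA -invfM; exact: unit_at_div (ue c t ut) (ue' c t ut).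
Qed.

Lemma gen_atV E q e : gen_at E q e -> gen_at (- E) q e^-1.
Proof. by move=> /(gen_atB (gen_at0 q)); rewrite sub0r div1r. Qed.

Lemma gen_atM D E q e e' : gen_at D q e -> gen_at E q e' -> gen_at (D + E) q (e * e').
Proof. by move=> ge /gen_atV/(gen_atB ge); rewrite invrK opprK. Qed.

Lemma gen_at_unit D q e u : gen_at D q e -> unit_at q u -> gen_at D q (e * u).
Proof.
move=> [e0 re ue] uu; have [u0 ru _] := uu; split.
- exact: mulf_neq0.
- by apply: ratfunM => //; exact: regular_ratfun ru.
- by move=> c t ut; rewrite mulrA; apply: unit_atM => //; exact: ue.
Qed.

(** The sign is that of L_D, which allows poles along D: a function with divisor D has its inverse
    as a generator of L_D. *)
Lemma has_order_gen (P : closed_point X) D z : ratfun z -> z != 0 ->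
  has_order P z (coeff P D) <-> gen_at D P z^-1.
Proof.
move=> rz z0; split=> [oz|[_ _ uz]].
  split; [by rewrite invr_eq0 | exact: ratfunV |] => c t ut.
  have [t0 _ _] := ut; have [u uu Ez] := oz t ut.
  have -> : ClosedPoint c = P by exact: closed_point_ext.
  rewrite Ez invfM mulVKf ?expfz_neq0 //; exact: unit_atV.
move=> t ut; have [t0 _ _] := ut; exists (t ^ coeff P D / z)^-1.
  by have := uz (@cp_closed _ _ P) t ut; case: (P) => ? ? /unit_atV.
by rewrite invf_div mulrC divfK // expfz_neq0.
Qed.

(** At a closed p with D(p) = m the generator is t^(-m), valid off the support of D and the zeros
    and poles of t, except that p itself is kept. At eta, 1 works off the support of D. *)
Lemma gen_at_near D p : exists e (U : opens), U p /\ forall q, U q -> gen_at D q e.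
Proof.
have avoid (s : seq (closed_point X)) q (c : closed_point_pred q) :
    {subset dom D <= s} -> open_avoid s q -> coeff (ClosedPoint c) D = 0.
  move=> Ds qs; apply: coeff_outdom; apply/negP => /Ds H.
  by apply: (qs _ H).
case: (point_cases hdim p) => [cp|->]; last first.
  exists 1, (open_avoid (dom D)); split.
    by move=> P _ E; apply: (@eta_not_closed _ _ hdim); rewrite E; exact: cp_closed.
  move=> q qD; split; [exact: oner_neq0 | exact: ratfun1 |] => c t ut.
  by rewrite (avoid (dom D)) // expr0z mul1r; exact: unit_at1.
have [i0 [Q [j0 [_ _ ut _]]]] := closed_uniformizer hdim hsmooth cp.
set t := _ / _ in ut; have [t0 vt _] := ut.
have rt : ratfun t by exact: regular_ratfun (vanishing_regular vt).
have [s sP] := unit_almost_everywhere rt t0.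
pose m := coeff (ClosedPoint cp) D.
pose s' := [seq P <- dom D ++ s | P != ClosedPoint cp].
have rtX (j : nat) : ratfun (t ^+ j).
  by elim: j => [|j IHj]; [exact: ratfun1 | rewrite exprS; exact: ratfunM].
have tm0 : t ^ (- m) != 0 by exact: expfz_neq0.
have rtm : ratfun (t ^ (- m)).
  by case: (- m) => j; [exact: rtX | apply: ratfunV (rtX _); exact: expf_neq0].
exists (t ^ (- m)), (open_avoid s'); split.
  by move=> P; rewrite mem_filter => /andP[/eqP ne _] E; apply: ne; exact: closed_point_ext.
move=> q qs'; split=> // c t' ut'.
have [E|ne] := pselect (q = p).
  subst q; rewrite (Prop_irrelevance c cp) -/m.
  have [t'0 _ _] := ut'; rewrite -exprz_inv -expfzMl.
  by apply: unit_atXz; exact: uniformizer_ratio.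
have qs : open_avoid (dom D ++ s) q.
  move=> P Ps E; apply: (qs' P) => //; rewrite mem_filter Ps andbT.
  by apply/eqP => EP; apply: ne; rewrite E EP.
rewrite (avoid (dom D ++ s)) //; last by move=> P PD; rewrite mem_cat PD.
rewrite expr0z mul1r; apply/unit_atXz/sP => P Ps; apply: qs.
by rewrite mem_cat Ps orbT.
Qed.

Lemma gen_at_exists D q : exists e, gen_at D q e.
Proof. by have [e [U [Uq ge]]] := gen_at_near D q; exists e; exact: ge. Qed.

Lemma LD_atM2 D E q z w : LD_at D q z -> LD_at E q w -> LD_at (D + E) q (z * w).
Proof.
have [e ge] := gen_at_exists D q; have [e' ge'] := gen_at_exists E q.
move=> /(gen_atP _ ge) rz /(gen_atP _ ge') rw; apply/(gen_atP _ (gen_atM ge ge')).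
by rewrite -mulf_div; exact: regularM.
Qed.

Lemma LD_at_div D E q z e : gen_at E q e -> LD_at (D + E) q z <-> LD_at D q (z / e).
Proof.
move=> ge; have [e' ge'] := gen_at_exists D q.
rewrite (gen_atP _ (gen_atM ge' ge)) (gen_atP _ ge').
by rewrite invfM mulrA mulrAC.
Qed.

Definition LD_scal D E (U : opens) z (h : forall q, U q -> forall x, LD_at D q x -> LD_at E q (x * z))
    (s : LD_sec D U) : LD_sec E U := MkLD (asboolT (local_section_map h (LD_local s))).

Lemma LD_iso D E z : z != 0 -> (forall q x, LD_at D q x <-> LD_at E q (x * z)) ->
  oiso (LD D) (LD E).
Proof.
move=> z0 h; have hU (U : opens) q (_ : U q) x : LD_at D q x -> LD_at E q (x * z) by move=> /h.
have [||f fE] := @mk_omorphism _ _ (LD D) (LD E) (fun U s => LD_scal (hU U) s).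
- by move=> U a s t; apply: val_inj; apply/funext => q /=; rewrite mulrDl -mulrA.
- by move=> U V hV s; apply: val_inj; apply/funext => q.
apply: (oiso_bij (f := f)) => U s.
  move=> t; rewrite !fE => /(congr1 (@LD_fun _ _ _ _)) E'.
  apply: val_inj; apply/funext => q; have /= := congr1 (fun g => g q) E'.
  exact: mulIf.
have hV q (_ : U q) x : LD_at E q x -> LD_at D q (x * z^-1).
  by move=> Ex; apply/h; rewrite divfK.
exists (LD_scal hV s); rewrite fE; apply: val_inj; apply/funext => q /=.
by rewrite divfK.
Qed.

(** The isomorphism is multiplication by a function z with divisor D - E, as z^-1 generates
    L_(D-E). *)
Lemma LD_iso_principal D E : cl D = cl E -> oiso (LD D) (LD E).
Proof.
move=> /eqP; rewrite /cl -Quotient.idealrBE => /asboolP[z [rz z0 oz]].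
apply: (LD_iso z0) => q x.
have gz : gen_at (D - E) q z^-1.
  case: (point_cases hdim q) => [cq|->]; first exact: ((has_order_gen (ClosedPoint cq) (D - E) rz z0).1 (oz _)).
  split; [by rewrite invr_eq0 | exact: ratfunV |].
  by move=> c; case: (@eta_not_closed _ _ hdim).
have {1}-> : D = E + (D - E) by rewrite addrC subrK.
by have := LD_at_div E x gz; rewrite invrK.
Qed.

Lemma structure_sheaf_iso : oiso (structure_sheaf X) (LD 0).
Proof.
have LD0 q x : LD_at 0 q x <-> regular_at q x by rewrite (gen_atP _ (gen_at0 q)) divr1.
have h1 (U : opens) q (_ : U q) x : regular_at q x -> LD_at 0 q (idfun x) by move=> /LD0.
pose f (U : opens) (a : (OX U)^o) : LD_sec 0 U :=
  MkLD (asboolT (local_section_map (h1 U) (OX_local a))).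
have [||g gE] := @mk_omorphism _ _ (structure_sheaf X) (LD 0) f.
- by move=> U a s t; apply: val_inj; apply/funext => q.
- by move=> U V hV s; apply: val_inj; apply/funext => q.
apply: (oiso_bij (f := g)) => U s.
  move=> t; rewrite !gE => /(congr1 (@LD_fun _ _ _ _)) E'; exact: val_inj.
have h2 q (_ : U q) x : LD_at 0 q x -> regular_at q (idfun x) by move=> /LD0.
exists (MkOX (asboolT (local_section_map h2 (LD_local s))) : (OX U)^o).
by rewrite gE; apply: val_inj.
Qed.

(** Near each point s is a single rational function, and every nonempty open set contains eta, so
    this function is the value of s at eta. *)
Lemma section_const (A : point X -> F -> Prop) (U : opens) s : @local_section k X A U s ->
  forall x y, s x = s y.
Proof.
move=> hs; have main (he : U eta) x : s x = s (exist _ eta he).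
  have [V [Vp [z hz]]] := hs x; have [-> _] := hz x Vp.
  by have [-> _] := hz (exist _ eta he) (open_eta Vp).
by move=> x y; have he := open_eta (svalP x); rewrite (main he) (main he y).
Qed.

Lemma section_at (A : point X -> F -> Prop) (U : opens) s : @local_section k X A U s ->
  forall x, A (sval x) (s x).
Proof. by move=> hs x; have [V [Vx [z hz]]] := hs x; have [->] := hz x Vx. Qed.

Lemma LD_line_bundle D : line_bundle (LD D).
Proof.
apply/line_bundleP => p; have [e [U [Up ge]]] := gen_at_near D p; exists U; split=> //.
have [e0 _ _] := ge p Up.
have he : @local_section k X (LD_at D) U (fun=> e).
  move=> q; exists U; split; first exact: svalP.
  by exists e => r Ur; split=> //; exact/gen_at_mem/ge.
exists (MkLD (asboolT he) : sec (LD D) U) => V hV s.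
have h1 q (Vq : V q) x : LD_at D q x -> regular_at q (x / e).
  by move=> /(gen_atP _ (ge q (hV q Vq))).
exists (MkOX (asboolT (local_section_map h1 (LD_local s)))); split.
  by apply: val_inj; apply/funext => q /=; rewrite divfK.
move=> b Eb; apply: val_inj; apply/funext => q /=; rewrite Eb /= mulfK //.
Qed.

End Generators.

(** * The divisor of a line bundle *)

Section LineBundles.
Variables (k : finFieldType) (X : proj_variety k).
Hypotheses (hdim : var_dim X 1) (hsmooth : smooth_var X 1).
Local Notation I := (var_ideal X).
Local Notation S := {mpoly k[(amb_dim X).+1]}.
Local Notation F := (cone_field X).
Local Notation opens := (opens (fun f : S => f \in I)).
Local Notation eta := (eta hdim).
Implicit Types (p q r : point X) (U V W : opens).

Lemma OX_at V (a : OX V) (x y : {p : point X | V p}) : sval x = sval y ->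
  OX_fun a x = OX_fun a y.
Proof. by move=> /sig_pt_inj ->. Qed.

Lemma OX_congr V (a b : OX V) : a = b -> forall y, OX_fun a y = OX_fun b y.
Proof. by move=> ->. Qed.

Lemma OX_funM V (a b : OX V) y : OX_fun (a * b) y = OX_fun a y * OX_fun b y.
Proof. by []. Qed.

Lemma OX_funD V (a b : OX V) y : OX_fun (a + b) y = OX_fun a y + OX_fun b y.
Proof. by []. Qed.

Lemma OX_fun_res V W (h : osub W V) (a : OX V) y : OX_fun (OX_res h a) y = OX_fun a (incl h y).
Proof. by []. Qed.

Lemma divf_mulr_cancel (K : fieldType) (a b c : K) : c != 0 -> a * c / (b * c) = a / b.
Proof. by move=> c0; rewrite -mulf_div divff // mulr1. Qed.

Section OneBundle.
Variables (L : omodule X) (U : point X -> opens) (e : forall p, sec L (U p)).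
Hypothesis uU : forall p, U p p.
Hypothesis coord : forall p V (h : osub V (U p)) (s : sec L V),
  exists! a : OX V, s = a *: res h (e p).

Lemma coord_inj p V (h : osub V (U p)) (a b : OX V) :
  a *: res h (e p) = b *: res h (e p) -> a = b.
Proof.
move=> E; have [c [_ uc]] := coord h (a *: res h (e p)).
by rewrite -(uc a) // -(uc b).
Qed.

Lemma coord_ex p V (h : osub V (U p)) (s : sec L V) : exists a : OX V, s = a *: res h (e p).
Proof. by have [a [Ea _]] := coord h s; exists a. Qed.

Local Notation cap p q := (open_cap (U p) (U q)).
Let hl p q : osub (cap p q) (U p). Proof. by move=> ? []. Qed.
Let hr p q : osub (cap p q) (U q). Proof. by move=> ? []. Qed.

Definition trans p q : OX (cap p q) :=
  projT1 (cid (coord_ex (@hr p q) (res (@hl p q) (e p)))).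

Lemma transE p q V (hp : osub V (U p)) (hq : osub V (U q)) (hV : osub V (cap p q)) :
  res hp (e p) = OX_res hV (trans p q) *: res hq (e q).
Proof.
rewrite -(res_comp (@hl p q) hV hp) -(res_comp (@hr p q) hV hq) -resZ; congr res.
by rewrite /trans; case: cid.
Qed.

Let capE p q : cap p q eta.
Proof. by split; apply: open_eta (uU _). Qed.

(* the constant value of the transition function from e_p to e_q *)
Definition tv p q : F := OX_fun (trans p q) (exist _ eta (capE p q)).

Lemma tvE p q y : OX_fun (trans p q) y = tv p q.
Proof. exact: (section_const hdim (OX_local (trans p q))). Qed.

Lemma tv_regular p q x : U p x -> U q x -> regular_at x (tv p q).
Proof.
move=> px qx; have := section_at (OX_local (trans p q)) (exist _ x (conj px qx)).
by rewrite tvE.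
Qed.

Lemma tvM p q r : tv p q * tv q r = tv p r.
Proof.
pose V := open_cap (cap p q) (U r).
have hp : osub V (U p) by move=> ? [[]].
have hq : osub V (U q) by move=> ? [[]].
have hR : osub V (U r) by move=> ? [].
have hpq : osub V (cap p q) by move=> ? [].
have hqr : osub V (cap q r) by move=> ? [[]].
have hpr : osub V (cap p r) by move=> ? [[]].
have := transE hp hq hpq; rewrite (transE hq hR hqr) (transE hp hR hpr) scalerA.
move=> /coord_inj E; have Ve : V eta by split; [exact: capE | exact: open_eta (uU r)].
by have := OX_congr E (exist _ eta Ve); rewrite OX_funM !OX_fun_res !tvE => ->.
Qed.

Lemma tvV p q : tv p q * tv q p = 1.
Proof.
rewrite tvM; have h : osub (U p) (U p) by [].
have hV : osub (U p) (cap p p) by [].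
have := transE h h hV; rewrite -{1}[res h (e p)]scale1r => /coord_inj E.
by have := OX_congr E (exist _ p (uU p)); rewrite OX_fun_res tvE => <-.
Qed.

Lemma tv_neq0 p q : tv p q != 0.
Proof.
by apply: contra_eq_neq (tvV p q) => ->; rewrite mul0r eq_sym oner_eq0.
Qed.

Lemma tv_unit p q x : U p x -> U q x -> unit_at x (tv p q).
Proof.
move=> px qx; apply: unit_atP; first exact: tv_regular.
by exists (tv q p); [exact: tv_regular | exact: tvV].
Qed.

Local Notation psi := (tv eta).

Lemma psi_ratfun p : ratfun (psi p).
Proof.
by apply/(regular_eta hdim); apply: tv_regular; [exact: uU | exact: open_eta (uU p)].
Qed.

(** D(P) is the order of psi P at P. At a closed point of U eta both e_eta and e_P generate, so psi
    P is a unit; only finitely many closed points remain, by [zeros_finite]. On U p the functions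
    psi p and psi q differ by a unit at q. *)
Lemma psi_divisor : exists D : divisor X, forall p q, U p q -> gen_at D q (psi p)^-1.
Proof.
have [d [f [hf ef Uf]]] := open_setP (uU eta).
have If : f \notin I by apply/negP.
have [s sP] := zeros_finite hdim hsmooth hf If.
have /choice[m mP] : forall P : closed_point X, exists m, has_order P (psi P) m.
  move=> P; apply: (has_order_exists hdim hsmooth); [exact: cp_closed | exact: psi_ratfun |].
  exact: tv_neq0.
pose D : divisor X := \sum_(P <- undup s) << m P *g P >>.
have DP P : coeff P D = if P \in s then m P else 0.
  rewrite /D raddf_sum /= (eq_bigr (fun Q : closed_point X => m Q * (Q == P)%:R)); last first.
    by move=> Q _; rewrite coeffU.
  rewrite -mem_undup; case: ifPn => Ps.
    rewrite (bigD1_seq P) ?undup_uniq //= eqxx mulr1 big1 ?addr0 // => Q /negPf->.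
    by rewrite mulr0.
  rewrite big1_seq // => Q /andP[_ Qs]; case: eqP => [E|]; rewrite ?mulr0 //.
  by rewrite -E Qs in Ps.
have gP (P : closed_point X) : gen_at D P (psi P)^-1.
  apply: (has_order_gen P D (psi_ratfun P) (tv_neq0 _ _)).1.
  rewrite DP; case: ifPn => // Ps t ut; exists (psi P); last by rewrite expr0z mul1r.
  apply: tv_unit; last exact: uU.
  by apply: Uf => Pf; rewrite sP in Ps.
have gq q : gen_at D q (psi q)^-1.
  case: (point_cases hdim q) => [cq|->]; first exact: (gP (ClosedPoint cq)).
  split; [by rewrite invr_eq0 tv_neq0 | by apply: ratfunV (psi_ratfun _); exact: tv_neq0 |].
  by move=> c; case: (@eta_not_closed _ _ hdim).
exists D => p q pq; have := gen_at_unit (gq q) (tv_unit pq (uU q)).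
by rewrite -(tvM eta p q) invfM divfK // tv_neq0.
Qed.

Let capV V p : osub (open_cap V (U p)) V. Proof. by move=> ? []. Qed.
Let capU V p : osub (open_cap V (U p)) (U p). Proof. by move=> ? []. Qed.

Definition local_coord V (s : sec L V) p : OX (open_cap V (U p)) :=
  projT1 (cid (coord_ex (@capU V p) (res (@capV V p) s))).

Lemma local_coordE V (s : sec L V) p :
  res (@capV V p) s = local_coord s p *: res (@capU V p) (e p).
Proof. by rewrite /local_coord; case: cid. Qed.

(* the rational function s / e_eta *)
Definition rat_val V (s : sec L V) (y : {p : point X | V p}) : F :=
  OX_fun (local_coord s (sval y)) (exist _ (sval y) (conj (svalP y) (uU _))) / psi (sval y).

(** Independence of the chart: coordinates in the charts p and r differ by [trans p r], whose value
    is psi r / psi p by the cocycle relation. *)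
Lemma rat_valE V (s : sec L V) W (hV : osub W V) p (hU : osub W (U p)) (a : OX W) :
  res hV s = a *: res hU (e p) -> forall (y : {p : point X | V p}) (z : {p : point X | W p}),
  sval y = sval z -> rat_val s y = OX_fun a z / psi p.
Proof.
move=> Ea y z yz; rewrite /rat_val; set r := sval y.
pose W' := open_cap W (U r).
have hW : osub W' W by move=> ? [].
have hr' : osub W' (U r) by move=> ? [].
have hp' : osub W' (U p) by move=> ? [/hU].
have hpr : osub W' (cap p r) by move=> ? [/hU].
have hVr : osub W' (open_cap V (U r)) by move=> ? [/hV].
have hWV : osub W' V by move=> ? [/hV].
have Er : OX_res hVr (local_coord s r) *: res hr' (e r) =
    (OX_res hW a * OX_res hpr (trans p r)) *: res hr' (e r).
  rewrite -scalerA -(transE hp' hr' hpr) -(res_comp (@capU V r) hVr hr') -resZ -local_coordE.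
  by rewrite -(res_comp hU hW hp') -resZ -Ea !(res_comp _ _ hWV).
have W'r : W' r by split; [rewrite /r yz; exact: svalP | exact: uU].
have := OX_congr (coord_inj Er) (exist _ r W'r); rewrite OX_funM !OX_fun_res tvE => E.
 rewrite (OX_at _ (y := incl hVr (exist _ r W'r))) // E.
rewrite -(tvM eta p r) divf_mulr_cancel ?tv_neq0 //; congr (_ / _); exact: OX_at.
Qed.

(** The isomorphism is s |-> s / e_eta. In the chart at p its inverse is x |-> x psi_p e_p, and
    these preimages glue by the cocycle relation. *)
Lemma rat_val_iso D : (forall p q, U p q -> gen_at D q (psi p)^-1) -> oiso L (LD D).
Proof.
move=> gD.
have loc V (s : sec L V) : local_section (LD_at D) (rat_val s).
  move=> x; exists (open_cap V (U (sval x))); split; first by split; [exact: svalP | exact: uU].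
  exists (rat_val s x) => y Vy; set a := local_coord s (sval x).
  have Ex := rat_valE (local_coordE s (sval x)).
  rewrite (Ex x (exist _ (sval x) (conj (svalP x) (uU _)))) // (Ex y (exist _ _ Vy)) //.
  split; first by congr (_ / _); exact: (section_const hdim (OX_local a)).
  have gy := gD _ _ (proj2 Vy); apply/(gen_atP hdim hsmooth _ gy).
  rewrite invrK divfK ?tv_neq0 //.
  have -> : OX_fun a (exist _ (sval x) (conj (svalP x) (uU _))) = OX_fun a (exist _ _ Vy).
    exact: (section_const hdim (OX_local a)).
  exact: section_at (OX_local a) (exist _ _ Vy).
pose f V (s : sec L V) : LD_sec D V := MkLD (asboolT (loc V s)).
have at_ V (y : {p : point X | V p}) : open_cap V (U (sval y)) (sval y).
  by split; [exact: svalP | exact: uU].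
have [||g gE] := @mk_omorphism _ _ L (LD D) f.
- move=> V a s t; apply: val_inj; apply/funext => y.
  change (rat_val (a *: s + t) y = OX_fun a y * rat_val s y + rat_val t y).
  have Ey : res (@capV V (sval y)) (a *: s + t) = (OX_res (@capV V (sval y)) a *
      local_coord s (sval y) + local_coord t (sval y)) *: res (@capU V (sval y)) (e (sval y)).
    by rewrite resD resZ !local_coordE scalerDl scalerA.
  rewrite (rat_valE Ey (z := exist _ _ (at_ V y))) // OX_funD OX_funM OX_fun_res.
  rewrite (rat_valE (local_coordE s _) (z := exist _ _ (at_ V y))) //.
  rewrite (rat_valE (local_coordE t _) (z := exist _ _ (at_ V y))) //.
  by rewrite mulrDl mulrA; congr (_ * _ / _ + _); exact: OX_at.
- move=> V W h s; apply: val_inj; apply/funext => y /=.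
  have hWV : osub (open_cap W (U (sval y))) V by move=> ? [/h].
  have E := local_coordE (res h s) (sval y); rewrite (res_comp _ _ hWV) in E.
  rewrite (rat_valE E (z := exist _ _ (at_ W y))) // /rat_val; congr (_ / _).
  exact: OX_at.
apply: (oiso_bij (f := g)) => V s.
  move=> t; rewrite !gE => /(congr1 (@LD_fun _ _ _ _)) /= Est.
  pose J := {p : point X | V p}.
  apply: (@sec_eq _ _ L J (fun x => open_cap V (U (sval x))) V (fun x => @capV V (sval x))).
    by move=> x Vx; exists (exist _ x Vx); split=> //; exact: uU.
  move=> x; rewrite !local_coordE; congr (_ *: _); apply: val_inj; apply/funext => y /=.
  pose y' : {p : point X | V p} := exist _ (sval y) (proj1 (svalP y)).
  have := congr1 (fun h => h y') Est.
  rewrite (rat_valE (local_coordE s (sval x)) (z := y)) //.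
  rewrite (rat_valE (local_coordE t (sval x)) (z := y)) //.
  by move=> /(mulIf _) -> //; rewrite invr_eq0 tv_neq0.
have h1 p q (Vpq : open_cap V (U p) q) x : LD_at D q x -> regular_at q (x * psi p).
  move=> Dx; have pq : U p q by case: Vpq.
  by have := (gen_atP hdim hsmooth x (gD p q pq)).1 Dx; rewrite invrK.
pose a p : OX (open_cap V (U p)) := MkOX (asboolT (local_section_map (h1 p)
  (local_section_res (@capV V p) (LD_local s)))).
pose J := {p : point X | V p}.
have [||t tE] := @sec_glue _ _ L J (fun x => open_cap V (U (sval x))) V
    (fun x => @capV V (sval x)) _ (fun x => a (sval x) *: res (@capU V (sval x)) (e (sval x))).
- by move=> x Vx; exists (exist _ x Vx); split=> //; exact: uU.
- move=> [p pV] [q qV] W hi hj /=; rewrite !resZ.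
  have hp : osub W (U p) by move=> ? /hi[].
  have hq : osub W (U q) by move=> ? /hj[].
  have hpq : osub W (cap p q) by move=> x Wx; split; [exact: hp | exact: hq].
  rewrite (res_comp _ _ hp) (res_comp _ _ hq) (transE hp hq hpq) scalerA; congr (_ *: _).
  apply: val_inj; apply/funext => y.
  change (OX_fun (OX_res hi (a p) * OX_res hpq (trans p q)) y = OX_fun (OX_res hj (a q)) y).
  rewrite OX_funM !OX_fun_res tvE /= -mulrA tvM; congr (LD_fun s _ * _).
  exact: sig_pt_inj.
exists t; rewrite gE; apply: val_inj; apply/funext => y /=.
rewrite (rat_valE (tE y) (z := exist _ _ (at_ V y))) //= mulfK ?tv_neq0 //.
by congr LD_fun; exact: sig_pt_inj.
Qed.

End OneBundle.

Lemma line_bundle_LD (L : omodule X) : line_bundle L -> exists D, oiso L (LD D).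
Proof.
move=> /line_bundleP vL.
have /choice[u uP] : forall p, exists u : {U : opens & sec L U}, tag u p /\
    forall V (h : osub V (tag u)) (s : sec L V), exists! a : OX V, s = a *: res h (tagged u).
  by move=> p; have [U [Up [e eP]]] := vL p; exists (Tagged (fun U : opens => sec L U) e).
have uU p : tag (u p) p by have [] := uP p.
have coord p V (h : osub V (tag (u p))) (s : sec L V) :
  exists! a : OX V, s = a *: res h (tagged (u p)) by have [_] := uP p; exact.
have [D gD] := psi_divisor uU coord.
by exists D; exact: rat_val_iso gD.
Qed.

End LineBundles.

(** * Tensor products *)

Section LinearMaps.
Variables (R : pzRingType) (U V : lmodType R) (f : U -> V).
Hypothesis lf : linear f.

Lemma lin_add u v : f (u + v) = f u + f v.
Proof. by have := lf 1 u v; rewrite !scale1r. Qed.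
Lemma lin_scale a u : f (a *: u) = a *: f u.
Proof.
have f0 : f 0 = 0 by apply: (addrI (f 0)); rewrite -lin_add !addr0.
by have := lf a u 0; rewrite f0 !addr0.
Qed.

End LinearMaps.

Section Tensor.
Variables (k : fieldType) (X : proj_variety k).
Local Notation opens := (opens (fun f : {mpoly k[(amb_dim X).+1]} => f \in var_ideal X)).
Local Notation omodule := (omodule X).
Implicit Types (U V W : opens) (E L T M : omodule).

Lemma obil_swap E L M (c : obilinear E L M) V s (a : OX V) l :
  c V s (a *: l) = c V (a *: s) l.
Proof. by rewrite (lin_scale (obil_r c s)) (lin_scale (obil_l c l)). Qed.

Section Criterion.
Variables (E L T : omodule) (b : obilinear E L T).
Variables (U : point X -> opens) (e : forall p, sec L (U p)).
Hypothesis uU : forall p, U p p.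
Hypothesis e_gen : forall p V (h : osub V (U p)) (l : sec L V), exists a : OX V, l = a *: res h (e p).
Hypothesis b_inj : forall p V (h : osub V (U p)), injective (fun s => b V s (res h (e p))).
Hypothesis b_surj : forall p V (h : osub V (U p)) x, exists s, b V s (res h (e p)) = x.

Section Extension.
Variables (M : omodule) (c : obilinear E L M).

(** Writing l = a e_p moves the scalar a to the other argument, where b is injective; so c depends
    only on the value of b. *)
Lemma obil_factor p V (h : osub V (U p)) s l s' l' :
  b V s l = b V s' l' -> c V s l = c V s' l'.
Proof.
have [a ->] := e_gen h l; have [a' ->] := e_gen h l'.
by rewrite !obil_swap => /b_inj ->.
Qed.

Let capV V p : osub (open_cap V (U p)) V. Proof. by move=> ? []. Qed.
Let capU V p : osub (open_cap V (U p)) (U p). Proof. by move=> ? []. Qed.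

(** m is the image of x under the map T -> M induced by c. It is tested on every local expression of
    x as a pure tensor, so no choice enters and restriction is respected. *)
Definition is_image V (x : sec T V) (m : sec M V) := forall W (h : osub W V) s l,
  res h x = b W s l -> res h m = c W s l.

(** Linearity, compatibility with restriction and uniqueness of the induced map all reduce to
    comparing an image with a section that is computed locally by c. *)
Lemma is_image_unique V (x : sec T V) (m m' : sec M V) : is_image x m ->
  (forall p, V p -> exists W (h : osub W V), W p /\ exists s l,
    res h x = b W s l /\ res h m' = c W s l) -> m = m'.
Proof.
move=> im loc.
have /choice[u uP] : forall p : {p : point X | V p}, exists W : {W : opens & osub W V},
    projT1 W (sval p) /\ res (projT2 W) m = res (projT2 W) m'.
  move=> p; have [W [h [Wp [s [l [Ex Em]]]]]] := loc _ (svalP p).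
  exists (existT _ W h); split=> //=; rewrite Em; exact: im.
apply: (@sec_eq _ _ M _ (fun p => projT1 (u p)) V (fun p => projT2 (u p))).
  by move=> p Vp; exists (exist _ p Vp); have [] := uP (exist _ p Vp).
by move=> p; have [] := uP p.
Qed.

Lemma is_image_ex V (x : sec T V) : exists m, is_image x m.
Proof.
have ex (p : {p : point X | V p}) : exists s : sec E (open_cap V (U (sval p))),
    b _ s (res (@capU V (sval p)) (e (sval p))) = res (@capV V (sval p)) x by exact: b_surj.
pose s p := projT1 (cid (ex p)).
have sP p : b _ (s p) (res (@capU V (sval p)) (e (sval p))) = res (@capV V (sval p)) x.
  by rewrite /s; case: cid.
have [||m mP] := @sec_glue _ _ M {p : point X | V p} (fun p => open_cap V (U (sval p))) V
  (fun p => @capV V (sval p)) _ (fun p => c _ (s p) (res (@capU V (sval p)) (e (sval p)))).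
- by move=> p Vp; exists (exist _ p Vp); split=> //; exact: uU.
- move=> p q W hp hq; have hW : osub W (U (sval p)) by move=> ? /hp[].
  have hWV : osub W V by move=> ? /hp[].
  rewrite -!obil_res; apply: (obil_factor hW).
  by rewrite !obil_res !sP !(res_comp _ _ hWV).
exists m => W h t l Ex.
pose J := {p : point X | W p}.
have hj (p : J) : osub (open_cap W (U (sval p))) W by move=> ? [].
apply: (@sec_eq _ _ M J (fun p => open_cap W (U (sval p))) W hj).
  by move=> p Wp; exists (exist _ p Wp); split=> //; exact: uU.
move=> p; pose p' : {p : point X | V p} := exist _ (sval p) (h _ (svalP p)).
have hpp : osub (open_cap W (U (sval p))) (open_cap V (U (sval p'))).
  by move=> q [/h].
have hV : osub (open_cap W (U (sval p))) V by move=> q [/h].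
have hU : osub (open_cap W (U (sval p))) (U (sval p)) by move=> q [].
rewrite (res_comp h (hj p) hV) -(res_comp (@capV V (sval p')) hpp hV) mP -!obil_res.
apply: (obil_factor hU); rewrite !obil_res sP -Ex.
by rewrite (res_comp _ _ hV) (res_comp _ _ hV).
Qed.

Lemma otensor_extension : exists f : omorphism T M,
  (forall V s t, f V (b V s t) = c V s t) /\
  (forall g : omorphism T M, (forall V s t, g V (b V s t) = c V s t) ->
     forall V x, g V x = f V x).
Proof.
pose F V (x : sec T V) := projT1 (cid (is_image_ex x)).
have FP V x : is_image x (F V x) by rewrite /F; case: cid.
have locx V (x : sec T V) p : V p -> exists s, res (@capV V p) x = b _ s (res (@capU V p) (e p)).
  by move=> Vp; have [s <-] := b_surj (@capU V p) (res (@capV V p) x); exists s.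
have [||f fE] := @mk_omorphism _ _ T M F.
- move=> V a x y; apply: is_image_unique (FP _ _) _ => p Vp.
  have [s sx] := locx V x p Vp; have [t ty] := locx V y p Vp.
  exists (open_cap V (U p)), (@capV V p); split; first by split=> //; exact: uU.
  exists (OX_res (@capV V p) a *: s + t), (res (@capU V p) (e p)).
  rewrite !resD !resZ sx ty (FP _ _ _ _ _ _ sx) (FP _ _ _ _ _ _ ty).
  by rewrite (obil_l b) (obil_l c).
- move=> V W h x; apply: is_image_unique (FP _ _) _ => p Wp.
  have [s sx] := locx W (res h x) p Wp.
  exists (open_cap W (U p)), (@capV W p); split; first by split=> //; exact: uU.
  exists s, (res (@capU W p) (e p)); split=> //.
  have hV : osub (open_cap W (U p)) V by move=> ? [/h].
  by rewrite (res_comp h _ hV); apply: FP; rewrite -sx (res_comp h _ hV).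
exists f; split=> [V s t|g gP V x]; rewrite fE.
  apply: is_image_unique (FP _ _) _ => p Vp.
  have h : osub V V by []; exists V, h; split=> //; exists s, t; by rewrite !res_id.
apply/esym; apply: is_image_unique (FP _ _) _ => p Vp.
have [s sx] := locx V x p Vp.
exists (open_cap V (U p)), (@capV V p); split; first by split=> //; exact: uU.
exists s, (res (@capU V p) (e p)); split=> //.
by rewrite -omap_res sx gP.
Qed.

End Extension.

Lemma otensor_criterion : is_otensor E L T.
Proof. by exists b => M c; exact: otensor_extension. Qed.

End Criterion.

Lemma otensor_unique E L T T' : is_otensor E L T -> is_otensor E L T' -> oiso T T'.
Proof.
have fix1 E' L' A (b : obilinear E' L' A) :
    (forall (M : omodule) (c : obilinear E' L' M), exists f : omorphism A M,
      (forall U s t, f U (b U s t) = c U s t) /\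
      (forall g : omorphism A M, (forall U s t, g U (b U s t) = c U s t) ->
         forall U x, g U x = f U x)) ->
    forall h : omorphism A A, (forall U s t, h U (b U s t) = b U s t) -> forall U x, h U x = x.
  move=> bP h hb U x; have [f [_ uf]] := bP A b.
  have [|//|i iE] := @mk_omorphism _ _ A A (fun U s => s); first by move=> ? ? ? ?.
  rewrite (uf h hb) -{2}[x](iE U x); apply/esym; apply: uf => V s t; exact: iE.
have comp A B C (f : omorphism A B) (g : omorphism B C) :
    exists h : omorphism A C, forall U x, h U x = g U (f U x).
  apply: mk_omorphism => [U a x y|U V h s]; first by rewrite !linearP.
  by rewrite !omap_res.
move=> [b bP] [b' bP']; have [f [fb _]] := bP T' b'; have [g [gb _]] := bP' T b.
have [fg fgE] := comp _ _ _ f g; have [gf gfE] := comp _ _ _ g f.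
exists f, g => U; split=> x.
  by rewrite -fgE; apply: (fix1 _ _ _ _ bP) => V s t; rewrite fgE fb gb.
by rewrite -gfE; apply: (fix1 _ _ _ _ bP') => V s t; rewrite gfE gb fb.
Qed.

Lemma otensor_iso E L T E' L' T' : is_otensor E L T -> oiso E' E -> oiso L' L -> oiso T T' ->
  is_otensor E' L' T'.
Proof.
move=> [b bP] [u [u' uu]] [v [v' vv]] [w [w' ww]].
have [h1 h2 h3] : [/\ forall U t, linear (fun s => w U (b U (u U s) (v U t))),
    forall U s, linear (fun t => w U (b U (u U s) (v U t))) &
    forall U V (h : osub V U) s t, w V (b V (u V (res h s)) (v V (res h t))) =
      res h (w U (b U (u U s) (v U t)))].
  split=> [U t a x y|U s a x y|U V h s t].
  - by rewrite linearP (obil_l b) linearP.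
  - by rewrite linearP (obil_r b) linearP.
  - by rewrite !omap_res obil_res omap_res.
exists (OBilinear h1 h2 h3) => M c.
have [c1 c2 c3] : [/\ forall U t, linear (fun s => c U (u' U s) (v' U t)),
    forall U s, linear (fun t => c U (u' U s) (v' U t)) &
    forall U V (h : osub V U) s t, c V (u' V (res h s)) (v' V (res h t)) =
      res h (c U (u' U s) (v' U t))].
  split=> [U t a x y|U s a x y|U V h s t].
  - by rewrite linearP (obil_l c).
  - by rewrite linearP (obil_r c).
  - by rewrite !omap_res obil_res.
have [f [fb uf]] := bP M (OBilinear c1 c2 c3).
have [||g gE] := @mk_omorphism _ _ T' M (fun U x => f U (w' U x)).
- by move=> U a x y; rewrite !linearP.
- by move=> U V h s; rewrite !omap_res.
exists g; split=> [U s t|g' g'b U x].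
  have [uK _] := uu U; have [vK _] := vv U; have [wK _] := ww U.
  by rewrite gE /= wK fb /= uK vK.
have [||g'' g''E] := @mk_omorphism _ _ T M (fun U x => g' U (w U x)).
- by move=> V a y z; rewrite !linearP.
- by move=> V W h s; rewrite !omap_res.
have [_ w'K] := ww U; rewrite gE -{1}[x]w'K -g''E; apply: uf => V s t.
have [_ u'K] := uu V; have [_ v'K] := vv V.
by rewrite g''E /=; have /= := g'b V (u' V s) (v' V t); rewrite u'K v'K.
Qed.

End Tensor.

(** * Decomposable bundles of rank 2 *)

Lemma det2_inverse (K : fieldType) (w11 w12 w21 w22 z11 z12 z21 z22 : K) :
  w11 * z11 + w12 * z21 = 1 -> w11 * z12 + w12 * z22 = 0 ->
  w21 * z11 + w22 * z21 = 0 -> w21 * z12 + w22 * z22 = 1 ->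
  (w11 * w22 - w12 * w21) * (z11 * z22 - z12 * z21) = 1.
Proof.
move=> E11 E12 E21 E22.
transitivity ((w11 * z11 + w12 * z21) * (w21 * z12 + w22 * z22) -
  (w11 * z12 + w12 * z22) * (w21 * z11 + w22 * z21)); first by ring.
by rewrite E11 E22 E12 mul0r subr0 mulr1.
Qed.

(** The determinant after rewriting the matrix in generators a, b of the source summands and c, d of
    the target summands. *)
Lemma det2_rescale (K : fieldType) (z11 z12 z21 z22 a b c d : K) :
  (z11 * z22 - z12 * z21) * (a * b / (c * d)) =
  z11 * a / c * (z22 * b / d) - z12 * b / c * (z21 * a / d).
Proof. by rewrite invfM; ring. Qed.

Lemma quotient_rescale (K : fieldType) (x y z a b c d : K) : a != 0 -> b != 0 -> c != 0 -> d != 0 ->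
  z != 0 -> x * y / z = x * a / c * (y * b / d) / (z * (a * b / (c * d))).
Proof. by move=> a0 b0 c0 d0 z0; field; rewrite a0 b0 c0 d0 z0. Qed.

Lemma gen_rescale (K : fieldType) (z a c : K) : z != 0 -> a != 0 -> c != 0 ->
  z^-1 = a / c * (z * a / c)^-1.
Proof. by move=> z0 a0 c0; field; rewrite ?z0 ?a0 ?c0. Qed.

Section Classification.
Variables (k : finFieldType) (X : proj_variety k).
Hypotheses (hdim : var_dim X 1) (hsmooth : smooth_var X 1).
Local Notation I := (var_ideal X).
Local Notation S := {mpoly k[(amb_dim X).+1]}.
Local Notation F := (cone_field X).
Local Notation opens := (opens (fun f : S => f \in I)).
Local Notation eta := (eta hdim).
Local Notation gens := (gen_at_exists hdim hsmooth).
Local Notation genP := (gen_atP hdim hsmooth).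
Implicit Types (p q : point X) (U V W : opens) (a b c d A D : divisor X) (z : F).

Lemma LD_cst_local D U z : (forall q, U q -> LD_at D q z) ->
  @local_section k X (LD_at D) U (fun=> z).
Proof.
move=> h q; exists U; split; first exact: svalP.
by exists z => r Ur; split=> //; exact: h.
Qed.
Definition LD_cst D U z (h : forall q, U q -> LD_at D q z) : LD_sec D U :=
  MkLD (asboolT (LD_cst_local h)).

Definition LD_mul D A U (s : LD_sec D U) (l : LD_sec A U) : LD_sec (D + A) U :=
  MkLD (asboolT (local_section_op2 (@LD_atM2 k X hdim hsmooth D A) (LD_local s) (LD_local l))).

(** The pairing multiplies rational functions. Where e generates L_A, division by e inverts
    multiplication by e from L_a to L_(a+A), which is what [otensor_criterion] asks for. *)
Lemma LD_osum_tensor a b A : is_otensor (osum (LD a) (LD b)) (LD A)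
  (osum (LD (a + A)) (LD (b + A))).
Proof.
pose m U (s : (LD_sec a U * LD_sec b U)%type) (l : LD_sec A U) :
  prod (LD_sec (a + A) U) (LD_sec (b + A) U) := (LD_mul s.1 l, LD_mul s.2 l).
have m1 U l : linear (fun s => @m U s l).
  by move=> r s t; congr pair; apply: val_inj; apply/funext => y /=; rewrite mulrDl -mulrA.
have m2 U s : linear (@m U s).
  by move=> r l l'; congr pair; apply: val_inj; apply/funext => y /=; rewrite mulrDr mulrCA.
have m3 U V (h : osub V U) s l : @m V (osum_res (E := LD a) (F := LD b) h s) (LD_res h l) =
    osum_res (E := LD (a + A)) (F := LD (b + A)) h (@m U s l).
  by congr pair; apply: val_inj.
pose B : obilinear (osum (LD a) (LD b)) (LD A) (osum (LD (a + A)) (LD (b + A))) :=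
  @OBilinear k X (osum (LD a) (LD b)) (LD A) (osum (LD (a + A)) (LD (b + A))) m m1 m2 m3.
have /choice[u uP] : forall p, exists u : F * opens, u.2 p /\ forall q, u.2 q -> gen_at A q u.1.
  by move=> p; have [e [U [Up ge]]] := gen_at_near hdim hsmooth A p; exists (e, U).
have e0 p : (u p).1 != 0 by have [Up ge] := uP p; have [] := ge p Up.
have ge p q : (u p).2 q -> gen_at A q (u p).1 by have [_] := uP p; exact.
pose e p : sec (LD A) (u p).2 := LD_cst (fun q Uq => gen_at_mem hdim hsmooth (ge p q Uq)).
apply: (@otensor_criterion _ _ _ _ _ B (fun p => (u p).2) e).
- by move=> p; have [] := uP p.
- move=> p V h l.
  have h1 q (Vq : V q) x : LD_at A q x -> regular_at q (x / (u p).1).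
    by move=> /(genP _ (ge p q (h q Vq))).
  exists (MkOX (asboolT (local_section_map h1 (LD_local l)))).
  by apply: val_inj; apply/funext => y /=; rewrite divfK.
- move=> p V h [s1 s2] [t1 t2] /= [E1 E2].
  by congr pair; apply: val_inj; apply/funext => y;
    [have /= := congr1 (fun f => f y) E1 | have /= := congr1 (fun f => f y) E2]; apply: mulIf.
- move=> p V h [x1 x2].
  have h1 D q (Vq : V q) x : LD_at (D + A) q x -> LD_at D q (x / (u p).1).
    by move=> /(LD_at_div hdim hsmooth D x (ge p q (h q Vq))).
  exists (MkLD (asboolT (local_section_map (h1 a) (LD_local x1))),
          MkLD (asboolT (local_section_map (h1 b) (LD_local x2)))).
  by congr pair; apply: val_inj; apply/funext => y /=; rewrite divfK.
Qed.

(** z is g(e) / e for a generator e of L_a near eta. Sections are constant functions, so by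
    linearity this one value determines g on every open set. *)
Lemma LD_hom a c (g : omorphism (LD a) (LD c)) : exists z,
  (forall V (y : {p : point X | V p}) (s : LD_sec a V),
    LD_fun (g V s : LD_sec c V) y = z * LD_fun s y) /\
  (forall q x, LD_at a q x -> LD_at c q (z * x)).
Proof.
have [e [U [Ue ge]]] := gen_at_near hdim hsmooth a eta.
have [e0 _ _] := ge _ Ue.
pose s0 : sec (LD a) U := LD_cst (fun q Uq => gen_at_mem hdim hsmooth (ge q Uq)).
pose z := LD_fun (g U s0 : LD_sec c U) (exist _ eta Ue) / e.
have main V (y : {p : point X | V p}) (s : LD_sec a V) :
    LD_fun (g V s : LD_sec c V) y = z * LD_fun s y.
  pose W := open_cap V U.
  have hV : osub W V by move=> ? [].
  have hU : osub W U by move=> ? [].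
  have Ve : V eta by exact: open_eta (svalP y).
  have We : W eta by split.
  have h1 q (Wq : W q) x : LD_at a q x -> regular_at q (x / e).
    by move=> /(genP _ (ge q (hU q Wq))).
  pose r : OX W := MkOX (asboolT (local_section_map h1 (LD_local (LD_res hV s)))).
  have Es : res (o := LD a) hV s = r *: res hU s0.
    by apply: val_inj; apply/funext => x /=; rewrite divfK.
  have Eg : res (o := LD c) hV (g V s) = r *: res (o := LD c) hU (g U s0).
    by rewrite -!omap_res Es linearZ.
  have := congr1 (fun t : LD_sec c W => LD_fun t (exist _ eta We)) Eg.
  rewrite (section_const hdim (LD_local (g V s : LD_sec c V)) y (incl hV (exist _ eta We))).
  rewrite (section_const hdim (LD_local s) y (incl hV (exist _ eta We))) => /= ->.
  rewrite /z mulrAC [RHS]mulrAC [X in _ = X / _]mulrC; congr (_ * _ / _).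
  by congr LD_fun; exact: sig_pt_inj.
exists z; split=> // q x ax.
have [e' [U' [Uq ge']]] := gen_at_near hdim hsmooth a q.
have [e'0 _ _] := ge' _ Uq.
pose s1 : LD_sec a U' := LD_cst (fun q Uq => gen_at_mem hdim hsmooth (ge' q Uq)).
have := section_at (LD_local (g U' s1 : LD_sec c U')) (exist _ q Uq).
rewrite main /= => cz; have -> : z * x = (x / e') * (z * e') by rewrite mulrCA divfK.
by apply: LD_atM => //; apply/(genP _ (ge' _ Uq)).
Qed.

Lemma osum_component a b c d (f : omorphism (osum (LD a) (LD b)) (osum (LD c) (LD d))) :
  exists z11 z12 z21 z22, [/\
    forall V (y : {p : point X | V p}) (s : LD_sec a V) (t : LD_sec b V),
      LD_fun (f V (s, t)).1 y = z11 * LD_fun s y + z12 * LD_fun t y /\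
      LD_fun (f V (s, t)).2 y = z21 * LD_fun s y + z22 * LD_fun t y,
    (forall q x, LD_at a q x -> LD_at c q (z11 * x)) /\
    (forall q x, LD_at b q x -> LD_at c q (z12 * x))
  & (forall q x, LD_at a q x -> LD_at d q (z21 * x)) /\
    (forall q x, LD_at b q x -> LD_at d q (z22 * x))].
Proof.
have lin_l V r (s s' : LD_sec a V) : ((r *: s + s', 0) : sec (osum (LD a) (LD b)) V) =
    r *: ((s, 0) : sec (osum (LD a) (LD b)) V) + ((s', 0) : sec (osum (LD a) (LD b)) V).
  by congr pair; rewrite /= scaler0 addr0.
have lin_r V r (s s' : LD_sec b V) : ((0, r *: s + s') : sec (osum (LD a) (LD b)) V) =
    r *: ((0, s) : sec (osum (LD a) (LD b)) V) + ((0, s') : sec (osum (LD a) (LD b)) V).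
  by congr pair; rewrite /= scaler0 addr0.
have res_l V W (h : osub W V) (s : LD_sec a V) :
    ((LD_res h s, 0) : sec (osum (LD a) (LD b)) W) = res h ((s, 0) : sec (osum (LD a) (LD b)) V).
  by congr pair; apply: val_inj.
have res_r V W (h : osub W V) (s : LD_sec b V) :
    ((0, LD_res h s) : sec (osum (LD a) (LD b)) W) = res h ((0, s) : sec (osum (LD a) (LD b)) V).
  by congr pair; apply: val_inj.
have [||f11 E11] := @mk_omorphism _ _ (LD a) (LD c) (fun V s => (f V (s, 0)).1).
- by move=> V r s s'; rewrite lin_l linearP.
- by move=> V W h s; rewrite res_l omap_res.
have [||f12 E12] := @mk_omorphism _ _ (LD b) (LD c) (fun V s => (f V (0, s)).1).
- by move=> V r s s'; rewrite lin_r linearP.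
- by move=> V W h s; rewrite res_r omap_res.
have [||f21 E21] := @mk_omorphism _ _ (LD a) (LD d) (fun V s => (f V (s, 0)).2).
- by move=> V r s s'; rewrite lin_l linearP.
- by move=> V W h s; rewrite res_l omap_res.
have [||f22 E22] := @mk_omorphism _ _ (LD b) (LD d) (fun V s => (f V (0, s)).2).
- by move=> V r s s'; rewrite lin_r linearP.
- by move=> V W h s; rewrite res_r omap_res.
have [z11 [F11 R11]] := LD_hom f11; have [z12 [F12 R12]] := LD_hom f12.
have [z21 [F21 R21]] := LD_hom f21; have [z22 [F22 R22]] := LD_hom f22.
exists z11, z12, z21, z22; split=> // V y s t.
have -> : f V (s, t) = f V (s, 0) + f V (0, t).
  by rewrite -linearD; congr (f V _); congr pair; rewrite /= ?addr0 ?add0r.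
by rewrite -F11 -F12 -F21 -F22 E11 E12 E21 E22.
Qed.

Lemma regular_of_LD a c q z ea ec : gen_at a q ea -> gen_at c q ec ->
  (forall x, LD_at a q x -> LD_at c q (z * x)) -> regular_at q (z * ea / ec).
Proof. by move=> ga gc zac; apply/(genP _ gc)/zac/(gen_at_mem hdim hsmooth). Qed.

(* z1 * z2 / z is a global regular function, hence a unit everywhere, and    *)
(* therefore so are the normalised entries z1 and z2.                        *)
Lemma diagonal_classes a b c d z1 z2 z : z1 != 0 -> z2 != 0 -> z != 0 ->
  (forall q x, LD_at a q x -> LD_at c q (z1 * x)) ->
  (forall q x, LD_at b q x -> LD_at d q (z2 * x)) ->
  (forall q ea eb ec ed, gen_at a q ea -> gen_at b q eb -> gen_at c q ec -> gen_at d q ed ->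
    unit_at q (z * (ea * eb / (ec * ed)))) ->
  cl a = cl c /\ cl b = cl d.
Proof.
move=> z10 z20 z0 r1 r2 uz.
have hreg q : regular_at q (z1 * z2 / z).
  have [ea ga] := gens a q; have [eb gb] := gens b q.
  have [ec gc] := gens c q; have [ed gd] := gens d q.
  have [a0 _ _] := ga; have [b0 _ _] := gb; have [c0 _ _] := gc; have [d0 _ _] := gd.
  rewrite (quotient_rescale z1 z2 a0 b0 c0 d0 z0).
  have [_ _ ruz] := uz q _ _ _ _ ga gb gc gd.
  apply: regularM => //; apply: regularM.
    by apply: regular_of_LD ga gc _ => x; exact: r1.
  by apply: regular_of_LD gb gd _ => x; exact: r2.
have hunit q : unit_at q (z1 * z2 / z).
  apply: global_regular_unit hreg _ q; by rewrite !mulf_neq0 ?invr_eq0.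
have units q ea eb ec ed : gen_at a q ea -> gen_at b q eb -> gen_at c q ec -> gen_at d q ed ->
    unit_at q (z1 * ea / ec) /\ unit_at q (z2 * eb / ed).
  move=> ga gb gc gd; have uz' := uz q _ _ _ _ ga gb gc gd.
  have [a0 _ _] := ga; have [b0 _ _] := gb; have [c0 _ _] := gc; have [d0 _ _] := gd.
  have := unit_atM (hunit q) uz'; rewrite (quotient_rescale z1 z2 a0 b0 c0 d0 z0).
  have [z'0 _ _] := uz'; rewrite divfK // => u12.
  have rr1 : regular_at q (z1 * ea / ec) by apply: regular_of_LD ga gc _ => x; exact: r1.
  have rr2 : regular_at q (z2 * eb / ed) by apply: regular_of_LD gb gd _ => x; exact: r2.
  move: (z1 * ea / ec) (z2 * eb / ed) rr1 rr2 u12 => A B rr1 rr2 [u0 _ ru].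
  split; apply: unit_atP => //.
    by exists ((A * B)^-1 * B); [exact: regularM | rewrite -mulrA [B * A]mulrC mulVf].
  by exists ((A * B)^-1 * A); [exact: regularM | rewrite -mulrA mulVf].
(* Such a z' has divisor a' - c', because its inverse is ea / ec times a unit at each point. *)
have class a' c' z' : z' != 0 ->
    (forall q ea ec, gen_at a' q ea -> gen_at c' q ec -> unit_at q (z' * ea / ec)) ->
    cl a' = cl c'.
  move=> z'0 u'; apply/eqP; rewrite /cl -Quotient.idealrBE; apply/asboolP; exists z'.
  have rz' : ratfun z'.
    have [ea ga] := gens a' eta; have [ec gc] := gens c' eta.
    have [a0 ra _] := ga; have [c0 rc _] := gc.
    have [_ /(regular_ratfun) ru _] := u' eta _ _ ga gc.
    have -> : z' = (z' * ea / ec) * (ec / ea) by rewrite mulrA divfK // mulfK.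
    by apply: ratfunM => //; apply: ratfunM => //; exact: ratfunV.
  split=> // P; apply: (has_order_gen P (a' - c') rz' z'0).2.
  have [ea ga] := gens a' P; have [ec gc] := gens c' P.
  have [a0 _ _] := ga; have [c0 _ _] := gc.
  rewrite (gen_rescale z'0 a0 c0); apply: gen_at_unit; first exact: gen_atB.
  by apply: unit_atV; exact: u'.
split; apply: class.
- exact: z10.
- move=> q ea ec ga gc; have [eb gb] := gens b q; have [ed gd] := gens d q.
  by have [] := units q _ _ _ _ ga gb gc gd.
- exact: z20.
- move=> q eb ed gb gd; have [ea ga] := gens a q; have [ec gc] := gens c q.
  by have [] := units q _ _ _ _ ga gb gc gd.
Qed.

Lemma LD_osum_iso a b c d : oiso (osum (LD a) (LD b)) (osum (LD c) (LD d)) ->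
  (cl a = cl c /\ cl b = cl d) \/ (cl a = cl d /\ cl b = cl c).
Proof.
move=> [f [g fg]].
have [z11 [z12 [z21 [z22 [fE [r11 r12] [r21 r22]]]]]] := osum_component f.
have [w11 [w12 [w21 [w22 [gE [t11 t12] [t21 t22]]]]]] := osum_component g.
have [ea [U [Ue gea]]] := gen_at_near hdim hsmooth a eta.
have [eb [W [We geb]]] := gen_at_near hdim hsmooth b eta.
pose V := open_cap U W; have Ve : V eta by split.
have [a0 _ _] := gea _ Ue; have [b0 _ _] := geb _ We.
pose sa : LD_sec a V := LD_cst (fun q (Vq : V q) => gen_at_mem hdim hsmooth (gea q (proj1 Vq))).
pose sb : LD_sec b V := LD_cst (fun q (Vq : V q) => gen_at_mem hdim hsmooth (geb q (proj2 Vq))).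
pose y : {p : point X | V p} := exist _ eta Ve.
(* g f = 1 is read at eta; on (sa, 0) and (0, sb), whose entries are nonzero there, it gives the
   matrix identity W Z = 1. *)
have gf (s : LD_sec a V) (t : LD_sec b V) :
    LD_fun s y = w11 * (z11 * LD_fun s y + z12 * LD_fun t y) +
                 w12 * (z21 * LD_fun s y + z22 * LD_fun t y) /\
    LD_fun t y = w21 * (z11 * LD_fun s y + z12 * LD_fun t y) +
                 w22 * (z21 * LD_fun s y + z22 * LD_fun t y).
  have [fK _] := fg V; have [f1 f2] := fE V y s t.
  have := gE V y (f V (s, t)).1 (f V (s, t)).2.
  by rewrite -surjective_pairing fK f1 f2.
have := gf sa 0; rewrite /= !mulr0 !addr0 => -[Ea1 Ea2].
have := gf 0 sb; rewrite /= !mulr0 !add0r => -[Eb1 Eb2].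
have Edet : (w11 * w22 - w12 * w21) * (z11 * z22 - z12 * z21) = 1.
  apply: det2_inverse.
  - by apply: (mulIf a0); rewrite mul1r [RHS]Ea1 mulrDl !mulrA.
  - by apply: (mulIf b0); rewrite mul0r [RHS]Eb1 mulrDl !mulrA.
  - by apply: (mulIf a0); rewrite mul0r [RHS]Ea2 mulrDl !mulrA.
  - by apply: (mulIf b0); rewrite mul1r [RHS]Eb2 mulrDl !mulrA.
set dz := z11 * z22 - z12 * z21 in Edet *; set dw := w11 * w22 - w12 * w21 in Edet *.
have dz0 : dz != 0 by apply: contra_eq_neq Edet => ->; rewrite mulr0 eq_sym oner_eq0.
(* In local generators the determinants of f and of g are regular functions inverse to each
   other. *)
have udz q xa xb xc xd : gen_at a q xa -> gen_at b q xb -> gen_at c q xc -> gen_at d q xd ->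
    unit_at q (dz * (xa * xb / (xc * xd))).
  move=> ga gb gc gd.
  have [xa0 _ _] := ga; have [xb0 _ _] := gb; have [xc0 _ _] := gc; have [xd0 _ _] := gd.
  apply: unit_atP.
    rewrite /dz det2_rescale; apply: regularB; apply: regularM.
    - by apply: regular_of_LD ga gc _ => x; exact: r11.
    - by apply: regular_of_LD gb gd _ => x; exact: r22.
    - by apply: regular_of_LD gb gc _ => x; exact: r12.
    - by apply: regular_of_LD ga gd _ => x; exact: r21.
  exists (dw * (xc * xd / (xa * xb))).
    rewrite /dw det2_rescale; apply: regularB; apply: regularM.
    - by apply: regular_of_LD gc ga _ => x; exact: t11.
    - by apply: regular_of_LD gd gb _ => x; exact: t22.
    - by apply: regular_of_LD gd ga _ => x; exact: t12.
    - by apply: regular_of_LD gc gb _ => x; exact: t21.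
  by rewrite mulrACA Edet mul1r mulf_div [xc * xd * _]mulrC divff // !mulf_neq0.
(* One of the two products in a nonzero determinant is nonzero; the antidiagonal case is the
   diagonal one with the source summands exchanged. *)
have [/eqP|ne] := eqVneq (z11 * z22) 0; last first.
  left; move: ne; rewrite mulf_eq0 negb_or => /andP[n11 n22].
  exact: diagonal_classes n11 n22 dz0 r11 r22 udz.
move=> E; right; have : z12 * z21 != 0.
  by apply: contraNneq dz0 => E'; rewrite /dz E' (eqP E) subrr.
rewrite mulf_eq0 negb_or => /andP[n12 n21].
have [|Hbc Had] := diagonal_classes n12 n21 dz0 r12 r21; last by split.
by move=> q xb xa xc xd gb ga gc gd; rewrite [xb * xa]mulrC; exact: udz.
Qed.

(** Every twisting line bundle is some L_A, and the tensor product is unique up to isomorphism, so a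
    class is described by divisors alone. *)
Lemma bun_classE (E : omodule X) a b : oiso E (osum (LD a) (LD b)) -> forall E',
  bun_class E E' <-> exists A, oiso E' (osum (LD (a + A)) (LD (b + A))).
Proof.
move=> iE E'; split=> [[_ [L [lL tE']]]|[A iE']].
  have [A iL] := line_bundle_LD hdim hsmooth lL; exists A; apply: otensor_unique tE' _.
  exact: otensor_iso (LD_osum_tensor a b A) iE iL (oiso_refl _).
split.
  apply: vector_bundle_iso (oiso_sym iE') _.
  by apply: osum_vector_bundle; exact: LD_line_bundle.
exists (LD A); split; first exact: LD_line_bundle.
exact: otensor_iso (LD_osum_tensor a b A) iE (oiso_refl _) (oiso_sym iE').
Qed.

Lemma c_sheaf_iso D : oiso (osum (LD D) (structure_sheaf X)) (osum (LD D) (LD 0)).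
Proof. by apply: oiso_osum; [exact: oiso_refl | exact: structure_sheaf_iso]. Qed.

Lemma c_classE D E' : c_class D E' <-> exists A, oiso E' (osum (LD (D + A)) (LD A)).
Proof.
rewrite /c_class (bun_classE (c_sheaf_iso D)).
by split=> -[A i]; exists A; move: i; rewrite add0r.
Qed.

Lemma structure_sheaf_line_bundle : line_bundle (structure_sheaf X).
Proof.
exact: vector_bundle_iso (oiso_sym (structure_sheaf_iso hdim hsmooth)) (LD_line_bundle hdim hsmooth 0).
Qed.

(** An equality of classes gives a twist A with D ~ D' + A and 0 ~ A, or D ~ A and 0 ~ D' + A;
    subtracting eliminates A. *)
Lemma c_class_eq D D' : c_class D = c_class D' <-> cl D = cl D' \/ cl D = cl (- D').
Proof.
have cl0 a b : cl a = cl b <-> principal (a - b).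
  by rewrite /cl; split=> [/eqP|h]; [rewrite -Quotient.idealrBE | apply/eqP; rewrite -Quotient.idealrBE].
have clB a b a' b' : cl a = cl a' -> cl b = cl b' -> cl (a - b) = cl (a' - b').
  move=> /cl0 Ha /cl0 Hb; apply/cl0.
  have -> : a - b - (a' - b') = a - a' - (b - b').
    by rewrite !opprB addrACA [RHS]addrACA [- b - a']addrC.
  exact: (rpredB (S := principal_subgroup X) Ha Hb).
have clS a a' A : cl a = cl a' -> cl (a + A) = cl (a' + A).
  by move=> h; have := clB _ (- A) _ (- A) h erefl; rewrite !opprK.
split=> [E|].
  have : c_class D (osum (LD D) (LD 0)).
    by apply/c_classE; exists 0; rewrite addr0; exact: oiso_refl.
  rewrite E => /c_classE[A /LD_osum_iso[[E1 E2]|[E1 E2]]]; [left|right].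
    by have := clB _ _ _ _ E1 E2; rewrite subr0 addrK.
  have := clB _ _ _ _ E1 E2; rewrite subr0 => ->; congr cl.
  by rewrite opprD addrCA subrr addr0.
have sub D1 D2 : cl D1 = cl D2 -> forall E', c_class D1 E' -> c_class D2 E'.
  move=> h E' /c_classE[A i]; apply/c_classE; exists A; apply: oiso_trans i _.
  by apply: oiso_osum (oiso_refl _); apply: (LD_iso_principal hdim hsmooth); exact: clS.
have ext D1 D2 : (forall E', c_class D1 E' -> c_class D2 E') ->
    (forall E', c_class D2 E' -> c_class D1 E') -> c_class D1 = c_class D2.
  by move=> h12 h21; apply/funext => E'; apply/propext; split; [exact: h12 | exact: h21].
(* Exchanging the summands L_(D1+A) and L_A turns a twist by A for D1 into a twist by D1 + A for
   -D1. *)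
have opp D1 E' : c_class D1 E' -> c_class (- D1) E'.
  move=> /c_classE[A i]; apply/c_classE; exists (D1 + A); rewrite addKr.
  by apply: oiso_trans i (oiso_osumC _ _).
case=> h; first by apply: ext; apply: sub.
have -> : c_class D = c_class (- D') by apply: ext; apply: sub.
by apply: ext => E' /opp; rewrite ?opprK.
Qed.

End Classification.

Theorem proposition6p3 (k : finFieldType) (X : proj_variety k)
    (hdim : var_dim X 1) (hsmooth : smooth_var X 1)
    (hirr : geom_irreducible X) :
  exists c : Cl X -> PBun2dec X,
    [/\ forall D : divisor X, sval (sval (c (cl D))) = c_class D,
        forall y : PBun2dec X, exists x : Cl X, c x = y
      & forall (D : divisor X) (x : Cl X),
          c x = c (cl D) <-> x = cl D \/ x = cl (- D)].
Proof.
have vb D : vector_bundle 2 (osum (LD D) (structure_sheaf X)).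
  apply: osum_vector_bundle; first exact: LD_line_bundle.
  exact: structure_sheaf_line_bundle.
have pf1 (D : divisor X) : exists E, vector_bundle 2 E /\ c_class D = bun_class E by exists (osum (LD D) (structure_sheaf X)).
pose c1 (D : divisor X) : PBun2 X := exist _ (c_class D) (pf1 D).
have pf2 (D : divisor X) : exists E, [/\ vector_bundle 2 E, decomposable E & sval (c1 D) = bun_class E].
  exists (osum (LD D) (structure_sheaf X)); split=> //.
  exists (LD D), (structure_sheaf X); split.
  - exact: LD_line_bundle.
  - exact: structure_sheaf_line_bundle.
  - exact: oiso_refl.
pose c2 (D : divisor X) : PBun2dec X := exist _ (c1 D) (pf2 D).
have c2_eq D y : c_class D = sval (sval y) -> c2 D = y.
  by case: y => -[y p1] p2 /= E; do 2![apply: eq_exist => /=].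
have clK (x : Cl X) : cl (repr x) = x by exact: reprK.
(* The value is computed on a chosen representative; [c_class_eq] shows that it does not depend on
   the choice. *)
pose c (x : Cl X) := c2 (repr x).
have cE D : sval (sval (c (cl D))) = c_class D.
  by apply: (c_class_eq hdim hsmooth _ _).2; left; exact: clK.
exists c; split=> //.
- move=> y; have [E [_ [L [M [lL lM iE]]] Ey]] := svalP y.
  have [a iL] := line_bundle_LD hdim hsmooth lL.
  have [b iM] := line_bundle_LD hdim hsmooth lM.
  have {}iE : oiso E (osum (LD a) (LD b)) by apply: oiso_trans iE _; exact: oiso_osum.
  (* L_a (+) L_b is the twist of L_(a-b) (+) O by L_b, so twists of one by A are twists of the other
     by A - b or b + A. *)
  exists (cl (a - b)); apply: c2_eq; rewrite -/(c _) Ey -[LHS]/(sval (sval (c _))) cE.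
  apply/funext => E'; apply/propext.
  rewrite (c_classE hdim hsmooth) (bun_classE hdim hsmooth iE).
  split=> -[A i].
    by exists (A - b); rewrite [b + _]addrC subrK addrA addrAC.
  by exists (b + A); rewrite addrA subrK.
- move=> D x; rewrite -[x in X in _ <-> X]clK.
  rewrite -(c_class_eq hdim hsmooth); split=> [E|E].
    by rewrite -[RHS]cE -E.
  by apply: c2_eq; rewrite cE.
Qed.
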